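(* Let $p\ge1$ be an integer and let $f$ and $g$ be convex functions on $\mathbb{R}^d$ whose $p$-th derivatives are Lipschitz with constants $L_{p,f}$ and $L_{p,g}$ respectively, with $L_{p,f}<L_{p,g}$. Let $F=f+g$ have a minimizer $x^*$ and let $R=\|x_0-x^*\|$. Then the combination framework (described in the context) with $H_{p,f}=2L_{p,f}$ reaches a point $x_N$ with $F(x_N)-F(x^* )\le\varepsilon$ using $N_f$ computations of derivatives of $f$ and $N_g$ computations of derivatives of $g$, where $$N_f=\tilde O\left[\left(\frac{L_{p,f}R^{p+1}}{\varepsilon}\right)^{\frac2{3p+1}}\right],\qquad N_g=\tilde O\left[\left(\frac{L_{p,g}R^{p+1}}{\varepsilon}\right)^{\frac2{3p+1}}\right].$$
   Context: $\|\cdot\|$ is the Euclidean norm. A function $\Phi$ is $s$-uniformly convex with constant $\sigma$ if $\Phi(y)\ge\Phi(x)+\langle\nabla\Phi(x),y-x\rangle+\frac{\sigma}{s}\|y-x\|^s$ for all $x,y$. $\tilde O$ means up to logarithmic factors (including in $1/\varepsilon$). The Taylor model is $\Omega_p(\phi,x;y)=\phi(x)+\sum_{k=1}^p\frac1{k!}D^k\phi(x)[y-x]^k$. A ''computation of derivatives'' of a function is one call, at one point, to an oracle returning its derivatives up to order $p$. CATD with parameter $H$ applied to a sum $\phi+\gamma$ ($\phi$ convex with Lipschitz $p$-th derivative, $\gamma$ proper closed convex, the composite part) from $x_0$: set $A_0=0$, $y_0=x_0$. For $k=0,1,\dots$, compute a pair $\lambda_{k+1}>0$, $y_{k+1}$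 with $$\frac12\le\lambda_{k+1}\frac{H\|y_{k+1}-\tilde x_k\|^{p-1}}{(p-1)!}\le\frac p{p+1},\quad y_{k+1}=\operatorname{argmin}_y\Big\{\Omega_p(\phi,\tilde x_k;y)+\frac H{p!}\|y-\tilde x_k\|^{p+1}+\gamma(y)\Big\},$$ $$a_{k+1}=\frac{\lambda_{k+1}+\sqrt{\lambda_{k+1}^2+4\lambda_{k+1}A_k}}2,\quad A_{k+1}=A_k+a_{k+1},\quad\tilde x_k=\frac{A_k}{A_{k+1}}y_k+\frac{a_{k+1}}{A_{k+1}}x_k,$$ and set $x_{k+1}=x_k-a_{k+1}(\nabla\phi(y_{k+1})+\gamma'(y_{k+1}))$, with $\gamma'(y_{k+1})$ a subgradient of $\gamma$ at $y_{k+1}$ (the gradient if $\gamma$ is differentiable). CATD with restarts, for an objective $\phi+\gamma$ that is $s$-uniformly convex with constant $\sigma$ and has minimizer $x_*$: from a starting point $z_0$, with $R_0=\|z_0-x_*\|$ and $R_k=R_02^{-k}$, let $z_{k+1}$ be the output $y_{N_k}$ of CATD started at $z_k$ and run for $$N_k=\max\Big\{\Big\lceil\Big(\tfrac{s\,c_p L\,2^s}{\sigma}R_k^{p+1-s}\Big)^{2/(3p+1)}\Big\rceil,1\Big\}$$ steps, where $c_p=2^{p-1}(p+1)^{(3p+1)/2}/(p-1)!$ and $L$ is the constant $H$ used in CATD (a constant multiple of the Lipschitz constant of the $p$-th derivative of $\phi$). Combination framework for convex functions: (outer) run CATD (without restarts) for $F=f+g$ from $x_0$ with $\phi=f$, composite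 part $\gamma=g$ and $H=H_{p,f}$; (inner) each outer subproblem $$\min_y\Big(\Omega_p(f,\tilde x_k;y)+\frac{H_{p,f}}{p!}\|y-\tilde x_k\|^{p+1}+g(y)\Big)$$ is solved by CATD with restarts, applied to the whole subproblem objective (which is $(p+1)$-uniformly convex with Lipschitz $p$-th derivative), up to the desired accuracy, namely until the norm of the gradient of the subproblem objective at the returned point $\tilde y$ is at most $\frac1{4p(p+1)}\|\nabla F(\tilde y)\|$. Derivatives of $f$ are computed only at outer iterations; derivatives of $g$ are computed at the inner iterations.
   Formalization: Proved for L_{p,f}>0 and ε ≤ L_{p,f}R^{p+1}; each search for a pair (λ,y) may use a polylogarithmic number of trials, all counted; logarithms may involve derivative bounds at x_0; the point reached may be x_k, y_k or an inner restart point. *)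

(* Defs.v *)
From HB Require Import structures.
From mathcomp Require Import all_boot all_order all_algebra.
From mathcomp Require Import all_classical all_reals all_analysis.

Set Implicit Arguments.
Unset Strict Implicit.
Unset Printing Implicit Defensive.

Import Order.TTheory GRing.Theory Num.Theory.
Import numFieldNormedType.Exports.

Local Open Scope classical_set_scope.
Local Open Scope ring_scope.

Section Calculus.
Variables (R : realType) (d : nat).
Local Notation V := 'rV[R]_d.

(* The library norm on 'rV[R]_d is the max norm, hence these two. *)
Definition edot (x y : V) : R := \sum_(i < d) x 0 i * y 0 i.
Definition enorm (x : V) : R := Num.sqrt (edot x x).

(* D^k phi(x)[v_1, ..., v_k], with k = size vs, as an iterated directional
   derivative. *)
Fixpoint Dn (phi : V -> R) (vs : seq V) : V -> R :=
  if vs is v :: vs' then fun x => 'D_v (Dn phi vs') x else phi.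

Definition grad (phi : V -> R) (x : V) : V :=
  \row_(i < d) 'D_(delta_mx 0 i) phi x.

(* In finite dimension, phi is p times (Frechet) differentiable iff all the
   multilinear components of its derivatives of order < p are differentiable. *)
Definition ndifferentiable (p : nat) (phi : V -> R) : Prop :=
  forall (vs : seq V) (x : V), (size vs < p)%N -> differentiable (Dn phi vs) x.

(* phi is p times differentiable and D^p phi is L-Lipschitz for the operator
   norm of p-linear forms. *)
Definition lip_deriv (p : nat) (L : R) (phi : V -> R) : Prop :=
  ndifferentiable p phi /\
  forall (vs : seq V) (x y : V), size vs = p ->
    `|Dn phi vs x - Dn phi vs y| <= L * enorm (x - y) * \prod_(v <- vs) enorm v.

Definition convex_fun (phi : V -> R) : Prop := @convex_function R V setT phi.

Definition uniformly_convex (s : nat) (sigma : R) (phi : V -> R) : Prop :=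
  forall x y : V,
    phi x + edot (grad phi x) (y - x) + sigma / s%:R * enorm (y - x) ^+ s
      <= phi y.

Definition is_argmin (phi : V -> R) (x : V) : Prop := forall y, phi x <= phi y.

Definition taylor (p : nat) (phi : V -> R) (x y : V) : R :=
  phi x + \sum_(1 <= k < p.+1) (k`!%:R)^-1 * Dn phi (nseq k (y - x)) x.

End Calculus.

Section CATD.
Variables (R : realType) (d : nat).
Local Notation V := 'rV[R]_d.

Definition tensor_model (p : nat) (H : R) (phi gamma : V -> R) (c y : V) : R :=
  taylor p phi c y + H / p`!%:R * enorm (y - c) ^+ p.+1 + gamma y.

Definition catd_a (lam A : R) : R :=
  (lam + Num.sqrt (lam ^+ 2 + 4 * lam * A)) / 2.

Definition catd_mid (lam A : R) (x y : V) : V :=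
  let a := catd_a lam A in (A / (A + a)) *: y + (a / (A + a)) *: x.

Definition catd_window (p : nat) (H lam : R) (c y : V) : bool :=
  2^-1 <= lam * (H * enorm (y - c) ^+ p.-1 / (p.-1)`!%:R) <= p%:R / p.+1%:R.

(* [catd_run p H T phi gamma z n A x y m]: n iterations of CATD on phi + gamma
   started at z lead to A_n = A, x_n = x, y_n = y and use m computations of
   derivatives.  How an admissible pair (lambda, y) is searched for is left open:
   the midpoint depends on lambda, so each candidate lambda examined costs one
   computation, and t <= T candidates (the accepted one included) are examined
   in an iteration; one more computation is made at the new y.  Only a real
   valued, differentiable gamma is needed, so that gamma' is its gradient. *)
Inductive catd_run (p : nat) (H : R) (T : nat) (phi gamma : V -> R) (z : V) :
    nat -> R -> V -> V -> nat -> Prop :=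
| catd_start : catd_run p H T phi gamma z 0 0 z z 0
| catd_iter n A x y m lam y' t :
    catd_run p H T phi gamma z n A x y m ->
    0 < lam ->
    is_argmin (tensor_model p H phi gamma (catd_mid lam A x y)) y' ->
    catd_window p H lam (catd_mid lam A x y) y' ->
    (0 < t <= T)%N ->
    catd_run p H T phi gamma z n.+1
      (A + catd_a lam A)
      (x - catd_a lam A *: (grad phi y' + grad gamma y'))
      y' (m + t + 1).

(* The output after N iterations.  When x_n is an exact minimizer there may be
   no admissible pair to continue with (for instance when p >= 2 and z is the
   minimizer); CATD may then stop and return x_n. *)
Definition catd_output (p : nat) (H : R) (T : nat) (phi gamma : V -> R)
    (z : V) (N : nat) (z' : V) (m : nat) : Prop :=
  (exists A x, catd_run p H T phi gamma z N A x z' m) \/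
  (exists n A y, [/\ (n < N)%N, catd_run p H T phi gamma z n A z' y m
                   & is_argmin (fun v => phi v + gamma v) z']).

Definition catd_const (p : nat) : R :=
  2 ^+ p.-1 * p.+1%:R `^ ((3 * p + 1)%:R / 2) / (p.-1)`!%:R.

Definition restart_steps (p s : nat) (L sigma Rk : R) : nat :=
  maxn `|Num.ceil ((s%:R * catd_const p * L * 2 ^+ s / sigma
                     * Rk `^ (p.+1%:R - s%:R)) `^ (2 / (3 * p + 1)%:R))|%N 1.

End CATD.
Arguments catd_const {R} p.

Section Framework.
Variables (R : realType) (d : nat).
Local Notation V := 'rV[R]_d.

(* In both constructors A, x, y are the current A_k, x_k, y_k of the outer CATD,
   t counts the candidates examined so far in the search of the next pair, and
   nf, ng count the computations of derivatives of f and g made so far.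
   [Outer]: between two subproblems.  [Inner]: solving the subproblem for the
   candidate lambda = lam; z is the current restart point z_j. *)
Inductive fw_state : Type :=
| Outer (A : R) (x y : V) (t nf ng : nat)
| Inner (A : R) (x y : V) (lam : R) (j : nat) (z : V) (t nf ng : nat).

Definition fw_nf (s : fw_state) : nat :=
  match s with Outer _ _ _ _ nf _ => nf | Inner _ _ _ _ _ _ _ nf _ => nf end.

Definition fw_ng (s : fw_state) : nat :=
  match s with Outer _ _ _ _ _ ng => ng | Inner _ _ _ _ _ _ _ _ ng => ng end.

Definition fw_points (s : fw_state) : seq V :=
  match s with
  | Outer _ x y _ _ _ => [:: x; y]
  | Inner _ x y _ _ z _ _ _ => [:: x; y; z]
  end.

Definition subproblem (p : nat) (Hf : R) (f g : V -> R) (c : V) : V -> R :=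
  tensor_model p Hf f g c.

Definition accurate (p : nat) (Hf : R) (f g : V -> R) (c z : V) : bool :=
  enorm (grad (subproblem p Hf f g c) z)
    <= (4 * p * p.+1)%:R^-1 * enorm (grad (fun v => f v + g v) z).

(* One step of the combination framework.  The subproblem is solved by CATD with
   restarts with smooth part the whole subproblem objective, no composite part,
   CATD parameter Hin and uniform convexity constant sigma.
   - fw_try: choose a candidate lambda; derivatives of f and g at the midpoint,
     which is also the starting point z_0 of the restarts.
   - fw_restart: one restart, followed by a computation of grad f at the new
     point to test the accuracy (grad g is known there).  An accurate point
     which violates the condition on lambda may be refined further, which is
     charged to the search as a new candidate.
   - fw_accept: the pair (lam, z) becomes (lambda_{k+1}, y_{k+1}).
   - fw_reject: the search goes on with another candidate. *)
Inductive fw_step (p : nat) (f g : V -> R) (Hf sigma Hin : R) (T : nat) :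
    fw_state -> fw_state -> Prop :=
| fw_try A x y t nf ng lam :
    0 < lam -> (t < T)%N ->
    uniformly_convex p.+1 sigma (subproblem p Hf f g (catd_mid lam A x y)) ->
    lip_deriv p Hin (subproblem p Hf f g (catd_mid lam A x y)) ->
    fw_step p f g Hf sigma Hin T
      (Outer A x y t nf ng)
      (Inner A x y lam 0 (catd_mid lam A x y) t.+1 nf.+1 ng.+1)
| fw_restart A x y lam j z t nf ng zmin z' m :
    let c := catd_mid lam A x y in
    let acc := accurate p Hf f g c z in
    ~~ (acc && catd_window p Hf lam c z) ->
    (t + acc <= T)%N ->
    is_argmin (subproblem p Hf f g c) zmin ->
    catd_output p Hin T (subproblem p Hf f g c) (fun=> 0) z
      (restart_steps p p.+1 Hin sigma (enorm (c - zmin) / 2 ^+ j)) z' m ->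
    fw_step p f g Hf sigma Hin T
      (Inner A x y lam j z t nf ng)
      (Inner A x y lam j.+1 z' (t + acc) nf.+1 (ng + m))
| fw_accept A x y lam j z t nf ng :
    let c := catd_mid lam A x y in
    accurate p Hf f g c z -> catd_window p Hf lam c z ->
    fw_step p f g Hf sigma Hin T
      (Inner A x y lam j z t nf ng)
      (Outer (A + catd_a lam A)
             (x - catd_a lam A *: (grad f z + grad g z)) z 0 nf ng)
| fw_reject A x y lam j z t nf ng :
    let c := catd_mid lam A x y in
    accurate p Hf f g c z -> ~~ catd_window p Hf lam c z ->
    fw_step p f g Hf sigma Hin T
      (Inner A x y lam j z t nf ng) (Outer A x y t nf ng).

Definition fw_init (x0 : V) : fw_state := Outer 0 x0 x0 0 0 0.

(* One of the points at hand is an eps-solution. *)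
Definition eps_reached (F : V -> R) (xs : V) (eps : R) (s : fw_state) : Prop :=
  exists2 v, v \in fw_points s & F v - F xs <= eps.

(* [fw_exec stop ... s s']: the framework can go from s to s' without a state
   satisfying stop before s'. *)
Inductive fw_exec (stop : fw_state -> Prop)
    (p : nat) (f g : V -> R) (Hf sigma Hin : R) (T : nat) (s : fw_state) :
    fw_state -> Prop :=
| fw_exec0 : fw_exec stop p f g Hf sigma Hin T s s
| fw_execS s1 s2 : fw_exec stop p f g Hf sigma Hin T s s1 -> ~ stop s1 ->
    fw_step p f g Hf sigma Hin T s1 s2 ->
    fw_exec stop p f g Hf sigma Hin T s s2.

(* B bounds the derivatives of orders 2, ..., p of phi at x. *)
Definition deriv_bound (p : nat) (B : R) (phi : V -> R) (x : V) : Prop :=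
  forall vs : seq V, (2 <= size vs <= p)%N ->
    `|Dn phi vs x| <= B * \prod_(v <- vs) enorm v.

End Framework.

(* The logarithmic factor of the bounds; it is at least 1 when all the arguments
   are nonnegative. *)
Definition log_factor (R : realType) (eps R0 Lf Lg B : R) : R :=
  ln (expR 1 + eps^-1 + R0 + Lf^-1 + Lg + B).

(* The quantity under the O-tilde. *)
Definition rate (R : realType) (p : nat) (L R0 eps : R) : R :=
  (L * R0 ^+ p.+1 / eps) `^ (2 / (3 * p + 1)%:R).

(* Main.v *)
Require Import Defs.
From HB Require Import structures.
From mathcomp Require Import all_boot all_order all_algebra.
From mathcomp Require Import all_classical all_reals all_analysis.
From mathcomp Require Import ring lra zify.

(** CATD is analysed as an accelerated proximal extragradient method in the sense of
    Monteiro and Svaiter.  With v = grad F(y') and c the midpoint, the condition on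
    lambda and H >= 2 L give |lam v + y' - c| <= (4/7) |y' - c|, both for the exact
    minimizer of the model and for an accurate approximation of it.  Hence the
    potential A (F(y) - F(xs)) + |x - xs|^2 / 2 decreases at each step by a multiple
    of A' |y' - c|^2 / lam, and Hoelder's inequality turns this into
    A_N >= const N^((3p+1)/2) / (H R^(p-1)).  For an inner run c_p is large enough
    for the distance to the minimizer of the subproblem to be halved by each restart,
    so that J = O(log) restarts make the point accurate unless it is an eps-solution;
    here one needs a polynomial bound for the Lipschitz constant of the gradient of
    the subproblem near xs.  The outer run is bounded by the same growth of A_N.  An
    admissible lambda exists by the intermediate value theorem, as the minimizer of
    the model depends continuously on its center. *)

Set Implicit Arguments.
Unset Strict Implicit.
Unset Printing Implicit Defensive.

Import Order.TTheory GRing.Theory Num.Theory.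
Import numFieldNormedType.Exports.

Local Open Scope classical_set_scope.
Local Open Scope ring_scope.

(** * Euclidean norm and directional derivatives *)

(** The bound for [g] is the bound for [f] times the cost of one restart. Since the subproblem is
    uniformly convex of degree p+1, the exponent of R_k in the restart length is zero, and each
    restart takes about (Hin/sigma)^(2/(3p+1)) steps, a multiple of (Lg/Lf)^(2/(3p+1)); this factor
    turns [rate p Lf] into [rate p Lg]. The number 3p+1 itself is the sum of the two Hoelder
    exponents 2p+2 and p-1. Two regularity problems shape the first half. Derivatives are iterated
    directional ones and D^p is only Lipschitz, so their symmetry is needed in a form without
    continuity before a Taylor polynomial can be differentiated. And |y|^(p+1) may fail to be smooth
    at 0, so its derivatives are followed inside a class of homogeneous functions. In the framework
    an accurate point may still violate the condition on lambda; a value strictly inside the window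
    is therefore aimed at, which a number of halvings depending only on p then guarantees. The cost
    bounds come from an invariant of all executions, termination from an execution built step by
    step. *)

Section Euclid.
Context {R : realType} {d : nat}.
Implicit Types x y z u v : 'rV[R]_d.

Lemma edotC x y : edot x y = edot y x.
Proof. by apply: eq_bigr => i _; rewrite mulrC. Qed.

Lemma edotDl x y z : edot (x + y) z = edot x z + edot y z.
Proof. by rewrite -big_split; apply: eq_bigr => i _; rewrite mxE mulrDl. Qed.

Lemma edotZl (a : R) x y : edot (a *: x) y = a * edot x y.
Proof. by rewrite mulr_sumr; apply: eq_bigr => i _; rewrite mxE mulrA. Qed.

Lemma edotNl x y : edot (- x) y = - edot x y.
Proof. by rewrite -scaleN1r edotZl mulN1r. Qed.

Lemma edotDr x y z : edot z (x + y) = edot z x + edot z y.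
Proof. by rewrite !(edotC z) edotDl. Qed.

Lemma edotZr (a : R) x y : edot y (a *: x) = a * edot y x.
Proof. by rewrite !(edotC y) edotZl. Qed.

Lemma edotNr x y : edot y (- x) = - edot y x.
Proof. by rewrite !(edotC y) edotNl. Qed.

Lemma edot0l x : edot 0 x = 0.
Proof. by rewrite -(scale0r x) edotZl mul0r. Qed.

Lemma edot0r x : edot x 0 = 0.
Proof. by rewrite edotC edot0l. Qed.

Definition edotE := (edotDl, edotDr, edotNl, edotNr, edotZl, edotZr).

Lemma edot_ge0 x : 0 <= edot x x.
Proof. by apply: sumr_ge0 => i _; rewrite -expr2 sqr_ge0. Qed.

Lemma enorm_ge0 x : 0 <= enorm x.
Proof. exact: sqrtr_ge0. Qed.

Lemma enorm_sqr x : enorm x ^+ 2 = edot x x.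
Proof. by rewrite sqr_sqrtr ?edot_ge0. Qed.

Lemma edot_eq0 x : edot x x = 0 -> x = 0.
Proof.
move=> /eqP; rewrite psumr_eq0 => [|i _]; last by rewrite -expr2 sqr_ge0.
move=> /allP h; apply/rowP => i; rewrite mxE.
by have := h i; rewrite mem_index_enum => /(_ isT) /=; rewrite mulf_eq0 orbb => /eqP.
Qed.

Lemma enorm_eq0 x : enorm x = 0 -> x = 0.
Proof. by move=> h; apply: edot_eq0; rewrite -enorm_sqr h expr0n. Qed.

Lemma enorm0 : enorm (0 : 'rV[R]_d) = 0.
Proof. by rewrite /enorm edot0l sqrtr0. Qed.

Lemma enorm_gt0 x : x != 0 -> 0 < enorm x.
Proof.
by move=> x0; rewrite lt_def enorm_ge0 andbT; apply: contra_neq x0 => /enorm_eq0.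
Qed.

Lemma enormZ (a : R) x : enorm (a *: x) = `|a| * enorm x.
Proof. by rewrite /enorm edotZl edotZr mulrA -expr2 sqrtrM ?sqr_ge0// sqrtr_sqr. Qed.

Lemma enormN x : enorm (- x) = enorm x.
Proof. by rewrite -scaleN1r enormZ normrN1 mul1r. Qed.

Lemma enormB x y : enorm (x - y) = enorm (y - x).
Proof. by rewrite -enormN opprB. Qed.

(** Cauchy-Schwarz, from the nonnegative square of |y|^2 x - <x,y> y, a multiple that avoids
    division. *)
Lemma edot_le x y : edot x y <= enorm x * enorm y.
Proof.
have [->|y0] := eqVneq y 0; first by rewrite edot0r enorm0 mulr0.
have ny := enorm_gt0 y0; have nx := enorm_ge0 x.
have := edot_ge0 (enorm y ^+ 2 *: x - edot x y *: y).
rewrite !edotE -!enorm_sqr (edotC y x).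
set a := enorm x in nx *; set b := enorm y in ny *; set t := edot x y => h.
have : 0 <= b ^+ 2 * ((a * b) ^+ 2 - t ^+ 2) by nra.
rewrite pmulr_rge0 ?exprn_gt0// subr_ge0 => h2.
have ab : 0 <= a * b by rewrite mulr_ge0// ltW.
by rewrite leNgt; apply/negP => lt; nra.
Qed.

Lemma normr_edot_le x y : `|edot x y| <= enorm x * enorm y.
Proof.
rewrite ler_norml edot_le andbT -[in X in X <= _]enormN -(opprK (edot x y)) lerN2 -edotNl.
exact: edot_le.
Qed.

Lemma enormD x y : enorm (x + y) <= enorm x + enorm y.
Proof.
rewrite -ler_sqr ?nnegrE ?addr_ge0 ?enorm_ge0// enorm_sqr !edotE -!enorm_sqr (edotC y x).
have := edot_le x y; nra.
Qed.

Lemma enorm_dist x y : `|enorm x - enorm y| <= enorm (x - y).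
Proof.
have h1 := enormD (x - y) y; have h2 := enormD (y - x) x.
rewrite !subrK in h1 h2; rewrite (enormB y x) in h2.
by rewrite ler_norml; apply/andP; split; lra.
Qed.

Lemma enorm_tri z x y : enorm (x - y) <= enorm (x - z) + enorm (z - y).
Proof. by have := enormD (x - z) (z - y); rewrite addrA subrK. Qed.

Lemma edot_delta x i : edot x (delta_mx 0 i) = x 0 i.
Proof.
rewrite /edot (bigD1 i) //= !mxE !eqxx mulr1 big1 ?addr0// => j ji.
by rewrite !mxE eqxx (negbTE ji) mulr0.
Qed.

Lemma enorm_delta i : enorm (delta_mx 0 i : 'rV[R]_d) = 1.
Proof. by rewrite /enorm edot_delta !mxE !eqxx sqrtr1. Qed.

Lemma coord_le_norm x i : `|x 0 i| <= `|x|.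
Proof.
by rewrite [leRHS]/Num.norm /= mx_normrE; apply/bigmax_geP; right => /=; exists (0, i).
Qed.

Lemma norm_le_enorm x : `|x| <= enorm x.
Proof.
rewrite [leLHS]/Num.norm /= mx_normrE; apply: bigmax_le => [|[i j] _]; first exact: enorm_ge0.
rewrite /= ord1 -edot_delta; apply: (le_trans (normr_edot_le _ _)).
by rewrite enorm_delta mulr1.
Qed.

Lemma enorm_le_norm x : enorm x <= d%:R * `|x|.
Proof.
have h : enorm x = enorm (\sum_i x 0 i *: (delta_mx 0 i : 'rV[R]_d)).
  by rewrite {1}(row_sum_delta x).
rewrite h; apply: (@le_trans _ _ (\sum_i enorm (x 0 i *: (delta_mx 0 i : 'rV[R]_d)))).
  elim/big_ind2 : _ => [|a b c e ha hc|//]; first by rewrite enorm0.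
  by apply: (le_trans (enormD _ _)); apply: lerD.
have -> : d%:R * `|x| = \sum_(i < d) `|x| by rewrite sumr_const card_ord mulr_natl.
by apply: ler_sum => i _; rewrite enormZ enorm_delta mulr1 coord_le_norm.
Qed.

Lemma enorm_continuous : continuous (@enorm R d).
Proof.
move=> x; apply/(@cvgrPdist_le _ _ _ (nbhs x)) => /= e e0.
have d1 : 0 < d%:R + 1 :> R by rewrite ltr_wpDl.
apply: (@nbhs_le_nbhs_norm R ('rV[R]_d) x); exists (e / (d%:R + 1)); first by rewrite /= divr_gt0.
move=> y /=; rewrite /ball_ /= => /ltW xy.
apply: (le_trans (enorm_dist _ _)); apply: (le_trans (enorm_le_norm _)).
apply: (@le_trans _ _ ((d%:R + 1) * `|x - y|)); first by rewrite ler_wpM2r// lerDl.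
by rewrite mulrC -ler_pdivlMr.
Qed.

End Euclid.

Section Calculus.
Context {R : realType} {d : nat}.
Local Notation V := 'rV[R]_d.
Implicit Types (f : V -> R) (x y u v w : V).

Lemma is_derive_line f x v (t : R) : differentiable f (x + t *: v) ->
  is_derive t 1 (fun s => f (x + s *: v)) ('D_v f (x + t *: v)).
Proof.
move=> /diff_derivable - /(_ v).
have E : (fun h : R => h^-1 *: (((fun s => f (x + s *: v)) \o shift t) (h *: 1) - f (x + t *: v)))
       = (fun h : R => h^-1 *: ((f \o shift (x + t *: v)) (h *: v) - f (x + t *: v))).
  apply/funext => h /=; congr (_ *: (f _ - _)).
  by rewrite [h *: 1]mulr1 scalerDl addrCA.
by move=> df; apply: DeriveDef; rewrite /derivable /derive E.
Qed.

Lemma mvt01 (u du : R -> R) : (forall t : R, is_derive t (1 : R) u (du t)) ->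
  exists2 t : R, 0 < t < 1 & u 1 - u 0 = du t.
Proof.
move=> dug; have cu : {within `[0, 1], continuous u}.
  apply: continuous_subspaceT => t.
  by apply/differentiable_continuous/derivable1_diffP/ex_derive.
have [t] := MVT ltr01 (fun t _ => dug t) cu.
by rewrite in_itv/= subr0 mulr1 => ? ->; exists t.
Qed.

Lemma ge0_derive_le01 (u du : R -> R) : (forall t : R, is_derive t (1 : R) u (du t)) ->
  (forall t, 0 <= t -> t <= 1 -> 0 <= du t) -> u 0 <= u 1.
Proof.
move=> dug du0; have [t /andP[t0 t1] h] := mvt01 dug.
by rewrite -subr_ge0 h du0 ?ltW.
Qed.

Lemma line_mvt f x v : (forall y, differentiable f y) ->
  exists2 t : R, 0 < t < 1 & f (x + v) - f x = 'D_v f (x + t *: v).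
Proof.
move=> df; have [|t t01 h] :=
  @mvt01 (fun s : R => f (x + s *: v)) (fun t => 'D_v f (x + t *: v)).
  by move=> t; exact: is_derive_line.
by exists t => //; rewrite -h scale1r scale0r addr0.
Qed.

Lemma deriveD_dir f x u v : differentiable f x ->
  'D_(u + v) f x = 'D_u f x + 'D_v f x.
Proof. by move=> df; rewrite !deriveE// linearD. Qed.

Lemma deriveZ_dir f x (a : R) v : differentiable f x ->
  'D_(a *: v) f x = a * 'D_v f x.
Proof. by move=> df; rewrite !deriveE// linearZ. Qed.

Lemma derive_coord f x v : differentiable f x ->
  'D_v f x = \sum_i v 0 i * 'D_(delta_mx 0 i) f x.
Proof.
move=> df; rewrite deriveE// {1}(row_sum_delta v) linear_sum.
by apply: eq_bigr => i _; rewrite linearZ/= deriveE.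
Qed.

Lemma edot_grad f x v : differentiable f x -> edot (grad f x) v = 'D_v f x.
Proof.
by move=> df; rewrite derive_coord//; apply: eq_bigr => i _; rewrite !mxE mulrC.
Qed.

(** The little-o of the library refers to the max norm. It is dominated by the Euclidean norm, so
    both the radius and the error transfer without a factor depending on [d]. *)
Lemma differentiable_expand f x (e : R) : differentiable f x -> 0 < e ->
  exists2 r : R, 0 < r & forall k, enorm k < r ->
    `|f (x + k) - f x - 'D_k f x| <= e * enorm k.
Proof.
move=> df e0; have := diff_locally df => /eqaddoP /(_ e e0).
rewrite near_simpl => /nbhs_normP [r /= r0 hr]; exists r => // k kr.
have := hr k; rewrite /ball_ /= sub0r normrN => /(_ (le_lt_trans (norm_le_enorm k) kr)) h.
rewrite deriveE// addrC [f _ - _]addrC addrA -opprD addrC ['d _ _ _ + _]addrC [x + k]addrC.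
by apply: (le_trans h); rewrite ler_wpM2l ?norm_le_enorm// ltW.
Qed.

End Calculus.

(** * Iterated directional derivatives and their symmetry *)

Section Iterated.
Context {R : realType} {d : nat}.
Local Notation V := 'rV[R]_d.
Implicit Types (f phi : V -> R) (x y u v w : V) (us vs ws : seq V).

(** The mean value theorem in the direction [v] reduces the second difference to ['D_v f] at two
    points near [x], and both values are expanded at [x]. Hence differentiability of ['D_v f] at the
    single point [x] is enough. *)
Lemma second_difference f x u v (e : R) : (forall y, differentiable f y) ->
  differentiable ('D_v f) x -> 0 < e ->
  exists2 r : R, 0 < r & forall t, 0 < t < r ->
    `|(f (x + t *: u + t *: v) - f (x + t *: u) - f (x + t *: v) + f x)
      - t ^+ 2 * 'D_u ('D_v f) x| <= e * t ^+ 2.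
Proof.
move=> df dDf e0; set N := enorm u + enorm v + 1.
(* Both offsets from [x] have norm at most t(N-1), so precision e/(2N) in the expansion makes each
   of the two errors at most e t/2. *)
have N0 : 0 < N by rewrite ltr_wpDl// addr_ge0 ?enorm_ge0.
have e'0 : 0 < e / (2 * N) by rewrite divr_gt0// mulr_gt0.
have [r r0 hr] := differentiable_expand dDf e'0.
exists (r / N) => [|t /andP[t0]]; first by rewrite divr_gt0.
rewrite ltr_pdivlMr// => tr.
pose g (s : R) := f (x + t *: u + s *: (t *: v)) - f (x + s *: (t *: v)).
pose dg (s : R) := t * ('D_v f (x + t *: u + s *: (t *: v)) - 'D_v f (x + s *: (t *: v))).
have gdg (s : R) : is_derive s (1 : R) g (dg s).
  have h (y : V) : t * 'D_v f y = 'D_(t *: v) f y by rewrite deriveZ_dir.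
  by rewrite /dg mulrBr !h; apply: is_deriveB; apply: is_derive_line.
have [s /andP[s0 s1] hs] := mvt01 gdg.
have -> : f (x + t *: u + t *: v) - f (x + t *: u) - f (x + t *: v) + f x = g 1 - g 0.
  by rewrite /g !scale1r !scale0r !addr0; ring.
rewrite {}hs /dg.
have nt w : enorm (t *: w) = t * enorm w by rewrite enormZ gtr0_norm.
have ns : enorm (s *: (t *: v)) <= t * enorm v.
  by rewrite enormZ nt gtr0_norm// ler_piMl ?mulr_ge0 ?enorm_ge0 // ltW.
have nu := enorm_ge0 u; have nv := enorm_ge0 v.
have k2 : enorm (s *: (t *: v)) <= t * (N - 1).
  by apply: (le_trans ns); rewrite ler_pM2l// /N addrK lerDr.
have k1 : enorm (t *: u + s *: (t *: v)) <= t * (N - 1).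
  apply: (le_trans (enormD _ _)); rewrite /N addrK mulrDr nt; exact: lerD.
have tN : t * (N - 1) < r by apply: le_lt_trans tr; rewrite ler_pM2l// gerBl.
have := hr _ (le_lt_trans k1 tN); have := hr _ (le_lt_trans k2 tN).
rewrite deriveD_dir// (deriveZ_dir t u dDf) addrA => h2 h1.
have b (k : R) : k <= t * (N - 1) -> e / (2 * N) * k <= e / 2 * t.
  move=> hk; apply: (@le_trans _ _ (e / (2 * N) * (t * N))).
    by rewrite ler_pM2l// (le_trans hk)// ler_pM2l// gerBl.
  rewrite le_eqVlt; apply/orP; left; apply/eqP; field.
  by rewrite gt_eqF.
have := le_trans h1 (b _ k1); have := le_trans h2 (b _ k2).
set a5 := 'D_u ('D_v f) x; set a4 := 'D_(s *: _) ('D_v f) x; set a3 := 'D_v f x.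
set a2 := 'D_v f (x + t *: u + _); set a1 := 'D_v f (x + _) => g2 g1.
have -> : t * (a2 - a1) - t ^+ 2 * a5 = t * ((a2 - a3 - (t * a5 + a4)) - (a1 - a3 - a4)) by ring.
rewrite normrM gtr0_norm// expr2 mulrCA ler_pM2l//.
apply: (le_trans (ler_normB _ _)); apply: (le_trans (lerD g1 g2)).
by rewrite -mulrDl -splitr.
Qed.

(** Young's version of the symmetry theorem: the second difference does not change when [u] and [v]
    are exchanged, and it approximates both mixed derivatives. *)
Lemma derive_swap f x u v : (forall y, differentiable f y) ->
  differentiable ('D_u f) x -> differentiable ('D_v f) x ->
  'D_u ('D_v f) x = 'D_v ('D_u f) x.
Proof.
move=> df du dv.
suff h : `|'D_u ('D_v f) x - 'D_v ('D_u f) x| <= 0.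
  by apply/eqP; rewrite -subr_eq0 -normr_le0.
apply/ler_addgt0Pr => e e0; rewrite add0r.
have e2 : 0 < e / 2 by rewrite divr_gt0.
have [r r0 hr] := second_difference u df dv e2.
have [r' r'0 hr'] := second_difference v df du e2.
pose t := Num.min r r' / 2.
have m0 : 0 < Num.min r r' by rewrite lt_min r0.
have t0 : 0 < t by rewrite divr_gt0.
have tm : t < Num.min r r' by rewrite ltr_pdivrMr// ltr_pMr// ltr1n.
have := hr t; have := hr' t; rewrite t0.
rewrite (lt_le_trans tm) ?ge_min ?lexx ?orbT// => /(_ isT) h1.
rewrite (lt_le_trans tm) ?ge_min ?lexx ?orbT// => /(_ isT) h2.
move: h1 h2; rewrite [x + t *: v + t *: u]addrAC.
set a := 'D_u _ x; set b := 'D_v _ x => h1 h2.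
set f1 := f (x + t *: u + _) in h1 h2; set f2 := f (x + t *: v) in h1 h2.
set f3 := f (x + t *: u) in h1 h2; set f4 := f x in h1 h2.
have t2 : 0 < t ^+ 2 by rewrite exprn_gt0.
have : `|t ^+ 2 * (a - b)| <= e * t ^+ 2.
  have -> : t ^+ 2 * (a - b) = (f1 - f2 - f3 + f4 - t ^+ 2 * b) - (f1 - f3 - f2 + f4 - t ^+ 2 * a) by ring.
  apply: (le_trans (ler_normB _ _)); apply: (le_trans (lerD h1 h2)).
  by rewrite -mulrDl -splitr.
by rewrite normrM gtr0_norm// mulrC ler_pM2r.
Qed.

Lemma Dn_cat phi us vs : Dn phi (us ++ vs) = Dn (Dn phi vs) us.
Proof. by elim: us => //= u us ->. Qed.

Lemma ndifferentiable_Dn p phi vs : ndifferentiable p phi ->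
  ndifferentiable (p - size vs) (Dn phi vs).
Proof. by move=> h ws x hs; rewrite -Dn_cat; apply: h; rewrite size_cat addnC -ltn_subRL. Qed.

Lemma Dn_move p phi u ws vs : ndifferentiable p phi -> (size (ws ++ u :: vs) <= p)%N ->
  Dn phi (ws ++ u :: vs) = Dn phi (u :: ws ++ vs).
Proof.
move=> h; elim: ws => //= w ws IH hs; rewrite IH; last exact: ltnW.
have {}hs : ((size (ws ++ vs)).+1 < p)%N by move: hs; rewrite !size_cat /= addnS.
apply/funext => x /=; apply: derive_swap => [y||].
- by apply: h; apply: ltnW.
- exact: (h (w :: ws ++ vs)).
- exact: (h (u :: ws ++ vs)).
Qed.

Lemma Dn_nseq_move p phi (k : nat) w u vs : ndifferentiable p phi ->
  (k + (size vs).+1 <= p)%N ->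
  Dn phi (nseq k w ++ u :: vs) = Dn phi (u :: nseq k w ++ vs).
Proof. by move=> h hs; apply: (Dn_move h); rewrite size_cat size_nseq. Qed.

(** Linearity in an inner slot: by symmetry the direction can be moved outermost, where a derivative
    is linear in its direction. *)
Lemma Dn_expand p phi ws vs w x : ndifferentiable p phi ->
  (size ws + (size vs).+1 <= p)%N ->
  Dn phi (ws ++ w :: vs) x = \sum_i w 0 i * Dn phi (ws ++ delta_mx 0 i :: vs) x.
Proof.
move=> h hs; rewrite (Dn_move h) ?size_cat//= derive_coord; last first.
  by apply: h; rewrite size_cat -addnS.
by apply: eq_bigr => i _; rewrite (Dn_move h) ?size_cat.
Qed.

Lemma is_derive_coordB x (i : 'I_d) y v :
  differentiable (fun y => (y - x) 0 i) y /\ 'D_v (fun y => (y - x) 0 i) y = v 0 i.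
Proof.
have -> : (fun y : V => (y - x) 0 i) = (fun y : V => y 0 i) \- cst (x 0 i).
  by apply/funext => z; rewrite /= !mxE.
have dc : differentiable (fun y : V => y 0 i) y by apply: differentiable_coord.
split; first exact: differentiableB.
rewrite deriveB ?derive_cst; [|exact: diff_derivable|by []].
rewrite subr0 /derive.
apply: (@cvg_lim _ (@Rhausdorff R)); apply/cvgrPdist_le => e e0; near=> h.
rewrite /= !mxE addrK [_ *: _]mulKf ?subrr ?normr0 ?ltW//.
by near: h; apply: nbhs_dnbhs_neq.
Unshelve. all: end_near. Qed.

(** The derivative of the polynomial D^k phi(x)[y-x]^k. Induction on [k] expands one slot in
    coordinates, which leaves a basis vector as a fixed direction; this is why the list [us] is
    carried along. *)
Lemma Dn_nseq_diff p phi x (k : nat) us y : ndifferentiable p phi ->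
  (k + size us <= p)%N ->
  differentiable (fun y => Dn phi (nseq k (y - x) ++ us) x) y /\
  forall v, 'D_v (fun y => Dn phi (nseq k (y - x) ++ us) x) y =
    k%:R * Dn phi (nseq k.-1 (y - x) ++ v :: us) x.
Proof.
move=> h; elim: k us => [|k IH] us hs.
  by split => [|v]; [exact: differentiable_cst | rewrite mul0r derive_cst].
have E : (fun y => Dn phi (nseq k.+1 (y - x) ++ us) x) =
    \sum_i (fun y => (y - x) 0 i * Dn phi (nseq k (y - x) ++ delta_mx 0 i :: us) x).
  apply/funext => z; rewrite fct_sumE -(@Dn_expand p) ?size_nseq -?addSnnS//.
  by rewrite (Dn_nseq_move _ _ h) -?addSnnS.
have hs' (i : 'I_d) : (k + size (delta_mx 0%R i :: us : seq V) <= p)%N by rewrite /= -addSnnS.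
have d1 (i : 'I_d) := (is_derive_coordB x i y (0 : V)).1.
have d2 i := (IH _ (hs' i)).1.
rewrite E; split=> [|v].
  by apply: differentiable_sum => i; apply: differentiableM.
rewrite derive_sum => [|i]; last by apply/diff_derivable/differentiableM.
have -> : (\sum_i 'D_v (fun y => (y - x) 0 i * Dn phi (nseq k (y - x) ++ delta_mx 0 i :: us) x) y)
    = \sum_i ((y - x) 0 i * (k%:R * Dn phi (nseq k.-1 (y - x) ++ v :: delta_mx 0 i :: us) x)
        + v 0 i * Dn phi (nseq k (y - x) ++ delta_mx 0 i :: us) x).
  apply: eq_bigr => i _; rewrite deriveM; [|exact: diff_derivable|exact: diff_derivable].
  by rewrite (is_derive_coordB x i y v).2 (IH _ (hs' i)).2 [_ *: v 0 i]mulrC.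
rewrite big_split /= -(@Dn_expand p) ?size_nseq -?addSnnS//.
rewrite mulrSr mulrDl mul1r; congr (_ + _).
(* For [k = 0] the predecessor is truncated, but the factor [k] kills the term. Otherwise the
   coordinate sum is folded back into a slot y - x. *)
case: k {IH E d2} hs hs' => [|k] hs hs'; first by rewrite mul0r big1// => i _; rewrite mul0r mulr0.
rewrite -[k.+1.-1]/k -cat_rcons.
under eq_bigr do rewrite mulrCA -cat_rcons.
rewrite -mulr_sumr -(@Dn_expand p) ?size_rcons ?size_nseq ?cat_rcons -?addSnnS//.
by rewrite -cat_rcons (Dn_move h) ?cat_rcons// size_cat size_nseq /=; lia.
Qed.

End Iterated.

(** * Taylor polynomials *)

Section Taylor.
Context {R : realType} {d : nat}.
Local Notation V := 'rV[R]_d.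
Implicit Types (f phi : V -> R) (x y u v w : V) (us vs ws : seq V).

Lemma is_derive_monomial (c : R) (n : nat) (t : R) :
  is_derive t (1 : R) (fun s => c * s ^+ n) (c * (n%:R * t ^+ n.-1)).
Proof.
have h : is_derive t (1 : R) (fun s => s ^+ n) (n%:R * t ^+ n.-1).
  apply: DeriveDef; first exact: exprn_derivable.
  by rewrite exp_derive /GRing.scale /= mulr1.
exact: (@is_deriveZ R R R (fun s => s ^+ n) c t 1 _ h).
Qed.

Lemma taylorE p phi x y :
  taylor p phi x y = \sum_(k < p.+1) k`!%:R^-1 * Dn phi (nseq k (y - x)) x.
Proof.
rewrite /taylor big_add1 /= big_mkord big_ord_recl /= fact0 invr1 mul1r.
by congr (_ + _); apply: eq_bigr => i _; rewrite big_add1.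
Qed.

Lemma taylor_center p phi x : taylor p phi x x = phi x.
Proof.
rewrite taylorE big_ord_recl /= fact0 invr1 mul1r subrr big1 ?addr0// => i _.
by rewrite /= derive0 mulr0.
Qed.

Lemma taylor_diff p phi x y : ndifferentiable p phi ->
  differentiable (taylor p phi x) y /\
  forall v, 'D_v (taylor p phi x) y =
    if p is p'.+1 then taylor p' ('D_v phi) x y else 0.
Proof.
move=> h; have hk (k : 'I_p.+1) := @Dn_nseq_diff _ _ p phi x k [::] y h.
have -> : taylor p phi x =
    \sum_(k < p.+1) (k`!%:R^-1 \*: (fun y => Dn phi (nseq k (y - x) ++ [::]) x)).
  by apply/funext => z; rewrite taylorE fct_sumE; apply: eq_bigr => k _ /=; rewrite cats0.
have d1 (k : 'I_p.+1) : differentiable (fun y => Dn phi (nseq k (y - x) ++ [::]) x) y.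
  by apply: (hk k _).1; rewrite addn0 -ltnS.
split=> [|v]; first by apply: differentiable_sum => k; apply: differentiableZ.
rewrite derive_sum => [|k]; last by apply/diff_derivable/differentiableZ.
rewrite big_ord_recl deriveZ; last exact/diff_derivable.
rewrite ((hk ord0 _).2 v)// mul0r scaler0 add0r.
case: p h hk d1 => [|p] h hk d1; first by rewrite big_ord0.
rewrite taylorE; apply: eq_bigr => k _.
rewrite deriveZ; last exact/diff_derivable.
rewrite ((hk (lift ord0 k) _).2 v) ?addn0//; last by rewrite -ltnS.
rewrite lift0 Dn_cat [_ *: _]mulrA; congr (_ * _).
by rewrite factS natrM invfM mulrAC mulVf ?mul1r// pnatr_eq0.
Qed.

Lemma Dn_taylor p phi x vs : ndifferentiable p phi -> (size vs <= p)%N ->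
  Dn (taylor p phi x) vs = taylor (p - size vs) (Dn phi vs) x.
Proof.
move=> h; elim: vs => [|v vs IH] hs; first by rewrite subn0.
apply/funext => y /=; rewrite IH ?(ltnW hs)//.
have -> : (p - size vs = (p - (size vs).+1).+1)%N by rewrite subnSK.
rewrite (taylor_diff _ _ _).2//.
by have := ndifferentiable_Dn (vs := vs) h; rewrite -subnSK.
Qed.

Lemma ndifferentiable_taylor p phi x : ndifferentiable p phi ->
  ndifferentiable p (taylor p phi x).
Proof.
move=> h vs y hs; rewrite Dn_taylor ?(ltnW hs)//.
exact: (taylor_diff _ _ (ndifferentiable_Dn h)).1.
Qed.

Lemma ndifferentiable_cat n m phi vs : ndifferentiable n phi -> (m + size vs <= n)%N ->
  ndifferentiable m (Dn phi vs).
Proof. by move=> h hs ws x hw; rewrite -Dn_cat; apply: h; rewrite size_cat; lia. Qed.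

Lemma lip_deriv_Dn p L phi vs m : lip_deriv p L phi -> (m + size vs = p)%N ->
  lip_deriv m (L * \prod_(v <- vs) enorm v) (Dn phi vs).
Proof.
move=> [h hl] hm; split; first by apply: (ndifferentiable_cat h); rewrite hm.
move=> ws x y hw; rewrite -!Dn_cat; apply: (le_trans (hl _ _ _ _)).
  by rewrite size_cat hw.
by rewrite big_cat /= le_eqVlt; apply/orP; left; apply/eqP; ring.
Qed.

Lemma ndifferentiable1 p phi : (0 < p)%N -> ndifferentiable p phi ->
  forall x, differentiable phi x.
Proof. by move=> p0 h x; apply: (h [::]). Qed.

(** Induction on [p]: along the segment the remainder has as derivative the remainder of ['D_h phi],
    one order lower, whose Lipschitz constant is L|h|. Comparison with a monomial replaces
    integration. *)
Lemma taylor_remainder p L phi x y : lip_deriv p L phi ->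
  `|phi y - taylor p phi x y| <= L * enorm (y - x) ^+ p.+1 / p.+1`!%:R.
Proof.
elim: p L phi y => [|p IH] L phi y hphi.
  have := hphi.2 [::] y x erefl; rewrite /taylor big_geq// addr0 big_nil mulr1 expr1.
  by rewrite (_ : 1`! = 1)%N// divr1.
pose h := y - x; pose M := L * enorm h ^+ p.+2.
have hp : (0 < p.+1)%N by [].
pose u (t : R) := phi (x + t *: h) - taylor p.+1 phi x (x + t *: h).
pose du (t : R) := 'D_h phi (x + t *: h) - taylor p ('D_h phi) x (x + t *: h).
have hu (t : R) : is_derive t (1 : R) u (du t).
  have [d1 d2] := taylor_diff x (x + t *: h) hphi.1.
  rewrite /du -d2; apply: is_deriveB; apply: is_derive_line => //.
  exact: (ndifferentiable1 hp hphi.1).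
have hdu (t : R) : 0 <= t -> `|du t| <= M / p.+2`!%:R * (p.+2%:R * t ^+ p.+1).
  move=> t0; have := IH _ _ (x + t *: h) (@lip_deriv_Dn p.+1 L phi [:: h] p hphi (addn1 p)).
  rewrite big_seq1 addrAC subrr add0r enormZ (ger0_norm t0) => /le_trans; apply.
  rewrite le_eqVlt; apply/orP; left; apply/eqP; rewrite /M (factS p.+1) natrM exprMn [enorm h ^+ p.+2]exprS.
  by field; rewrite -natrD !pnatr_eq0 -lt0n fact_gt0.
(* The sign [s] treats the upper and the lower bound at once. *)
have mono (s : R) : (`|s| = 1) -> s * u 1 <= M / p.+2`!%:R.
  move=> s1; rewrite -subr_ge0.
  pose w (t : R) := M / (p.+2)`!%:R * t ^+ p.+2 - s * u t.
  have : w 0 <= w 1.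
    apply: (@ge0_derive_le01 _ w (fun t => M / p.+2`!%:R * (p.+2%:R * t ^+ p.+1) - s * du t)).
      move=> t; have hs := @is_deriveZ R R R u s t 1 _ (hu t).
      by apply: is_deriveB; exact: is_derive_monomial.
    move=> t t0 _; rewrite subr_ge0; apply: le_trans (hdu t t0).
    by rewrite -[leRHS]mul1r -s1 -normrM ler_norm.
  rewrite /w /u scale0r addr0 taylor_center subrr expr0n expr1n !mulr0 subr0 mulr1.
  by [].
have E : u 1 = phi y - taylor p.+1 phi x y by rewrite /u scale1r (_ : x + h = y)// /h addrC subrK.
rewrite -E ler_norml; apply/andP; split; last by rewrite -[u 1]mul1r mono ?normr1.
by rewrite lerNl -mulN1r mono ?normrN1.
Qed.

Lemma taylor_remainder_Dn p L phi x y vs m : lip_deriv p L phi -> (m + size vs = p)%N ->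
  `|Dn phi vs y - Dn (taylor p phi x) vs y| <=
    L * \prod_(v <- vs) enorm v * enorm (y - x) ^+ m.+1 / m.+1`!%:R.
Proof.
move=> hphi hm; have := taylor_remainder x y (lip_deriv_Dn hphi hm).
by rewrite Dn_taylor//; [rewrite -hm addnK | exact: hphi.1 | rewrite -hm leq_addl].
Qed.

End Taylor.

(** * The power of the norm *)

Section Regularizer.
Context {R : realType} {d : nat}.
Local Notation V := 'rV[R]_d.
Implicit Types (f : V -> R) (x y u v w : V) (us vs ws : seq V).

(** Meant for homogeneous functions of degree at least 2 at the origin, where the rules for
    quotients by |y| do not apply. *)
Lemma quadratic_diff0 f x (C : R) : 0 <= C ->
  (forall k, enorm k <= 1 -> `|f (x + k) - f x| <= C * enorm k ^+ 2) ->
  differentiable f x /\ forall v, 'D_v f x = 0.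
Proof.
move=> C0 hC.
have h : f \o shift x = cst (f x) + (0 : V -> R) +o_ (0 : V) id.
  apply/eqaddoP => e e0; apply: (@nbhs_le_nbhs_norm R V 0).
  pose D := d%:R + 1 : R; have D0 : 0 < D by rewrite /D ltr_wpDl.
  have C1 : 0 < C + 1 by rewrite ltr_wpDl.
  exists (Num.min D^-1 (e / (D ^+ 2 * (C + 1)))).
    by rewrite /= lt_min invr_gt0 D0 divr_gt0// mulr_gt0// exprn_gt0.
  move=> k /=; rewrite /ball_ /= sub0r normrN lt_min => /andP[k1 k2].
  have kD : enorm k <= D * `|k|.
    by apply: (le_trans (enorm_le_norm _)); rewrite ler_wpM2r// /D lerDl.
  have -> : (f \o shift x - (cst (f x) + (0 : V -> R))) k = f (x + k) - f x.
    rewrite -[LHS]/(f (k + x) - (f x + 0)).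
    by rewrite addr0 [k + x]addrC.
  have k1' : enorm k <= 1.
    by apply: (le_trans kD); rewrite mulrC -ler_pdivlMr// div1r ltW.
  apply: (le_trans (hC k k1')).
  apply: (@le_trans _ _ ((C + 1) * (D * `|k|) ^+ 2)).
    apply: ler_pM => //; first by rewrite exprn_ge0 ?enorm_ge0.
      by rewrite lerDl.
    by rewrite ler_pXn2r ?nnegrE ?enorm_ge0// mulr_ge0// ltW.
  move: k2; rewrite ltr_pdivlMr ?mulr_gt0 ?exprn_gt0// => /ltW k2.
  rewrite (_ : _ * _ = `|k| * (D ^+ 2 * (C + 1)) * `|k|); last by ring.
  exact: ler_wpM2r.
have d0 : continuous (0 : V -> R) by move=> y; apply: cst_continuous.
have dE : 'd f x = (\0 : {linear V -> R}) :> (V -> R).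
  exact: diff_unique.
have df : differentiable f x by apply/diff_locallyP; rewrite dE.
by split=> // v; rewrite deriveE// dE.
Qed.

Lemma differentiable_edotl u y : differentiable (fun z => edot z u) y.
Proof.
have -> : (fun z => edot z u) = \sum_(i < d) (fun z : V => z 0 i * u 0 i).
  by apply/funext => z; rewrite fct_sumE.
apply: differentiable_sum => i; apply: differentiableM; last exact: differentiable_cst.
exact: differentiable_coord.
Qed.

Lemma derive_edotl u y v : 'D_v (fun z => edot z u) y = edot v u.
Proof.
rewrite /derive; apply: (@cvg_lim _ (@Rhausdorff R)); apply/cvgrPdist_le => e e0; near=> h.
rewrite /= edotDl addrK edotZl [_ *: _]mulKf ?subrr ?normr0 ?ltW//.
by near: h; apply: nbhs_dnbhs_neq.
Unshelve. all: end_near. Qed.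

Lemma differentiable_enorm y : y != 0 -> differentiable (@enorm R d) y.
Proof.
move=> y0; have n0 : 0 < edot y y by rewrite -enorm_sqr exprn_gt0// enorm_gt0.
apply: (@differentiable_comp _ _ _ _ (fun z => edot z z) Num.sqrt).
  have -> : (fun z => edot z z) = \sum_(i < d) (fun z : V => z 0 i * z 0 i).
    by apply/funext => z; rewrite fct_sumE.
  apply: differentiable_sum => i; apply: differentiableM; exact: differentiable_coord.
by apply/derivable1_diffP; apply: ex_derive; apply: is_derive1_sqrt.
Qed.

Lemma derive_enorm y v : y != 0 -> 'D_v (@enorm R d) y = (enorm y)^-1 * edot y v.
Proof.
move=> y0; have n0 := enorm_gt0 y0; have dn := differentiable_enorm y0.
have h : 'D_v (fun z => enorm z * enorm z) y = 2 * edot y v.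
  rewrite (_ : (fun z => _) = \sum_(i < d) (fun z : V => z 0 i * z 0 i)); last first.
    by apply/funext => z; rewrite fct_sumE -expr2 enorm_sqr.
  have dc i : differentiable (fun z : V => z 0 i) y by apply: differentiable_coord.
  have Dc i : 'D_v (fun z : V => z 0 i) y = v 0 i.
    have := derive_edotl (delta_mx 0 i) y v; rewrite edot_delta => <-.
    by congr ('D_v _ y); apply/funext => z; rewrite edot_delta.
  rewrite derive_sum => [|i]; last by apply/diff_derivable/differentiableM.
  rewrite mulr_sumr; apply: eq_bigr => i _.
  by rewrite deriveM ?Dc; [rewrite /GRing.scale /=; ring|exact: diff_derivable|exact: diff_derivable].
have : 2 * (enorm y * 'D_v (@enorm R d) y) = 2 * edot y v.
  rewrite -h deriveM; [rewrite /GRing.scale /=; ring|exact: diff_derivable|exact: diff_derivable].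
move=> /(mulfI _) <-; last by rewrite pnatr_eq0.
by rewrite mulKf// gt_eqF.
Qed.

(* Homogeneous of degree m, written with the unit vector y / |y| so that no
   negative power of |y| occurs; the value at y = 0 is 0 for m > 0. *)
Definition hmon (m : nat) (us : seq V) (y : V) : R :=
  enorm y ^+ m * \prod_(u <- us) ((enorm y)^-1 * edot y u).

(** The product rule along [v]: the factor <y,u>/|y| has derivative (<v,u> -
    <y/|y|,u><y/|y|,v>)/|y|, and its denominator lowers the degree from m to m-1. *)
Fixpoint dhmon (m : nat) (us : seq V) (v : V) (y : V) : R :=
  if us is u :: us' then
    edot v u * hmon m.-1 us' y - hmon m.-1 [:: u, v & us'] y
      + (enorm y)^-1 * edot y u * dhmon m us' v y
  else m%:R * hmon m.-1 [:: v] y.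

Lemma hmon_cons m u us y : hmon m (u :: us) y = (enorm y)^-1 * edot y u * hmon m us y.
Proof. by rewrite /hmon big_cons mulrCA. Qed.

Lemma hmon0 m us : (0 < m)%N -> hmon m us 0 = 0.
Proof. by move=> m0; rewrite /hmon enorm0 expr0n gtn_eqF// mul0r. Qed.

Lemma unit_edot_le y u : `|(enorm y)^-1 * edot y u| <= enorm u.
Proof.
have [->|y0] := eqVneq y 0; first by rewrite edot0l mulr0 normr0 enorm_ge0.
have n0 := enorm_gt0 y0.
rewrite normrM ger0_norm ?invr_ge0 ?enorm_ge0// mulrC ler_pdivrMr// mulrC.
exact: normr_edot_le.
Qed.

Lemma prod_enorm_ge0 us : 0 <= \prod_(u <- us) enorm u.
Proof. by apply: prodr_ge0 => u _; exact: enorm_ge0. Qed.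

Lemma hmon_le m us y : `|hmon m us y| <= enorm y ^+ m * \prod_(u <- us) enorm u.
Proof.
rewrite /hmon normrM ger0_norm ?exprn_ge0 ?enorm_ge0// ler_wpM2l ?exprn_ge0 ?enorm_ge0//.
rewrite normr_prod; apply: ler_prod => u _; rewrite normr_ge0; exact: unit_edot_le.
Qed.

Lemma differentiable_unit_edot u y : y != 0 ->
  differentiable (fun z => (enorm z)^-1 * edot z u) y.
Proof.
move=> y0; apply: differentiableM; last exact: differentiable_edotl.
by apply: differentiableV; [exact: differentiable_enorm|rewrite gt_eqF ?enorm_gt0].
Qed.

Lemma hmon_diff_neq0 m us y : y != 0 -> (0 < m)%N ->
  differentiable (hmon m us) y /\ forall v, 'D_v (hmon m us) y = dhmon m us v y.
Proof.
move=> y0 m0; have n0 := enorm_gt0 y0; have dn := differentiable_enorm y0.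
have nE : enorm y != 0 by rewrite gt_eqF.
elim: us => [|u us [d1 d2]].
  have -> : hmon m [::] = (@enorm R d) ^+ m.
    by apply/funext => z; rewrite /hmon big_nil mulr1 fctE.
  split=> [|v]; first by case: m m0 => // m _; exact: differentiableX.
  rewrite deriveX; last exact/diff_derivable.
  by rewrite derive_enorm//= /hmon big_seq1 mulrA.
have -> : hmon m (u :: us) = (fun z => (enorm z)^-1 * edot z u) * hmon m us.
  by apply/funext => z; rewrite hmon_cons.
have d3 := differentiable_unit_edot u y0.
split=> [|v]; first exact: differentiableM.
rewrite deriveM; [|exact: diff_derivable|exact: diff_derivable].
rewrite d2 /= -[_ *: dhmon _ _ _ _]/(_ * _) addrC; congr (_ + _).
rewrite deriveM; [|apply: diff_derivable; exact: differentiableV|exact/diff_derivable/differentiable_edotl].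
rewrite deriveV//; last exact: diff_derivable.
rewrite derive_edotl derive_enorm// !hmon_cons /GRing.scale /=.
have -> : hmon m us y = enorm y * hmon m.-1 us y.
  by rewrite /hmon mulrA -exprS prednK.
by rewrite -exprVn; field.
Qed.

Lemma dhmon0 m us v : (1 < m)%N -> dhmon m us v 0 = 0.
Proof.
move=> m1; have m0 : (0 < m.-1)%N by case: m m1 => [|[]].
by elim: us => [|u us IH] /=; rewrite !hmon0// ?mulr0// IH mulr0 subr0 addr0.
Qed.

Lemma hmon_diff m us y : (1 < m)%N ->
  differentiable (hmon m us) y /\ forall v, 'D_v (hmon m us) y = dhmon m us v y.
Proof.
move=> m1; have [->|y0] := eqVneq y 0; last by apply: hmon_diff_neq0 => //; lia.
have [|k k1|h1 h2] := @quadratic_diff0 (hmon m us) 0 (\prod_(u <- us) enorm u).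
- exact: prod_enorm_ge0.
- rewrite add0r hmon0 ?subr0; last by lia.
  apply: (le_trans (hmon_le _ _ _)); rewrite mulrC ler_wpM2l ?prod_enorm_ge0//.
  by apply: ler_wiXn2l => //; exact: enorm_ge0.
- by split=> // v; rewrite h2 dhmon0.
Qed.

(** Linear combinations of functions [hmon m us] with at most [r] factors each; [K] bounds the sum
    of the absolute coefficients times the products of the norms. Differentiation lowers [m] by one
    and raises [r] by one, with an explicit new [K]. *)
Inductive hcomb (m r : nat) : R -> (V -> R) -> Prop :=
| hcomb_mon us K : (size us <= r)%N -> \prod_(u <- us) enorm u <= K ->
    hcomb m r K (hmon m us)
| hcomb_add f g K1 K2 K : hcomb m r K1 f -> hcomb m r K2 g -> K1 + K2 <= K ->
    hcomb m r K (fun y => f y + g y)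
| hcomb_scale a f K1 K : hcomb m r K1 f -> `|a| * K1 <= K ->
    hcomb m r K (fun y => a * f y).

Lemma hcomb_le m r r' K K' f : hcomb m r K f -> (r <= r')%N -> K <= K' -> hcomb m r' K' f.
Proof.
move=> h rr.
elim: h K' => {f K} [us K hs hp|f g K1 K2 K _ IH1 _ IH2 hK|a f K1 K _ IH hK] K' KK'.
- by apply: hcomb_mon; [exact: leq_trans rr | exact: le_trans KK'].
- by apply: (hcomb_add (IH1 _ (lexx _)) (IH2 _ (lexx _))); exact: le_trans KK'.
- by apply: (hcomb_scale (IH _ (lexx _))); exact: le_trans KK'.
Qed.

Lemma hcomb_mul m r K f u : hcomb m r K f ->
  hcomb m r.+1 (enorm u * K) (fun y => (enorm y)^-1 * edot y u * f y).
Proof.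
elim=> {f K} [us K hs hp|f g K1 K2 K _ IH1 _ IH2 hK|a f K1 K _ IH hK].
- rewrite (_ : (fun y => _) = hmon m (u :: us)); last by apply/funext => y; rewrite hmon_cons.
  by apply: hcomb_mon => //; rewrite big_cons ler_wpM2l ?enorm_ge0.
- rewrite (_ : (fun y => _) = (fun y => (enorm y)^-1 * edot y u * f y + (enorm y)^-1 * edot y u * g y)).
    by apply: (hcomb_add IH1 IH2); rewrite -mulrDr ler_wpM2l ?enorm_ge0.
  by apply/funext => y; rewrite mulrDr.
- rewrite (_ : (fun y => _) = (fun y => a * ((enorm y)^-1 * edot y u * f y))).
    by apply: (hcomb_scale IH); rewrite mulrCA ler_wpM2l ?enorm_ge0.
  by apply/funext => y; rewrite mulrCA.
Qed.

Lemma hcomb_dhmon m us v :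
  hcomb m.-1 (size us).+1 ((m + 2 * size us)%:R * enorm v * \prod_(u <- us) enorm u)
    (dhmon m us v).
Proof.
elim: us => [|u us IH] /=.
  apply: (@hcomb_scale _ _ _ _ (enorm v)); first by apply: hcomb_mon; rewrite ?big_seq1.
  by rewrite big_nil mulr1 muln0 addn0 normr_nat.
pose P := \prod_(u <- us) enorm u.
have P0 : 0 <= P by exact: prod_enorm_ge0.
have h1 : hcomb m.-1 (size us).+2 (enorm v * enorm u * P) (fun y => edot v u * hmon m.-1 us y).
  apply: (@hcomb_scale _ _ _ _ P); first by apply: hcomb_mon => //; lia.
  by rewrite ler_wpM2r// normr_edot_le.
have h2 : hcomb m.-1 (size us).+2 (enorm v * enorm u * P) (fun y => -1 * hmon m.-1 [:: u, v & us] y).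
  apply: (@hcomb_scale _ _ _ _ (enorm v * enorm u * P)).
    by apply: hcomb_mon => //; rewrite !big_cons mulrCA mulrA.
  by rewrite normrN1 mul1r.
have h3 := hcomb_mul u IH.
have := hcomb_add (hcomb_add h1 h2 (lexx _)) h3 (lexx _).
rewrite (_ : (fun y => _) = dhmon m (u :: us) v); last first.
  by apply/funext => y /=; rewrite mulN1r.
move=> /hcomb_le; apply => //.
rewrite big_cons -/P mulnS addnCA natrD; nra.
Qed.

Lemma hcomb_derive m r K f : hcomb m r K f -> (1 < m)%N ->
  (forall y, differentiable f y) /\
  forall v, hcomb m.-1 r.+1 ((m + 2 * r)%:R * enorm v * K) ('D_v f).
Proof.
move=> h m1; elim: h => {f K} [us K hs hp|f g K1 K2 K _ [d1 IH1] _ [d2 IH2] hK|a f K1 K _ [d1 IH] hK].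
- split=> [y|v]; first exact: (hmon_diff us y m1).1.
  rewrite (_ : 'D_v _ = dhmon m us v); last first.
    by apply/funext => y; rewrite (hmon_diff us y m1).2.
  apply: (hcomb_le (hcomb_dhmon m us v)); first by [].
  apply: ler_pM => //; rewrite ?mulr_ge0 ?enorm_ge0 ?prod_enorm_ge0//.
  by rewrite ler_wpM2r ?enorm_ge0// ler_nat; lia.
- split=> [y|v]; first exact: differentiableD.
  rewrite (_ : 'D_v _ = fun y => 'D_v f y + 'D_v g y).
    apply: (hcomb_add (IH1 v) (IH2 v)); rewrite -mulrDr ler_wpM2l// mulr_ge0 ?enorm_ge0//.
  by apply/funext => y; rewrite deriveD//; exact: diff_derivable.
- split=> [y|v]; first exact: (differentiableZ a).
  rewrite (_ : 'D_v _ = fun y => a * 'D_v f y).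
    by apply: (hcomb_scale (IH v)); rewrite mulrCA ler_wpM2l// mulr_ge0 ?enorm_ge0.
  by apply/funext => y; rewrite (deriveZ a)//; exact: diff_derivable.
Qed.

Lemma hcomb0 m r K f : (0 < m)%N -> hcomb m r K f -> f 0 = 0.
Proof.
move=> m0; elim=> {f K} [us K _ _|f g K1 K2 K _ -> _ -> _|a f K1 K _ -> _].
- exact: hmon0.
- exact: addr0.
- exact: mulr0.
Qed.

Lemma enorm_unitK y : enorm y *: ((enorm y)^-1 *: y) = y.
Proof.
have [->|y0] := eqVneq y 0; first by rewrite !scaler0.
by rewrite scalerA mulfV ?scale1r// gt_eqF ?enorm_gt0.
Qed.

Lemma enorm_unit_le y : enorm ((enorm y)^-1 *: y) <= 1.
Proof.
have [->|y0] := eqVneq y 0; first by rewrite scaler0 enorm0.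
by rewrite enormZ ger0_norm ?invr_ge0 ?enorm_ge0// mulVf// gt_eqF ?enorm_gt0.
Qed.

(** Normalization is Lipschitz away from 0 with constant 2/|y|; in the multiplied form the estimate
    persists at the origin. *)
Lemma enorm_unit_dist x y :
  enorm y * enorm ((enorm x)^-1 *: x - (enorm y)^-1 *: y) <= 2 * enorm (x - y).
Proof.
rewrite -[X in X * _]ger0_norm ?enorm_ge0// -enormZ scalerBr enorm_unitK.
have -> : enorm y *: ((enorm x)^-1 *: x) - y = (enorm y - enorm x) *: ((enorm x)^-1 *: x) + (x - y).
  by rewrite scalerBl enorm_unitK addrA subrK.
apply: (le_trans (enormD _ _)); rewrite enormZ mulr_natl mulr2n lerD2r.
apply: (@le_trans _ _ (`|enorm y - enorm x| * 1)).
  by rewrite ler_wpM2l ?enorm_unit_le.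
by rewrite mulr1 enormB enorm_dist.
Qed.

(** A function of degree 1 may have a kink at 0 but is globally Lipschitz: the factor |y| pays for
    the singularity of y/|y|. *)
Lemma hmon1_lip us x y : `|hmon 1 us x - hmon 1 us y| <=
  (2 * size us + 1)%:R * \prod_(u <- us) enorm u * enorm (x - y).
Proof.
elim: us => [|u us IH]; first by rewrite /hmon !big_nil !mulr1 mul1r enorm_dist.
rewrite !hmon_cons big_cons; set P := \prod_(u <- us) _ in IH *.
have P0 : 0 <= P by exact: prod_enorm_ge0.
have nu := enorm_ge0 u.
have ha := unit_edot_le x u.
have hab : `|(enorm x)^-1 * edot x u - (enorm y)^-1 * edot y u| * enorm y <= enorm u * (2 * enorm (x - y)).
  rewrite -!edotZl -edotNl -edotDl.
  apply: (@le_trans _ _ (enorm ((enorm x)^-1 *: x - (enorm y)^-1 *: y) * enorm u * enorm y)).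
    by rewrite ler_wpM2r ?enorm_ge0 ?normr_edot_le.
  rewrite [_ * enorm u]mulrC -mulrA ler_wpM2l// mulrC; exact: enorm_unit_dist.
have hy := hmon_le 1 us y; rewrite -/P expr1 in hy.
move: (_^-1 * edot x u) (_^-1 * edot y u) (hmon 1 us x) (hmon 1 us y) ha hab hy IH => a b s t ha hab ht hst.
have -> : a * s - b * t = a * (s - t) + (a - b) * t by ring.
apply: (le_trans (ler_normD _ _)); rewrite !normrM.
have h1 : `|a| * `|s - t| <= enorm u * ((2 * size us + 1)%:R * P * enorm (x - y)).
  exact: ler_pM.
have h2 : `|a - b| * `|t| <= enorm u * (2 * enorm (x - y)) * P.
  apply: (@le_trans _ _ (`|a - b| * (enorm y * P))); first by rewrite ler_wpM2l.
  by rewrite [leLHS]mulrA ler_wpM2r.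
apply: (le_trans (lerD h1 h2)); rewrite le_eqVlt; apply/orP; left; apply/eqP.
by rewrite mulnS !natrD; ring.
Qed.

Lemma hcomb1_lip r K f x y : hcomb 1 r K f ->
  `|f x - f y| <= (2 * r + 1)%:R * K * enorm (x - y).
Proof.
elim=> {f K} [us K hs hp|f g K1 K2 K _ IH1 _ IH2 hK|a f K1 K _ IH hK].
- apply: (le_trans (hmon1_lip us x y)); rewrite ler_wpM2r ?enorm_ge0//.
  by apply: ler_pM => //; rewrite ?prod_enorm_ge0// ler_nat; lia.
- rewrite opprD addrACA; apply: (le_trans (ler_normD _ _)); apply: (le_trans (lerD IH1 IH2)).
  by rewrite -mulrDl -mulrDr ler_wpM2r ?enorm_ge0// ler_wpM2l.
- rewrite -mulrBr normrM; apply: (le_trans (ler_wpM2l (normr_ge0 a) IH)).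
  by rewrite mulrA mulrCA ler_wpM2r ?enorm_ge0// ler_wpM2l.
Qed.

Definition powreg (p : nat) (y : V) : R := enorm y ^+ p.+1.

Lemma Dn_powreg p vs : (size vs <= p)%N ->
  hcomb (p.+1 - size vs) (size vs) ((2 * p + 1)%:R ^+ size vs * \prod_(v <- vs) enorm v)
    (Dn (powreg p) vs).
Proof.
elim: vs => [_|v vs IH /= hs].
  rewrite (_ : powreg p = hmon p.+1 [::]); last by apply/funext => y; rewrite /hmon big_nil mulr1.
  by rewrite subn0; apply: hcomb_mon; rewrite // expr0 mul1r.
have [|d1] := hcomb_derive (IH (ltnW hs)); first by lia.
move=> /(_ v); rewrite -subnS => /hcomb_le; apply => //.
rewrite big_cons exprS mulrACA -!mulrA.
have n0 := prod_enorm_ge0 vs; have nv := enorm_ge0 v.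
rewrite ler_wpM2r ?mulr_ge0 ?exprn_ge0// ler_nat; lia.
Qed.

(** Each derivative costs at most a factor 2p+1; after [p] of them the degree is 1, and the
    Lipschitz bound for degree 1 costs the last factor. *)
Lemma lip_deriv_powreg p : lip_deriv p ((2 * p + 1)%:R ^+ p.+1) (powreg p).
Proof.
split=> [vs x hs|vs x y hs].
  have h := Dn_powreg (ltnW hs).
  by apply: (hcomb_derive h _).1; lia.
have := @Dn_powreg p vs; rewrite hs leqnn subSnn => /(_ isT) /(@hcomb1_lip _ _ _ x y).
by rewrite exprS !mulrA => /le_trans; apply; rewrite mulrAC.
Qed.

Lemma Dn_powreg0 p vs : (size vs <= p)%N -> Dn (powreg p) vs 0 = 0.
Proof. by move=> hs; apply: hcomb0 (Dn_powreg hs); lia. Qed.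

Lemma powreg_diff p y : (0 < p)%N -> differentiable (powreg p) y /\
  forall v, 'D_v (powreg p) y = p.+1%:R * enorm y ^+ p.-1 * edot y v.
Proof.
move=> p0; have [df D] := @hmon_diff p.+1 [::] y p0.
have E : powreg p = hmon p.+1 [::] by apply/funext => z; rewrite /hmon big_nil mulr1.
rewrite E; split=> // v; rewrite D /= /hmon big_seq1.
have [->|y0] := eqVneq y 0; first by rewrite edot0l !mulr0.
have n0 := enorm_gt0 y0.
by case: p p0 {df D E} => // p _; rewrite /= exprS; field; rewrite gt_eqF.
Qed.

End Regularizer.

(** * Stability of [lip_deriv], and convexity expressed by gradients *)

Section Closure.
Context {R : realType} {d : nat}.
Local Notation V := 'rV[R]_d.
Implicit Types (f g phi : V -> R) (x y u v w : V) (us vs ws : seq V).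

Lemma derive_shiftB f c v y : 'D_v (fun y => f (y - c)) y = 'D_v f (y - c).
Proof.
rewrite /derive; set F := fun h => _; set G := fun h => _.
by rewrite (_ : F = G)//; apply/funext => h; rewrite /F /G /= addrA.
Qed.

Lemma differentiable_shiftB f c y : differentiable f (y - c) ->
  differentiable (fun y => f (y - c)) y.
Proof.
by move=> df; apply: (@differentiable_comp _ _ _ _ (fun y => y - c) f).
Qed.

Lemma Dn_shiftB f c vs : Dn (fun y => f (y - c)) vs = fun y => Dn f vs (y - c).
Proof.
by elim: vs => //= v vs ->; apply/funext => y; rewrite derive_shiftB.
Qed.

Lemma lip_deriv_shiftB p L f c : lip_deriv p L f -> lip_deriv p L (fun y => f (y - c)).
Proof.
move=> [h1 h2]; split=> [vs x hs|vs x y hs]; rewrite Dn_shiftB.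
  by apply: differentiable_shiftB; apply: h1.
have -> : x - y = x - c - (y - c) by rewrite opprB addrA subrK.
exact: h2.
Qed.

Lemma Dn_add p f g vs : ndifferentiable p f -> ndifferentiable p g -> (size vs <= p)%N ->
  Dn (fun y => f y + g y) vs = fun y => Dn f vs y + Dn g vs y.
Proof.
move=> hf hg; elim: vs => //= v vs IH hs; rewrite IH ?(ltnW hs)//.
apply/funext => y; have [df dg] := (hf vs y hs, hg vs y hs).
by rewrite -[LHS]/('D_v (Dn f vs + Dn g vs) y) deriveD//; exact: diff_derivable.
Qed.

Lemma Dn_scale p f a vs : ndifferentiable p f -> (size vs <= p)%N ->
  Dn (fun y => a * f y) vs = fun y => a * Dn f vs y.
Proof.
move=> hf; elim: vs => //= v vs IH hs; rewrite IH ?(ltnW hs)//.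
by apply/funext => y; rewrite (deriveZ a)//; apply: diff_derivable; exact: hf.
Qed.

Lemma lip_deriv_add p L M f g : lip_deriv p L f -> lip_deriv p M g ->
  lip_deriv p (L + M) (fun y => f y + g y).
Proof.
move=> [f1 f2] [g1 g2]; split=> [vs x hs|vs x y hs].
  rewrite (Dn_add f1 g1 (ltnW hs)); apply: differentiableD; [exact: f1|exact: g1].
rewrite (Dn_add f1 g1) ?hs// opprD addrACA; apply: (le_trans (ler_normD _ _)).
by rewrite !mulrDl lerD ?f2 ?g2.
Qed.

Lemma lip_deriv_scale p L f a : lip_deriv p L f ->
  lip_deriv p (`|a| * L) (fun y => a * f y).
Proof.
move=> [f1 f2]; split=> [vs x hs|vs x y hs].
  rewrite (Dn_scale _ f1 (ltnW hs)); apply: (differentiableZ a); exact: f1.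
by rewrite (Dn_scale _ f1) ?hs// -mulrBr normrM -!mulrA ler_wpM2l// mulrA f2.
Qed.

Lemma lip_deriv_taylor p phi x : ndifferentiable p phi -> lip_deriv p 0 (taylor p phi x).
Proof.
move=> h; split=> [|vs y z hs]; first exact: ndifferentiable_taylor.
by rewrite Dn_taylor ?hs// subnn /taylor !big_geq// subrr normr0 !mul0r.
Qed.

Lemma lip_deriv_le p L M f : lip_deriv p L f -> L <= M -> lip_deriv p M f.
Proof.
move=> [h1 h2] LM; split=> // vs x y hs; apply: (le_trans (h2 _ _ _ hs)).
by rewrite ler_wpM2r ?prod_enorm_ge0// ler_wpM2r ?enorm_ge0.
Qed.

Definition grad_convex f := forall x y, f x + 'D_(y - x) f x <= f y.

(** The chord inequality at x + t(y-x) is compared with the first-order expansion and divided by a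
    small [t]. *)
Lemma convex_grad_convex f : convex_fun f -> (forall x, differentiable f x) -> grad_convex f.
Proof.
move=> cf df x y; set h := y - x; rewrite -lerBrDl; apply/ler_addgt0Pr => e e0.
have N0 : 0 < enorm h + 1 by rewrite ltr_wpDl ?enorm_ge0.
have e' : 0 < e / (enorm h + 1) by rewrite divr_gt0.
have [r r0 hr] := differentiable_expand (df x) e'.
pose t := Num.min 1 (r / (enorm h + 1)) / 2.
have m0 : 0 < Num.min 1 (r / (enorm h + 1)) by rewrite lt_min ltr01 divr_gt0.
have t0 : 0 < t by rewrite divr_gt0.
have tm : t < Num.min 1 (r / (enorm h + 1)) by rewrite ltr_pdivrMr// ltr_pMr// ltr1n.
move: tm; rewrite lt_min => /andP[t1 tr].
have hk : enorm (t *: h) < r.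
  rewrite enormZ gtr0_norm//; move: tr; rewrite ltr_pdivlMr// mulrDr mulr1.
  by apply: le_lt_trans; rewrite lerDl ltW.
have := hr _ hk; rewrite deriveZ_dir// enormZ (gtr0_norm t0) ler_norml => /andP[h1 _].
have t01 : 0 <= t <= 1 by rewrite !ltW.
have h2 : f (x + t *: h) <= t * f y + (1 - t) * f x.
  have -> : x + t *: h = t *: y + (1 - t) *: x.
    by rewrite /h scalerBl scale1r scalerBr addrCA.
  by have := cf (Itv01 (ltW t0) (ltW t1)) y x; rewrite !in_setE => /(_ I I).
rewrite -(ler_pM2l t0).
have h3 : e / (enorm h + 1) * (t * enorm h) <= t * e.
  rewrite mulrCA ler_pM2l// mulrAC ler_pdivrMr// ler_pM2l//.
  by rewrite lerDl.
nra.
Qed.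

Lemma grad_convex_mono f x h : (forall x, differentiable f x) -> grad_convex f ->
  'D_h f x <= 'D_h f (x + h).
Proof.
move=> df cf; have := cf x (x + h); have := cf (x + h) x.
have -> : x - (x + h) = - h by rewrite opprD addNKr.
have -> : x + h - x = h by rewrite addrAC subrr add0r.
rewrite -scaleN1r deriveZ_dir// mulN1r; lra.
Qed.

Definition strong_mono (s : nat) (sigma : R) f := forall x h,
  sigma * enorm h ^+ s <= 'D_h f (x + h) - 'D_h f x.

Lemma strong_mono_uc s sigma f : (0 < s)%N -> (forall x, differentiable f x) ->
  strong_mono s sigma f -> uniformly_convex s sigma f.
Proof.
move=> s0 df sm x y; rewrite edot_grad//; set h := y - x.
pose u (t : R) := f (x + t *: h) - 'D_h f x * t ^+ 1 - sigma / s%:R * enorm h ^+ s * t ^+ s.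
pose du (t : R) := 'D_h f (x + t *: h) - 'D_h f x * (1%:R * t ^+ 0)
  - sigma / s%:R * enorm h ^+ s * (s%:R * t ^+ s.-1).
have hu (t : R) : is_derive t (1 : R) u (du t).
  apply: is_deriveB; last exact: is_derive_monomial.
  by apply: is_deriveB; [exact: is_derive_line|exact: is_derive_monomial].
have [t /andP[t0 t1]] := mvt01 hu.
have : 0 <= du t.
  (* Multiplication by [t] matches the monotonicity inequality for the increment [t *: h]. *)
  rewrite /du -(pmulr_rge0 _ t0); have := sm x (t *: h).
  rewrite enormZ gtr0_norm// !deriveZ_dir// => h1.
  have -> : t * ('D_h f (x + t *: h) - 'D_h f x * (1%:R * t ^+ 0)
      - sigma / s%:R * enorm h ^+ s * (s%:R * t ^+ s.-1))
    = (t * 'D_h f (x + t *: h) - t * 'D_h f x) - sigma * (t * enorm h) ^+ s.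
    rewrite exprMn -[in RHS](prednK s0) exprS prednK// expr0; field.
    by rewrite pnatr_eq0 -lt0n.
  by rewrite subr_ge0.
rewrite /u scale1r scale0r addr0 !expr0n !expr1n (_ : x + h = y); last by rewrite /h addrC subrK.
rewrite (gtn_eqF s0) /= => h1 h2; move: h1; rewrite -h2; lra.
Qed.

Lemma uc_grad_convex s sigma f : 0 <= sigma -> (forall x, differentiable f x) ->
  uniformly_convex s sigma f -> grad_convex f.
Proof.
move=> s0 df uc x y; apply: le_trans (uc x y); rewrite edot_grad// lerDl.
by rewrite mulr_ge0 ?divr_ge0 ?exprn_ge0 ?enorm_ge0.
Qed.

(** With a = |x+h|, b = |x| and n = |h|, twice a^(p-1)<x+h,h> - b^(p-1)<x,h> equals (a^(p-1) -
    b^(p-1))(a^2 - b^2) + n^2(a^(p-1) + b^(p-1)). The first product is nonnegative, and the larger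
    of a, b is at least n/2. *)
Lemma powreg_strong_mono p : (0 < p)%N ->
  strong_mono p.+1 (p.+1%:R / 2 ^+ p) (@powreg R d p).
Proof.
move=> p0 x h; rewrite !(powreg_diff _ p0).2; set y := x + h.
set a := enorm y; set b := enorm x; set n := enorm h.
have a0 : 0 <= a by exact: enorm_ge0. have b0 : 0 <= b by exact: enorm_ge0.
have n0 : 0 <= n by exact: enorm_ge0.
have ea : 2 * edot y h = a ^+ 2 - b ^+ 2 + n ^+ 2.
  by rewrite /a /b /n !enorm_sqr /y !edotE (edotC h x); ring.
have eb : 2 * edot x h = a ^+ 2 - b ^+ 2 - n ^+ 2.
  by rewrite /a /b /n !enorm_sqr /y !edotE (edotC h x); ring.
have nab : n <= a + b by rewrite /n -[h](addKr x) -/y addrC; apply: (le_trans (enormD _ _)); rewrite enormN.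
have hm : (n / 2) ^+ p.-1 <= a ^+ p.-1 + b ^+ p.-1.
  have n20 : 0 <= n / 2 by rewrite divr_ge0.
  have [ab|ba] := leP a b.
    apply: (@le_trans _ _ (b ^+ p.-1)); last by rewrite lerDr exprn_ge0.
    by rewrite lerXn2r ?nnegrE//; lra.
  apply: (@le_trans _ _ (a ^+ p.-1)); last by rewrite lerDl exprn_ge0.
  by rewrite lerXn2r ?nnegrE//; lra.
have hs : 0 <= (a ^+ p.-1 - b ^+ p.-1) * (a ^+ 2 - b ^+ 2).
  have [ab|/ltW ba] := leP a b.
    by rewrite mulr_le0// subr_le0 lerXn2r ?nnegrE.
  by rewrite mulr_ge0// subr_ge0 lerXn2r ?nnegrE.
have -> : p.+1%:R / 2 ^+ p * n ^+ p.+1 = p.+1%:R * ((n / 2) ^+ p.-1 * n ^+ 2 / 2).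
  case: p p0 {hm hs} => // k _; rewrite /= expr_div_n [2 ^+ _]exprS [n ^+ k.+2]exprS [n ^+ k.+1]exprS.
  by field; rewrite expf_neq0// pnatr_eq0.
rewrite -!mulrA -mulrBr ler_wpM2l//.
have n2 : 0 <= n ^+ 2 by rewrite exprn_ge0.
have := ler_wpM2r n2 hm; nra.
Qed.

End Closure.

Lemma model_mono_arith (R : realFieldType) (s h l P1 P2 T1 T2 G1 G2 : R) :
  0 <= T1 - T2 + l * (P1 - P2) -> G2 <= G1 -> s <= h / 2 * (P1 - P2) ->
  h / 2 * (P1 - P2) <= (h - l) * (P1 - P2) ->
  s <= T1 + h * P1 + G1 - (T2 + h * P2 + G2).
Proof. by move=> h1 h2 h3 h4; lra. Qed.

(** * The tensor model and its minimizer *)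

Section Model.
Context {R : realType} {d : nat}.
Local Notation V := 'rV[R]_d.
Implicit Types (c x y u v w h : V).

Lemma powreg_diff2 p z h : (1 < p)%N ->
  differentiable ('D_h (powreg p)) z /\
  p.+1%:R * enorm z ^+ p.-1 * enorm h ^+ 2 <= 'D_h ('D_h (powreg p)) z.
Proof.
move=> p1; have p0 := ltnW p1.
have E : 'D_h (powreg p) = fun y => p.+1%:R * hmon p [:: h] y.
  apply/funext => y; rewrite (_ : powreg p = hmon p.+1 [::]).
    by rewrite (hmon_diff [::] y (p0 : 1 < p.+1)%N).2.
  by apply/funext => z'; rewrite /hmon big_nil mulr1.
have [d1 d2] := hmon_diff [:: h] z p1.
rewrite E; split; first exact: (differentiableZ p.+1%:R).
rewrite (deriveZ p.+1%:R); last exact: diff_derivable.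
rewrite d2 /= !hmon_cons /hmon big_nil mulr1 -enorm_sqr -[_ *: _]/(_ * _).
set e := _^-1 * edot z h; set a := enorm z ^+ _.
have a0 : 0 <= a by rewrite exprn_ge0 ?enorm_ge0.
rewrite -mulrA ler_wpM2l//.
have -> : enorm h ^+ 2 * a - e * (e * a) + e * (p%:R * (e * a)) =
  a * enorm h ^+ 2 + (p%:R - 1) * (e ^+ 2 * a) by ring.
rewrite lerDl; apply: mulr_ge0; first by rewrite subr_ge0 ler1n.
by rewrite mulr_ge0 ?sqr_ge0.
Qed.

Context (p : nat) (L H : R) (phi gam : V -> R).
Hypotheses (p0 : (0 < p)%N) (L0 : 0 <= L) (LH : 2 * L <= H) (H0 : 0 < H).
Hypotheses (hphi : lip_deriv p L phi) (cphi : grad_convex phi).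
Hypotheses (dgam : forall x, differentiable gam x) (cgam : grad_convex gam).

Let dphi x : differentiable phi x := ndifferentiable1 p0 hphi.1 x.

Lemma tensor_model_diff c y : differentiable (tensor_model p H phi gam c) y /\
  forall v, 'D_v (tensor_model p H phi gam c) y =
    'D_v (taylor p phi c) y
    + H / p`!%:R * (p.+1%:R * enorm (y - c) ^+ p.-1 * edot (y - c) v) + 'D_v gam y.
Proof.
have [d1 _] := taylor_diff c y hphi.1.
have [d2 D2] := powreg_diff (y - c) p0.
have d3 := differentiable_shiftB d2.
have d4 : differentiable (fun y => H / p`!%:R * powreg p (y - c)) y.
  exact: (differentiableZ (H / p`!%:R)).
have d5 : differentiable (fun y => taylor p phi c y + H / p`!%:R * powreg p (y - c)) y.
  exact: differentiableD.
split=> [|v]; first exact: differentiableD.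
rewrite -[LHS]/('D_v ((fun y => taylor p phi c y + H / p`!%:R * powreg p (y - c)) + gam) y).
rewrite deriveD; [|exact: diff_derivable|exact: diff_derivable].
rewrite -[X in 'D_v X y + _]/(taylor p phi c + (H / p`!%:R \*: (fun y => powreg p (y - c)))).
rewrite deriveD; [|exact: diff_derivable|exact: diff_derivable].
rewrite deriveZ; last exact: diff_derivable.
by rewrite derive_shiftB D2.
Qed.

(** The Taylor polynomial of a convex function need not be convex, but its second derivative differs
    from that of [phi] by at most L|y-c|^(p-1)/(p-1)!, which the added multiple of |y-c|^(p+1)
    compensates. *)
Lemma taylor_reg_mono c x h :
  0 <= 'D_h (taylor p phi c) (x + h) - 'D_h (taylor p phi c) x
    + L / (p.-1)`!%:R / p.+1%:R * ('D_h (powreg p) (x + h - c) - 'D_h (powreg p) (x - c)).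
Proof.
have L1 : 0 <= L / (p.-1)`!%:R / p.+1%:R by rewrite !divr_ge0.
have hpow : 0 <= 'D_h (powreg p) (x + h - c) - 'D_h (powreg p) (x - c).
  have := powreg_strong_mono p0 (x - c) h; rewrite addrAC.
  by apply: le_trans; rewrite mulr_ge0 ?divr_ge0 ?exprn_ge0 ?enorm_ge0.
have D1 y : 'D_h (taylor p phi c) y = taylor p.-1 ('D_h phi) c y.
  by rewrite (taylor_diff c y hphi.1).2; case: p p0.
have [p1|p1] := ltnP 1 p; last first.
  (* For p = 1 the polynomial is affine, and [phi] has no second derivative to compare with. *)
  have T y : taylor p.-1 ('D_h phi) c y = 'D_h phi c.
    by rewrite /taylor big_geq ?addr0//; lia.
  by rewrite !D1 !T subrr add0r mulr_ge0.
pose K := L / (p.-1)`!%:R / p.+1%:R.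
(* Subtracting ['D_h phi] leaves a remainder that can be estimated; convexity of [phi] then enters
   only through monotonicity of its gradient, in the last line. *)
pose W (t : R) := 'D_h (taylor p phi c) (x + t *: h) - 'D_h phi (x + t *: h)
   + K * 'D_h (powreg p) (x - c + t *: h).
pose dW (t : R) := 'D_h ('D_h (taylor p phi c)) (x + t *: h) - 'D_h ('D_h phi) (x + t *: h)
   + K * 'D_h ('D_h (powreg p)) (x - c + t *: h).
have hW (t : R) : is_derive t (1 : R) W (dW t).
  have i1 : is_derive t (1 : R) (fun t => 'D_h (powreg p) (x - c + t *: h))
      ('D_h ('D_h (powreg p)) (x - c + t *: h)).
    by apply: is_derive_line; exact: (powreg_diff2 _ _ p1).1.
  have i2 := @is_deriveZ R R R _ K t 1 _ i1.
  apply: is_deriveD; apply: is_deriveB; apply: is_derive_line.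
    by apply: (ndifferentiable_taylor c hphi.1 (vs := [:: h])).
  by apply: (hphi.1 [:: h]).
have : W 0 <= W 1.
  apply: (ge0_derive_le01 hW) => t _ _.
  have hp2 : (p.-2 + size [:: h; h] = p)%N by rewrite /= addn2; case: p p1 => [|[|k]].
  have := taylor_remainder_Dn c (x + t *: h) hphi hp2.
  have -> : p.-2.+1 = p.-1 by case: p p1 => [|[|k]].
  rewrite /= big_cons big_seq1 => h1; have {}h1 := le_trans (ler_norm _) h1.
  have h2 : K * (p.+1%:R * enorm (x - c + t *: h) ^+ p.-1 * enorm h ^+ 2) <=
    K * 'D_h ('D_h (powreg p)) (x - c + t *: h).
    by rewrite ler_wpM2l//; exact: (powreg_diff2 _ _ p1).2.
  rewrite /dW.
  have E : K * (p.+1%:R * enorm (x - c + t *: h) ^+ p.-1 * enorm h ^+ 2) =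
     L * (enorm h * enorm h) * enorm (x - c + t *: h) ^+ p.-1 / (p.-1)`!%:R.
    by rewrite /K; field; rewrite nat1r !pnatr_eq0 -?lt0n fact_gt0.
  rewrite (addrAC x) in h1; have {h2}h3 := le_trans h1 (eq_ind _ (fun z => z <= _) h2 _ E).
  by rewrite -(opprB ('D_h ('D_h phi) _)) addrC subr_ge0.
rewrite /W scale1r scale0r !addr0 (addrAC x) -/K => h1.
have := grad_convex_mono x h dphi cphi; lra.
Qed.

(** The constant of half of the regularizer: since 2L <= H, at most the other half is spent on the
    missing convexity of the Taylor polynomial. *)
Definition model_sigma : R := H * p.+1%:R / (2 ^+ p.+1 * p`!%:R).

Lemma tensor_model_strong_mono c :
  strong_mono p.+1 model_sigma (tensor_model p H phi gam c).
Proof.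
move=> x h; rewrite !(tensor_model_diff _ _).2 -!(powreg_diff _ p0).2.
have h1 := taylor_reg_mono c x h.
have h2 := grad_convex_mono x h dgam cgam.
have := powreg_strong_mono p0 (x - c) h; rewrite (addrAC x).
move: ('D_h (powreg p) (x + h - c)) h1 => P1; move: ('D_h (powreg p) (x - c)) => P2 h1 h3.
set n := enorm h ^+ p.+1 in h3 *.
have n0 : 0 <= n by rewrite exprn_ge0 ?enorm_ge0.
have P12 : 0 <= P1 - P2 by apply: le_trans h3; apply: mulr_ge0 => //; rewrite divr_ge0 ?exprn_ge0.
have h4 : H / p`!%:R / 2 * (P1 - P2) <= (H / p`!%:R - L / (p.-1)`!%:R / p.+1%:R) * (P1 - P2).
  rewrite ler_wpM2r//.
  have -> : L / (p.-1)`!%:R / p.+1%:R = L / p`!%:R * (p%:R / p.+1%:R).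
    case: p p0 => // k _; rewrite factS natrM /=; field.
    by rewrite nat1r -natrD !pnatr_eq0 -!lt0n fact_gt0.
  have q1 : p%:R / p.+1%:R <= 1 :> R by rewrite ler_pdivrMr// mul1r ler_nat.
  have f0 : 0 < p`!%:R^-1 :> R by rewrite invr_gt0 ltr0n fact_gt0.
  have h0 := ler_wpM2l L0 q1.
  set f := p`!%:R^-1 in f0 *; set q := p%:R / p.+1%:R in q1 h0 *.
  rewrite -subr_ge0 (_ : _ - _ = f * (H / 2 - L * q)); last by field.
  rewrite mulr_ge0 ?(ltW f0)// subr_ge0 (le_trans h0)// mulr1 ler_pdivlMr// mulrC.
  by [].
have h5 : model_sigma * n = H / p`!%:R / 2 * (p.+1%:R / 2 ^+ p * n).
  rewrite /model_sigma exprS; field.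
  by rewrite expf_neq0 ?pnatr_eq0// -lt0n fact_gt0.
have H1 : 0 <= H / p`!%:R / 2 by rewrite !divr_ge0// ltW.
have := ler_wpM2l H1 h3; rewrite -h5 => h6.
exact: (model_mono_arith h1 h2 h6 h4).
Qed.

Lemma model_sigma_gt0 : 0 < model_sigma.
Proof. by rewrite divr_gt0 ?mulr_gt0 ?exprn_gt0// ltr0n fact_gt0. Qed.

Lemma tensor_model_uc c :
  uniformly_convex p.+1 model_sigma (tensor_model p H phi gam c).
Proof.
apply: strong_mono_uc => // [x|]; [exact: (tensor_model_diff c x).1|].
exact: tensor_model_strong_mono.
Qed.

Lemma lip_deriv_tensor_model c Lg : lip_deriv p Lg gam ->
  lip_deriv p (H / p`!%:R * (2 * p + 1)%:R ^+ p.+1 + Lg) (tensor_model p H phi gam c).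
Proof.
move=> hg; apply: (lip_deriv_add _ hg).
have h0 : 0 <= H / p`!%:R by rewrite divr_ge0// ltW.
have h1 := lip_deriv_scale (H / p`!%:R) (lip_deriv_shiftB c (@lip_deriv_powreg R d p)).
rewrite ger0_norm// in h1; have := lip_deriv_add (lip_deriv_taylor c hphi.1) h1.
by rewrite add0r.
Qed.

(** At the center the derivatives of the regularizer up to order [p] vanish, and the Taylor
    polynomial reproduces those of [phi]. *)
Lemma Dn_tensor_model_center c vs : ndifferentiable p gam -> (size vs <= p)%N ->
  Dn (tensor_model p H phi gam c) vs c = Dn phi vs c + Dn gam vs c.
Proof.
move=> hg hs.
have h1 := ndifferentiable_taylor c hphi.1.
have h2 := (lip_deriv_shiftB c (@lip_deriv_powreg R d p)).1.
have h3 := (lip_deriv_scale (H / p`!%:R) (lip_deriv_shiftB c (@lip_deriv_powreg R d p))).1.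
have h4 := (lip_deriv_add (lip_deriv_taylor c hphi.1) (lip_deriv_scale (H / p`!%:R) (lip_deriv_shiftB c (@lip_deriv_powreg R d p)))).1.
rewrite (Dn_add h4 hg hs) (Dn_add h1 h3 hs) (Dn_scale _ h2 hs) Dn_shiftB subrr Dn_powreg0//.
by rewrite Dn_taylor; [rewrite taylor_center mulr0 addr0|exact: hphi.1|].
Qed.

End Model.

(** * Minimizers of uniformly convex functions *)

Section Argmin.
Context {R : realType} {d : nat}.
Local Notation V := 'rV[R]_d.
Implicit Types (f : V -> R) (c x y z u v w h : V).

Lemma derive_argmin f z v : differentiable f z -> is_argmin f z -> 'D_v f z = 0.
Proof.
move=> df mz.
suff pos w : 0 <= 'D_w f z.
  apply/eqP; rewrite eq_le pos andbT -oppr_ge0.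
  by rewrite -mulN1r -deriveZ_dir// scaleN1r pos.
rewrite -oppr_le0; apply/ler_addgt0Pr => e e0; rewrite add0r.
have N0 : 0 < enorm w + 1 by rewrite ltr_wpDl ?enorm_ge0.
have [r r0 hr] := differentiable_expand df (divr_gt0 e0 N0).
have t0 : 0 < r / 2 / (enorm w + 1) by rewrite !divr_gt0.
set t := r / 2 / (enorm w + 1) in t0.
have tw : enorm (t *: w) < r.
  rewrite enormZ gtr0_norm// /t mulrAC ltr_pdivrMr//.
  have := enorm_ge0 w; nra.
have := hr _ tw; rewrite deriveZ_dir// enormZ (gtr0_norm t0) => h.
have h1 := le_trans (ler_norm _) h.
have := mz (z + t *: w); rewrite -subr_ge0 => h2.
rewrite -(ler_pM2l t0) mulrN -[X in X <= _]add0r.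
have h3 : e / (enorm w + 1) * (t * enorm w) <= t * e.
  rewrite mulrCA ler_pM2l// mulrAC ler_pdivrMr// ler_pM2l//.
  by rewrite lerDl.
by apply: le_trans h3; apply: le_trans h1; rewrite lerD2r.
Qed.

Lemma argmin_of_derive f z : grad_convex f -> (forall v, 'D_v f z = 0) -> is_argmin f z.
Proof. by move=> cf D0 y; have := cf z y; rewrite D0 addr0. Qed.

Lemma uc_argmin s sigma f z y : (forall x, differentiable f x) ->
  uniformly_convex s sigma f -> is_argmin f z ->
  f z + sigma / s%:R * enorm (y - z) ^+ s <= f y.
Proof.
by move=> df uc mz; have := uc z y; rewrite edot_grad// (derive_argmin _ (df z) mz) addr0.
Qed.

Lemma uc_argmin_unique s sigma f z z' : (0 < s)%N -> 0 < sigma ->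
  (forall x, differentiable f x) -> uniformly_convex s sigma f ->
  is_argmin f z -> is_argmin f z' -> z' = z.
Proof.
move=> s0 sg df uc mz mz'; have := uc_argmin z' df uc mz; have := mz' z.
have c0 : 0 < sigma / s%:R by rewrite divr_gt0 ?ltr0n.
move=> h1 h2; have h3 : sigma / s%:R * enorm (z' - z) ^+ s <= 0.
  by have := le_trans h2 h1; rewrite gerDl.
apply/eqP; rewrite -subr_eq0; apply: contraTT h3 => hz.
by rewrite -ltNge mulr_gt0// exprn_gt0// enorm_gt0.
Qed.

Lemma closed_enorm_ball (r : R) : closed [set y : V | enorm y <= r].
Proof.
rewrite (_ : [set y | _] = (@enorm R d) @^-1` [set t : R | t <= r]); last by [].
by apply: closed_comp; [move=> x _; exact: enorm_continuous|exact: closed_le].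
Qed.

Lemma uc_exists_argmin s sigma f : (1 < s)%N -> 0 < sigma ->
  (forall x, differentiable f x) -> uniformly_convex s sigma f ->
  exists z, is_argmin f z.
Proof.
move=> s1 sg df uc; set G := enorm (grad f 0).
have sR : 0 < s%:R :> R by rewrite ltr0n ltnW.
(* Outside this ball the uniform convexity term outweighs G|y|, so the values exceed that at 0. The
   maximum with 1 is used for |y| <= |y|^(s-1). *)
pose r := Num.max 1 (G * s%:R / sigma).
have r1 : 1 <= r by rewrite le_max lexx.
have rG : G * s%:R / sigma <= r by rewrite le_max lexx orbT.
have r0 : 0 <= r by apply: le_trans r1.
have [z zA zmin] : exists2 z, z \in [set y : V | enorm y <= r] &
    forall t, t \in [set y : V | enorm y <= r] -> f z <= f t.
  apply: EVT_min_rV.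
  - by exists 0; rewrite /= enorm0.
  - apply: bounded_closed_compact; last exact: closed_enorm_ball.
    exists r; split; first exact: num_real.
    move=> M rM y /= yr; apply: le_trans (ltW rM); apply: le_trans yr; exact: norm_le_enorm.
  - by apply: continuous_subspaceT => y; apply: differentiable_continuous.
exists z => y; have [yr|yr] := leP (enorm y) r; first by apply: zmin; rewrite in_setE.
apply: (@le_trans _ _ (f 0)); first by apply: zmin; rewrite in_setE /= enorm0.
apply: le_trans (uc 0 y); rewrite subr0 -addrA lerDl.
have h1 := normr_edot_le (grad f 0) y; rewrite ler_norml -/G in h1.
have /andP[h2 _] := h1.
have h3 : G * enorm y <= sigma / s%:R * enorm y ^+ s.
  clearbody r; clear zA zmin; case: s s1 {uc} sR rG => [|[|s]]// _ sR rG.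
  rewrite exprSr mulrA ler_wpM2r ?enorm_ge0//.
  apply: (@le_trans _ _ (sigma / s.+2%:R * r)).
    by move: rG; rewrite ler_pdivrMr// -ler_pdivlMr// [r * sigma]mulrC mulrAC.
  apply: ler_wpM2l; first by rewrite divr_ge0// ltW.
  apply: (le_trans (ltW yr)); rewrite exprS ler_peMr ?enorm_ge0//.
  by rewrite exprn_ege1// (le_trans r1)// ltW.
by rewrite -lerBlDl sub0r (le_trans _ h3)// lerNl.
Qed.

End Argmin.

(** * Continuous dependence of the tensor step on its center *)

Section CenterContinuity.
Context {R : realType} {d : nat}.
Local Notation V := 'rV[R]_d.
Implicit Types (f phi : V -> R) (c x y z u v w h : V) (us : seq V).

Lemma for_continuousM (T : topologicalType) (F G : T -> R) (t : T) :
  {for t, continuous F} -> {for t, continuous G} -> {for t, continuous (fun s => F s * G s)}.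
Proof. exact: continuousM. Qed.

Lemma for_continuousD (T : topologicalType) (F G : T -> R) (t : T) :
  {for t, continuous F} -> {for t, continuous G} -> {for t, continuous (fun s => F s + G s)}.
Proof. exact: continuousD. Qed.

Lemma continuous_bigsum (T : topologicalType) (I : Type) (r : seq I) (F : I -> T -> R) :
  (forall i, continuous (F i)) -> continuous (fun t => \sum_(i <- r) F i t).
Proof.
move=> cF; elim: r => [|i r IH] t.
  by rewrite (_ : (fun _ => _) = cst 0); [exact: cst_continuous|apply/funext => t'; rewrite big_nil].
rewrite (_ : (fun _ => _) = F i + (fun t => \sum_(i <- r) F i t)).
  by apply: continuousD; [exact: cF|exact: IH].
by apply/funext => t'; rewrite big_cons.
Qed.

Lemma enorm_nbhs x (P : V -> Prop) :
  (\forall y \near x, P y) <-> exists2 r : R, 0 < r & forall y, enorm (y - x) < r -> P y.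
Proof.
split=> [/nbhs_normP [r /= r0 hr]|[r r0 hr]].
  exists r => // y yx; apply: hr; rewrite /ball_ /= distrC.
  exact: le_lt_trans (norm_le_enorm _) yx.
have d1 : 0 < d%:R + 1 :> R by rewrite ltr_wpDl.
apply: (@nbhs_le_nbhs_norm R V x); exists (r / (d%:R + 1)); first by rewrite /= divr_gt0.
move=> y /=; rewrite /ball_ /= distrC => yx; apply: hr; apply: (le_lt_trans (enorm_le_norm _)).
apply: (@le_lt_trans _ _ ((d%:R + 1) * `|y - x|)); first by rewrite ler_wpM2r// lerDl.
by rewrite mulrC -ltr_pdivlMr.
Qed.

Lemma lipschitz_continuous f (C : R) :
  (forall x y, `|f x - f y| <= C * enorm (x - y)) -> continuous f.
Proof.
move=> hf x; apply/(@cvgrPdist_le _ _ _ (nbhs x)) => /= e e0.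
have C1 : 0 < `|C| + 1 by rewrite ltr_wpDl.
apply/enorm_nbhs; exists (e / (`|C| + 1)); first by rewrite divr_gt0.
move=> y; rewrite ltr_pdivlMr// => yx; apply: (le_trans (hf _ _)); rewrite enormB.
apply: le_trans (ltW yx); rewrite mulrC ler_wpM2l ?enorm_ge0//.
by apply: (le_trans (ler_norm _)); rewrite lerDl.
Qed.

Lemma Dn_continuous p L phi us : lip_deriv p L phi -> (size us <= p)%N ->
  continuous (Dn phi us).
Proof.
move=> hphi; rewrite leq_eqVlt => /orP[/eqP hs|hs] x; last first.
  by apply: differentiable_continuous; apply: hphi.1.
apply: (@lipschitz_continuous _ (L * \prod_(v <- us) enorm v)) => y z.
by rewrite mulrAC; apply: hphi.2.
Qed.

(** Here [c] is both the base point and a part of the directions. Expanding one slot at a time in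
    coordinates separates the two dependences. *)
Lemma Dn_center_continuous p L phi k us z : lip_deriv p L phi -> (k + size us <= p)%N ->
  continuous (fun c => Dn phi (nseq k (z - c) ++ us) c).
Proof.
move=> hphi; elim: k us => [|k IH] us hs; first exact: Dn_continuous hphi _.
have E : (fun c => Dn phi (nseq k.+1 (z - c) ++ us) c) =
    fun c => \sum_i (z - c) 0 i * Dn phi (nseq k (z - c) ++ delta_mx 0 i :: us) c.
  apply/funext => c; rewrite -(Dn_expand _ _ hphi.1) ?size_nseq -?addSnnS//.
  by rewrite (Dn_nseq_move _ _ hphi.1) -?addSnnS.
rewrite E; apply: continuous_bigsum => i c. apply: (@for_continuousM V (fun c : V => (z - c) 0 i)
    (fun c : V => Dn phi (nseq k (z - c) ++ delta_mx 0 i :: us) c)); last first.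
  by apply: IH; rewrite /= addnS -addSn.
rewrite (_ : (fun c => _) = fun c : V => z 0 i - c 0 i).
  by apply: continuousB; [exact: cst_continuous|exact: coord_continuous].
by apply/funext => t; rewrite !mxE.
Qed.

Lemma derive_le_sum f z h : differentiable f z ->
  `|'D_h f z| <= (\sum_i `|'D_(delta_mx 0 i) f z|) * enorm h.
Proof.
move=> df; rewrite derive_coord// mulr_suml; apply: le_trans (ler_norm_sum _ _ _) _.
apply: ler_sum => i _; rewrite normrM mulrC ler_wpM2l//.
by apply: le_trans (norm_le_enorm _); exact: coord_le_norm.
Qed.

Context (p : nat) (L H : R) (phi gam : V -> R).
Hypotheses (p0 : (0 < p)%N) (L0 : 0 <= L) (LH : 2 * L <= H) (H0 : 0 < H).
Hypotheses (hphi : lip_deriv p L phi) (cphi : grad_convex phi).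
Hypotheses (dgam : forall x, differentiable gam x) (cgam : grad_convex gam).

Let model c := tensor_model p H phi gam c.

Lemma derive_model_center_continuous v z : continuous (fun c => 'D_v (model c) z).
Proof.
have dm c := (tensor_model_diff H p0 hphi dgam c z).2 v.
have E : (fun c => 'D_v (model c) z) = fun c =>
   \sum_(k < p) k`!%:R^-1 * Dn phi (nseq k (z - c) ++ [:: v]) c
   + H / p`!%:R * (p.+1%:R * enorm (z - c) ^+ p.-1 * edot (z - c) v) + 'D_v gam z.
  apply/funext => c; rewrite dm (taylor_diff _ _ hphi.1).2.
  congr (_ + _ + _); case: p p0 => // q _; rewrite taylorE.
  by apply: eq_bigr => k _; rewrite Dn_cat.
rewrite E => c.
have czc : {for c, continuous (fun c => z - c)}.
  by apply: continuousB; [exact: cst_continuous|exact: cvg_id].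
have kc (a : R) (x : V) : {for x, continuous (fun _ : V => a)} by exact: cst_continuous.
have c1 : {for c, continuous (fun c => \sum_(k < p) k`!%:R^-1 * Dn phi (nseq k (z - c) ++ [:: v]) c)}.
  apply: (@continuous_bigsum V _ _ (fun (k : 'I_p) c => k`!%:R^-1 * Dn phi (nseq k (z - c) ++ [:: v]) c)).
  move=> k x; have c0 : {for x, continuous (fun c => Dn phi (nseq k (z - c) ++ [:: v]) c)}.
    by apply: (Dn_center_continuous hphi); rewrite addn1.
  exact: (for_continuousM (kc _ x) c0).
have c2 : {for c, continuous (fun c => enorm (z - c) ^+ p.-1)}.
  apply: (@continuous_comp _ _ _ (fun c => enorm (z - c)) (fun t => t ^+ p.-1)).
    by apply: (continuous_comp czc); exact: enorm_continuous.
  exact: exprn_continuous.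
have c3 : {for c, continuous (fun c => edot (z - c) v)}.
  apply: (@continuous_comp _ _ _ (fun c => z - c) (fun y => edot y v)) => //.
  apply: (@continuous_bigsum V _ _ (fun (i : 'I_d) (y : V) => y 0 i * v 0 i)) => i x.
  exact: (for_continuousM (@coord_continuous _ _ _ 0 i x) (kc _ x)).
exact: (for_continuousD (for_continuousD c1
  (for_continuousM (kc _ c) (for_continuousM (for_continuousM (kc _ c) c2) c3))) (kc _ c)).
Qed.

(* Strong monotonicity gives sigma |z' - z|^p <= |grad (model c') z|, where z is fixed,
   so that only continuity in the center is needed. *)
Lemma model_argmin_continuous c z (e : R) : is_argmin (model c) z -> 0 < e ->
  \forall c' \near c, forall z', is_argmin (model c') z' -> enorm (z' - z) <= e.
Proof.
move=> mz e0; pose G c' := \sum_i `|'D_(delta_mx 0 i) (model c') z|.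
have dm c' y := (tensor_model_diff H p0 hphi dgam c' y).1.
have cG : continuous G.
  apply: continuous_bigsum => i x.
  apply: (@continuous_comp _ _ _ (fun c => 'D_(delta_mx 0 i) (model c) z) Num.norm).
    exact: derive_model_center_continuous.
  exact: norm_continuous.
have G0 : G c = 0.
  by rewrite /G big1// => i _; rewrite (derive_argmin _ (dm c z) mz) normr0.
have sg := @model_sigma_gt0 R p H H0.
have e1 : 0 < @model_sigma R p H * e ^+ p by rewrite mulr_gt0// exprn_gt0.
have := cG c => /(@cvgrPdist_lt _ _ _ (nbhs c)) /(_ _ e1); apply: filterS => c'.
rewrite G0 sub0r normrN => hG z' mz'.
have := tensor_model_strong_mono p0 L0 LH H0 hphi cphi dgam cgam c' z (z' - z).
have -> : z + (z' - z) = z' by rewrite addrC subrK.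
rewrite (derive_argmin _ (dm c' z') mz') sub0r => h1.
have h2 := derive_le_sum (z' - z) (dm c' z).
have h3 : @model_sigma R p H * enorm (z' - z) ^+ p.+1 <= G c' * enorm (z' - z).
  by apply: (le_trans h1); apply: le_trans h2; rewrite -normrN ler_norm.
rewrite leNgt; apply/negP => lt.
have n0 := lt_trans e0 lt.
move: h3; rewrite exprSr mulrA ler_pM2r// => h3.
have h4 : @model_sigma R p H * e ^+ p < @model_sigma R p H * enorm (z' - z) ^+ p.
  by rewrite ltr_pM2l// ltrXn2r ?nnegrE ?ltW// -lt0n p0.
have := lt_trans h4 (le_lt_trans h3 (le_lt_trans (ler_norm _) hG)).
by rewrite ltxx.
Qed.

Lemma model_argmin_exists c : exists z, is_argmin (model c) z.
Proof.
apply: (@uc_exists_argmin _ _ p.+1 (@model_sigma R p H)) => //.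
- exact: model_sigma_gt0.
- by move=> x; exact: (tensor_model_diff H p0 hphi dgam c x).1.
- exact: tensor_model_uc p0 L0 LH H0 hphi cphi dgam cgam c.
Qed.

End CenterContinuity.

(** * Choice of lambda *)

Section CatdStepSize.
Context {R : realType}.
Implicit Types (lam A : R).

Lemma catd_a_ge lam A : 0 < lam -> 0 <= A -> lam <= catd_a lam A.
Proof.
move=> l0 A0; rewrite /catd_a ler_pdivlMr// mulr_natr mulr2n lerD2l.
have h : 0 <= 4 * lam * A by rewrite !mulr_ge0// ltW.
by rewrite -[X in X <= _](ger0_norm (ltW l0)) -sqrtr_sqr ler_wsqrtr// lerDl.
Qed.

Lemma catd_a_gt0 lam A : 0 < lam -> 0 <= A -> 0 < catd_a lam A.
Proof. by move=> l0 A0; exact: lt_le_trans l0 (catd_a_ge l0 A0). Qed.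

Lemma catd_a_sqr lam A : 0 < lam -> 0 <= A -> catd_a lam A ^+ 2 = lam * (A + catd_a lam A).
Proof.
move=> l0 A0; rewrite /catd_a.
have h : 0 <= lam ^+ 2 + 4 * lam * A by rewrite addr_ge0 ?sqr_ge0// !mulr_ge0// ltW.
have := sqr_sqrtr h; set s := Num.sqrt _ => hs.
have -> : ((lam + s) / 2) ^+ 2 = (lam ^+ 2 + 2 * lam * s + s ^+ 2) / 4 by field.
by rewrite hs; field.
Qed.

Lemma catd_a_continuous A : continuous (fun lam => catd_a lam A).
Proof.
move=> lam; rewrite /catd_a.
have ci : {for lam, continuous (fun l : R => l)} by exact: cvg_id.
have ck (a : R) : {for lam, continuous (fun _ : R => a)} by exact: cst_continuous.
have cl : {for lam, continuous (fun l : R => l ^+ 2 + 4 * l * A)}.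
  apply: (for_continuousD (F := fun l : R => l ^+ 2) (G := fun l => 4 * l * A)).
    exact: exprn_continuous.
  exact: (for_continuousM (for_continuousM (ck _) ci) (ck _)).
have cs : {for lam, continuous (fun l : R => Num.sqrt (l ^+ 2 + 4 * l * A))}.
  apply: (@continuous_comp _ _ _ (fun l : R => l ^+ 2 + 4 * l * A) Num.sqrt) => //.
  exact: sqrt_continuous.
exact: (for_continuousM (for_continuousD ci cs) (ck _)).
Qed.

Context {d : nat}.
Local Notation V := 'rV[R]_d.
Implicit Types (x y : V).

Lemma catd_mid_eq lam A x y : 0 < lam -> 0 <= A ->
  (A + catd_a lam A) *: catd_mid lam A x y = A *: y + catd_a lam A *: x.
Proof.
move=> l0 A0; have a0 := catd_a_gt0 l0 A0.
have h : A + catd_a lam A != 0 by rewrite gt_eqF// ltr_wpDl.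
by rewrite /catd_mid scalerDr !scalerA ![(A + _) * _]mulrC !divfK.
Qed.

Lemma catd_mid_dist lam A x y z (r : R) : 0 < lam -> 0 <= A ->
  enorm (x - z) <= r -> enorm (y - z) <= r -> enorm (catd_mid lam A x y - z) <= r.
Proof.
move=> l0 A0 xr yr; have a0 := catd_a_gt0 l0 A0.
have s0 : 0 < A + catd_a lam A by rewrite ltr_wpDl.
have E : (A + catd_a lam A) *: (catd_mid lam A x y - z) =
    A *: (y - z) + catd_a lam A *: (x - z).
  by rewrite scalerBr catd_mid_eq// !scalerBr scalerDl opprD addrACA.
rewrite -(ler_pM2l s0) -[X in X * enorm _ <= _](gtr0_norm s0) -enormZ E.
apply: (le_trans (enormD _ _)); rewrite !enormZ ger0_norm// gtr0_norm// mulrDl.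
by apply: lerD; apply: ler_wpM2l => //; exact: ltW.
Qed.

Lemma catd_mid_far lam A x y : 0 < lam -> 0 <= A ->
  enorm (catd_mid lam A x y - x) <= A / lam * enorm (y - x).
Proof.
move=> l0 A0; have a0 := catd_a_gt0 l0 A0; have al := catd_a_ge l0 A0.
have s0 : 0 < A + catd_a lam A by rewrite ltr_wpDl.
have E : (A + catd_a lam A) *: (catd_mid lam A x y - x) = A *: (y - x).
  by rewrite scalerBr catd_mid_eq// scalerDl scalerBr opprD addrACA subrr addr0.
rewrite -(ler_pM2l s0) -[X in X * enorm _ <= _](gtr0_norm s0) -enormZ E enormZ ger0_norm//.
rewrite mulrA ler_wpM2r ?enorm_ge0//.
rewrite mulrCA ler_peMr// ler_pdivlMr// mul1r (le_trans al)// lerDr//.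
Qed.

Lemma catd_mid_continuous lam A x y : 0 < lam -> 0 <= A ->
  {for lam, continuous (fun l => catd_mid l A x y)}.
Proof.
move=> l0 A0; have a0 := catd_a_gt0 l0 A0.
have ca : {for lam, continuous (fun l => catd_a l A)} by exact: catd_a_continuous.
have ck (a : R) : {for lam, continuous (fun _ : R => a)} by exact: cst_continuous.
have ci : {for lam, continuous (fun l => (A + catd_a l A)^-1)}.
  apply: (@continuousV _ _ (fun l => A + catd_a l A)); first by rewrite gt_eqF// ltr_wpDl.
  exact: (for_continuousD (ck A) ca).
apply: (@continuousD _ V _ (fun l => (A / (A + catd_a l A)) *: y)
  (fun l => (catd_a l A / (A + catd_a l A)) *: x)).
  apply: (@continuousZl _ V _ (fun l => A / (A + catd_a l A)) y).
  exact: (for_continuousM (ck A) ci).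
apply: (@continuousZl _ V _ (fun l => catd_a l A / (A + catd_a l A)) x).
exact: (for_continuousM ca ci).
Qed.

End CatdStepSize.

(** * Existence of an admissible pair *)

Section LambdaSearch.
Context {R : realType} {d : nat}.
Local Notation V := 'rV[R]_d.
Implicit Types (c x y z u v w h : V).

Context (p : nat) (L H : R) (phi gam : V -> R) (xs : V).
Hypotheses (p0 : (0 < p)%N) (L0 : 0 <= L) (LH : 2 * L <= H) (H0 : 0 < H).
Hypotheses (hphi : lip_deriv p L phi) (cphi : grad_convex phi).
Hypotheses (dgam : forall x, differentiable gam x) (cgam : grad_convex gam).

Let F v := phi v + gam v.
Let model c := tensor_model p H phi gam c.

Hypothesis (mxs : is_argmin F xs).

Let L1 : L / p.+1`!%:R <= H / p`!%:R / 4.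
Proof.
have f0 : 0 < p`!%:R :> R by rewrite ltr0n fact_gt0.
rewrite factS natrM invfM mulrA -[leRHS]mulrAC.
apply: ler_wpM2r; first by rewrite invr_ge0 ltW.
have p2 : 2 <= p.+1%:R :> R by rewrite ler_nat.
rewrite ler_pdivrMr ?ltr0n// mulrAC ler_pdivlMr//.
have h : H * 2 <= H * p.+1%:R by rewrite ler_pM2l.
apply: le_trans h; rewrite (_ : L * 4 = 2 * L * 2); last by ring.
by rewrite ler_pM2r.
Qed.

Lemma model_ge c y : F y <= model c y.
Proof.
have := taylor_remainder c y hphi; rewrite ler_norml => /andP[_ h].
have n0 : 0 <= enorm (y - c) ^+ p.+1 by rewrite exprn_ge0 ?enorm_ge0.
have h1 := ler_wpM2r n0 L1.
have H1 : 0 <= H / p`!%:R by rewrite divr_ge0// ltW.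
have h2 := mulr_ge0 H1 n0.
rewrite /F /model /tensor_model lerD2r -lerBlDl; apply: (le_trans h).
by rewrite mulrAC; apply: (le_trans h1); rewrite mulrAC; lra.
Qed.

Lemma model_le c y : model c y <= F y + H / p`!%:R * (5 / 4) * enorm (y - c) ^+ p.+1.
Proof.
have := taylor_remainder c y hphi; rewrite ler_norml => /andP[h _].
have n0 : 0 <= enorm (y - c) ^+ p.+1 by rewrite exprn_ge0 ?enorm_ge0.
have h1 := ler_wpM2r n0 L1.
rewrite mulrAC in h.
rewrite /F /model /tensor_model; move: h h1.
set a := L / _ * _; set b := enorm _ ^+ _; set t := taylor _ _ _ _; set k := H / _.
by move: (phi y) (gam y) a b t k => f g a b t k h h1; lra.
Qed.

(** The model lies above F, and at [xs] exceeds it by at most 5/4 of the regularizer. Uniform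
    convexity turns this into (|z-xs|/2)^(p+1) <= (5/4)|c-xs|^(p+1), and 5/4 <= (3/2)^(p+1) gives
    the constant 3. *)
Lemma model_argmin_dist c z : is_argmin (model c) z -> enorm (z - xs) <= 3 * enorm (c - xs).
Proof.
move=> mz.
have uc := tensor_model_uc p0 L0 LH H0 hphi cphi dgam cgam c.
have dm y := (tensor_model_diff H p0 hphi dgam c y).1.
have h1 := uc_argmin xs dm uc mz.
have h2 := le_trans h1 (model_le c xs).
have h3 := le_trans (mxs z) (model_ge c z).
have h4 : model_sigma p H / p.+1%:R * enorm (xs - z) ^+ p.+1 <= H / p`!%:R * (5 / 4) * enorm (xs - c) ^+ p.+1.
  by rewrite -(lerD2l (model c z)); exact: le_trans h2 (lerD h3 (lexx _)).
have f0 : 0 < p`!%:R :> R by rewrite ltr0n fact_gt0.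
have k0 : 0 < H / p`!%:R by rewrite divr_gt0.
have E : model_sigma p H / p.+1%:R = H / p`!%:R * (2 ^+ p.+1)^-1.
  rewrite /model_sigma; field.
  by rewrite nat1r expf_neq0 ?pnatr_eq0//= -lt0n fact_gt0.
rewrite E -[leLHS]mulrA -[leRHS]mulrA ler_pM2l// in h4.
have t0 : 0 < 2 ^+ p.+1 :> R by rewrite exprn_gt0.
rewrite ler_pdivrMl// in h4.
rewrite -(@ler_pXn2r _ p.+1)// ?nnegrE ?mulr_ge0 ?enorm_ge0// enormB (enormB c).
apply: (le_trans h4); rewrite exprMn !mulrA ler_wpM2r ?exprn_ge0 ?enorm_ge0//.
have -> : 3 = 2 * (3 / 2) :> R by field.
rewrite exprMn -mulrA ler_pM2l//.
have h : (3 / 2) ^+ 2 <= (3 / 2) ^+ p.+1 :> R.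
  by apply: ler_weXn2l => //; lra.
by apply: le_trans h; rewrite expr2; lra.
Qed.

(** To first order the model and F agree at the center. Thus a tensor step from a point that does
    not minimize F has positive length. *)
Lemma argmin_center c : is_argmin (model c) c -> is_argmin F c.
Proof.
move=> mc; apply: argmin_of_derive.
  move=> u v; rewrite [X in _ + X <= _](_ : _ = 'D_(v - u) phi u + 'D_(v - u) gam u).
    by rewrite /F addrACA; apply: lerD; [exact: cphi|exact: cgam].
  rewrite -[LHS]/('D_(v - u) (phi + gam) u) deriveD//; apply: diff_derivable => //.
  exact: (ndifferentiable1 p0 hphi.1).
move=> v; have dphi := ndifferentiable1 p0 hphi.1 c.
rewrite -[LHS]/('D_v (phi + gam) c) deriveD; [|exact: diff_derivable|exact: diff_derivable].
have h1 := @Dn_tensor_model_center _ _ p L H phi gam hphi c [::v].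
have [dm D] := tensor_model_diff H p0 hphi dgam c c.
have := derive_argmin v dm mc; rewrite D subrr edot0l !mulr0 addr0 => <-; congr (_ + _).
rewrite (taylor_diff c c hphi.1).2.
by case: p p0 => // q _; rewrite taylor_center.
Qed.

(* Intermediate value theorem in lam: the quantity is small for small lam since the
   minimizers of the models stay bounded, and large for large lam since the midpoint
   then tends to x, which is not a fixed point of the tensor step. *)
Lemma catd_lambda_exists A x y (w0 : R) : 0 <= A -> ~ is_argmin F x -> 0 < w0 ->
  exists lam z, [/\ 0 < lam, is_argmin (model (catd_mid lam A x y)) z &
    lam * (H * enorm (z - catd_mid lam A x y) ^+ p.-1 / (p.-1)`!%:R) = w0].
Proof.
move=> A0 nx w00.
have /choice [Z hZ] : forall c, exists z, is_argmin (model c) z.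
  exact: model_argmin_exists p0 L0 LH H0 hphi cphi dgam cgam.
pose th c := H * enorm (Z c - c) ^+ p.-1 / (p.-1)`!%:R.
have f0 : 0 < (p.-1)`!%:R :> R by rewrite ltr0n fact_gt0.
have cr : continuous (fun c => enorm (Z c - c)).
  move=> c; apply/(@cvgrPdist_le _ _ _ (nbhs c)) => /= e e0.
  have e2 : 0 < e / 2 by rewrite divr_gt0.
  have := model_argmin_continuous p0 L0 LH H0 hphi cphi dgam cgam (hZ c) e2.
  move=> /enorm_nbhs [r r0 hr]; apply/enorm_nbhs; exists (Num.min r (e / 2)).
    by rewrite lt_min r0.
  move=> c'; rewrite lt_min => /andP[c1 c2]; apply: (le_trans (enorm_dist _ _)).
  have -> : Z c - c - (Z c' - c') = (c' - c) - (Z c' - Z c).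
    by rewrite !opprB addrACA [RHS]addrACA; congr (_ + _); rewrite addrC.
  apply: (le_trans (enormD _ _)); rewrite enormN (splitr e); apply: lerD; first exact: ltW.
  exact: hr c1 _ (hZ c').
have cth : continuous th.
  move=> c; have ck (a : R) : {for c, continuous (fun _ : V => a)} by exact: cst_continuous.
  apply: (for_continuousM (for_continuousM (ck H) _) (ck _)).
  apply: (@continuous_comp _ _ _ (fun c => enorm (Z c - c)) (fun t => t ^+ p.-1)).
    exact: cr.
  exact: exprn_continuous.
have r0 : 0 < enorm (Z x - x).
  apply: enorm_gt0; apply/negP => /eqP /subr0_eq E; apply: nx; apply: argmin_center.
  by have := hZ x; rewrite E.
have [r rr hr] : exists2 r, 0 < r & forall c, enorm (c - x) < r ->
    enorm (Z x - x) / 2 <= enorm (Z c - c).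
  have /(@cvgrPdist_le _ _ _ (nbhs x)) /(_ (enorm (Z x - x) / 2)) := cr x.
  rewrite divr_gt0// => /(_ isT) /enorm_nbhs [r rr hr]; exists r => // c /hr.
  by rewrite ler_norml => /andP[_]; lra.
set D := enorm (x - xs) + enorm (y - xs).
have D0 : 0 <= D by rewrite addr_ge0 ?enorm_ge0.
have hmid lam : 0 < lam -> enorm (catd_mid lam A x y - xs) <= D.
  by move=> l0; apply: catd_mid_dist => //; rewrite /D ?lerDl ?lerDr enorm_ge0.
have th_le lam : 0 < lam -> th (catd_mid lam A x y) <= H * (4 * D) ^+ p.-1 / (p.-1)`!%:R.
  move=> l0; rewrite /th ler_pM2r ?invr_gt0// ler_pM2l// lerXn2r ?nnegrE ?mulr_ge0 ?enorm_ge0//.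
  set c := catd_mid _ _ _ _; have h1 := model_argmin_dist (hZ c).
  apply: (le_trans (enorm_tri xs _ _)); rewrite (enormB xs).
  have := hmid _ l0; rewrite -/c; lra.
pose K1 := H * (4 * D) ^+ p.-1 / (p.-1)`!%:R.
have K10 : 0 <= K1 by rewrite /K1 !mulr_ge0 ?invr_ge0 ?exprn_ge0 ?mulr_ge0// ltW.
pose l1 := w0 / (K1 + 1).
have l10 : 0 < l1 by rewrite divr_gt0// ltr_wpDl.
pose K2 := H * (enorm (Z x - x) / 2) ^+ p.-1 / (p.-1)`!%:R.
have K20 : 0 < K2 by rewrite /K2 !mulr_gt0 ?invr_gt0 ?exprn_gt0 ?divr_gt0.
pose l2 := Num.max l1 (Num.max (w0 / K2) (A * enorm (y - x) / r + 1)).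
(* The last entry of [l2] brings the midpoint within [r] of [x], where the step length is at least
   half of that at [x]; the entry w0/K2 then makes the product reach [w0]. *)
have l12 : l1 <= l2 by rewrite le_max lexx.
have l20 : 0 < l2 by apply: lt_le_trans l12.
pose f lam := lam * th (catd_mid lam A x y).
have f1 : f l1 <= w0.
  apply: (@le_trans _ _ (l1 * K1)); first by rewrite ler_pM2l// th_le.
  by rewrite /l1 mulrAC ler_pdivrMr ?ltr_wpDl// ler_pM2l// lerDl.
have f2 : w0 <= f l2.
  apply: (@le_trans _ _ (l2 * K2)).
    by rewrite -ler_pdivrMr// /l2 !le_max lexx /= orbT.
  rewrite /f ler_pM2l// /K2 /th ler_pM2r ?invr_gt0// ler_pM2l//.
  apply: lerXn2r; rewrite ?nnegrE ?divr_ge0 ?enorm_ge0//; apply: hr.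
  apply: (le_lt_trans (catd_mid_far _ _ l20 A0)); rewrite mulrAC ltr_pdivrMr//.
  rewrite [r * _]mulrC -ltr_pdivrMr//; apply: (@lt_le_trans _ _ (A * enorm (y - x) / r + 1)).
    by rewrite ltrDl.
  by rewrite /l2 !le_max lexx !orbT.
have cf : {within `[l1, l2], continuous f}.
  apply: continuous_subspace_itv => lam; rewrite in_itv /= => /andP[la _].
  have l0 := lt_le_trans l10 la.
  have cm : {for lam, continuous (fun l => th (catd_mid l A x y))}.
    apply: (@continuous_comp _ _ _ (fun l => catd_mid l A x y) th).
      exact: catd_mid_continuous.
    exact: cth.
  have ci : {for lam, continuous (fun l : R => l)} by exact: cvg_id.
  exact: (for_continuousM ci cm).
have [|lam] := IVT (v := w0) l12 cf.
  by rewrite ge_min f1 le_max f2 orbT.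
rewrite in_itv /= => /andP[la _] hf; exists lam, (Z (catd_mid lam A x y)).
by split; [exact: lt_le_trans la|exact: hZ|].
Qed.

End LambdaSearch.

(** * Monteiro-Svaiter steps *)

Section Growth.
Context {R : realType}.

(** The arithmetic-geometric mean inequality for [m] copies of [a] and [q] copies of [b]. *)
Lemma weighted_agm (m q : nat) (a b : R) : 0 <= a -> 0 <= b ->
  (m + q)%:R ^+ (m + q) * (a ^+ m * b ^+ q) <= (m%:R * a + q%:R * b) ^+ (m + q).
Proof.
move=> a0 b0; pose E (i : 'I_(m + q)) := if (i < m)%N then a else b.
have E0 i : 0 <= E i by rewrite /E; case: ifP.
have [|h _] := @leif_AGM_scaled R 'I_(m + q) predT E.
  by move=> i _; rewrite mulrn_wge0.
move: h; rewrite card_ord !big_split_ord /=.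
have E1 (i : 'I_m) : E (lshift q i) = a by rewrite /E /= ltn_ord.
have E2 (i : 'I_q) : E (rshift m i) = b by rewrite /E /= ltnNge leq_addr.
under eq_bigr do rewrite E1; under [X in _ * X]eq_bigr do rewrite E2.
under [X in X + _]eq_bigr do rewrite E1; under [X in _ + X]eq_bigr do rewrite E2.
rewrite !prodr_const !sumr_const !card_ord -[a *+ _]mulr_natl -[b *+ (m + q)]mulr_natl.
rewrite -[a *+ m]mulr_natl -[b *+ q]mulr_natl => h; apply: le_trans h.
by rewrite !exprMn mulrACA -exprD.
Qed.

Lemma root_exists (n : nat) (a : R) : (0 < n)%N -> 0 <= a -> exists2 t : R, 0 <= t & t ^+ n = a.
Proof.
move=> n0 a0; exists (a `^ n%:R^-1); first exact: powR_ge0.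
by rewrite -powR_mulrn ?powR_ge0// -powRrM mulVf ?powRr1// pnatr_eq0 -lt0n.
Qed.

(* Hoelder's inequality: N K^(1/(m+q)) <= U^(m/(m+q)) S^(q/(m+q)), by AM-GM on each
   normalized term. *)
Lemma hoelder_growth (m q : nat) (K U S : R) (s : seq (R * R)) : (0 < m)%N -> 0 <= K ->
  (forall t, t \in s -> [/\ 0 <= t.1, 0 <= t.2 & K <= t.1 ^+ m * t.2 ^+ q]) ->
  0 < U -> 0 < S -> \sum_(t <- s) t.1 <= U -> \sum_(t <- s) t.2 <= S ->
  (size s)%:R ^+ (m + q) * K <= U ^+ m * S ^+ q.
Proof.
move=> m0 K0 hs U0 S0 hU hS; set n := (m + q)%N.
have n0 : (0 < n)%N by rewrite addn_gt0 m0.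
have nR : 0 < n%:R :> R by rewrite ltr0n.
have US : 0 < U ^+ m * S ^+ q by rewrite mulr_gt0// exprn_gt0.
have [r r0 hr] := root_exists n0 (divr_ge0 K0 (ltW US)).
have h1 t : t \in s -> r <= (m%:R * (t.1 / U) + q%:R * (t.2 / S)) / n%:R.
  move=> /hs [t1 t2 ht]; rewrite ler_pdivlMr//.
  have u0 : 0 <= t.1 / U by rewrite divr_ge0// ltW.
  have v0 : 0 <= t.2 / S by rewrite divr_ge0// ltW.
  have w0 : 0 <= m%:R * (t.1 / U) + q%:R * (t.2 / S) by rewrite addr_ge0// mulr_ge0.
  rewrite -(@ler_pXn2r _ n)// ?nnegrE ?mulr_ge0//.
  apply: le_trans (weighted_agm m q u0 v0); rewrite exprMn mulrC ler_pM2l ?exprn_gt0//.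
  rewrite hr !expr_div_n mulrACA -invfM ler_pM2r ?invr_gt0//.
have h2 : (size s)%:R * r <= 1.
  have -> : (size s)%:R * r = \sum_(t <- s) r by rewrite big_const_seq count_predT iter_addr_0 mulr_natl.
  apply: (@le_trans _ _ (\sum_(t <- s) (m%:R * (t.1 / U) + q%:R * (t.2 / S)) / n%:R)).
    by rewrite big_seq [leRHS]big_seq; apply: ler_sum => t; exact: h1.
  rewrite -mulr_suml ler_pdivrMr// mul1r big_split /= -!mulr_sumr -!mulr_suml /n natrD.
  have b1 : (\sum_(t <- s) t.1) / U <= 1 by rewrite ler_pdivrMr// mul1r.
  have b2 : (\sum_(t <- s) t.2) / S <= 1 by rewrite ler_pdivrMr// mul1r.
  by apply: lerD; rewrite -[leRHS]mulr1 ler_wpM2l.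
have h3 : ((size s)%:R * r) ^+ n <= 1 by rewrite exprn_ile1// mulr_ge0.
by move: h3; rewrite exprMn hr mulrA ler_pdivrMr// mul1r.
Qed.

Lemma subr_expn_le (n : nat) (u v : R) : 0 <= u -> u <= v ->
  v ^+ n.+1 - u ^+ n.+1 <= n.+1%:R * v ^+ n * (v - u).
Proof.
move=> u0 uv; have v0 := le_trans u0 uv; have vu : 0 <= v - u by rewrite subr_ge0.
elim: n => [|n IH]; first by rewrite !expr1 expr0 !mul1r.
have -> : v ^+ n.+2 - u ^+ n.+2 = v * (v ^+ n.+1 - u ^+ n.+1) + u ^+ n.+1 * (v - u).
  by rewrite [v ^+ n.+2]exprS [u ^+ n.+2]exprS; ring.
have -> : n.+2%:R * v ^+ n.+1 * (v - u) = v * (n.+1%:R * v ^+ n * (v - u)) + v ^+ n.+1 * (v - u).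
  by rewrite -[n.+2]addn1 natrD exprS; ring.
by apply: lerD; [apply: ler_wpM2l|apply: ler_wpM2r => //; apply: lerXn2r].
Qed.

(** Combine a^2 = lam A' with a <= (p+1) U'^p (U'-U). The exponents are those for which (lam
    A')^(p+1) (A' r^2/lam)^(p-1) = (lam r^(p-1))^2 A'^(2p), so that A' cancels and only the lower
    bound [kap] for lam r^(p-1) remains. *)
Lemma catd_growth (p : nat) (lam A r kap U U' : R) : (0 < p)%N -> 0 < lam -> 0 <= A -> 0 <= r ->
  0 < kap -> kap <= lam * r ^+ p.-1 -> 0 <= U -> U <= U' -> U ^+ p.+1 = A ->
  U' ^+ p.+1 = A + catd_a lam A ->
  kap ^+ 2 / p.+1%:R ^+ (2 * p + 2) <=
    (U' - U) ^+ (2 * p + 2) * ((A + catd_a lam A) / lam * r ^+ 2) ^+ p.-1.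
Proof.
move=> p0 l0 A0 r0 k0 hk U0 UU eU eU'; have a0 := catd_a_gt0 l0 A0; have as2 := catd_a_sqr l0 A0.
set a := catd_a lam A in eU' a0 as2 *; set A' := A + a in eU' as2 *.
have A'0 : 0 < A' by rewrite ltr_wpDl.
have U'0 := le_trans U0 UU; have dU : 0 <= U' - U by rewrite subr_ge0.
have P0 : 0 < p.+1%:R ^+ (2 * p + 2) :> R by rewrite exprn_gt0.
have h1 : a <= p.+1%:R * U' ^+ p * (U' - U).
  by have := subr_expn_le p U0 UU; rewrite eU eU' /A' addrAC subrr add0r.
have h2 : (lam * A') ^+ p.+1 <= (p.+1%:R * U' ^+ p * (U' - U)) ^+ (2 * p + 2).
  rewrite (_ : (2 * p + 2 = 2 * p.+1)%N); last by rewrite mulnS addnC.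
  rewrite -as2 -exprM lerXn2r ?nnegrE ?(ltW a0)// !mulr_ge0// exprn_ge0//.
have e2 : (p.+1%:R * U' ^+ p * (U' - U)) ^+ (2 * p + 2)
    = p.+1%:R ^+ (2 * p + 2) * (U' - U) ^+ (2 * p + 2) * A' ^+ (2 * p).
  rewrite !exprMn [_ ^+ p ^+ _](_ : _ = A' ^+ (2 * p)) 1?mulrAC//.
  rewrite -eU' -!exprM (_ : (p * (2 * p + 2) = p.+1 * (2 * p))%N)//.
  by rewrite mulnDr mulSn addnC [(p * 2)%N]mulnC.
rewrite e2 in h2.
rewrite ler_pdivrMr// -(ler_pM2r (exprn_gt0 (2 * p) A'0)).
set X := (U' - U) ^+ _ in h2 *; set Q := p.+1%:R ^+ _ in h2 P0 *.
have b0 : 0 <= (A' / lam * r ^+ 2) ^+ p.-1.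
  by rewrite exprn_ge0// mulr_ge0 ?sqr_ge0// divr_ge0// ltW.
have h3 := ler_wpM2r b0 h2.
have -> : X * (A' / lam * r ^+ 2) ^+ p.-1 * Q * A' ^+ (2 * p) = Q * X * A' ^+ (2 * p) * (A' / lam * r ^+ 2) ^+ p.-1 by ring.
apply: le_trans h3.
have -> : (lam * A') ^+ p.+1 * (A' / lam * r ^+ 2) ^+ p.-1 = (lam * r ^+ p.-1) ^+ 2 * A' ^+ (2 * p).
  case: p p0 {X Q P0 hk eU eU' h1 h2 e2 b0} => // k _ /=.
  rewrite -addn2 exprD mulrAC -exprMn.
  have -> : lam * A' * (A' / lam * r ^+ 2) = A' ^+ 2 * r ^+ 2 by field; rewrite gt_eqF.
  rewrite mulnS exprD exprM !exprMn -!exprM [(k * 2)%N]mulnC.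
  rewrite ?(_ : forall x : R, x ^+ (2 * k) = x ^+ k * x ^+ k); last by move=> x; rewrite mul2n -addnn exprD.
  ring.
rewrite ler_pM2r ?exprn_gt0//; apply: lerXn2r; rewrite ?nnegrE ?(ltW k0)//.
exact: le_trans (ltW k0) hk.
Qed.

End Growth.

Lemma growth_exponent (p : nat) : (0 < p)%N -> (2 * p + 2 + p.-1 = 3 * p + 1)%N.
Proof. by case: p => // q _ /=; lia. Qed.

(** * Decrease of the potential and its consequences *)

Section MonteiroSvaiter.
Context {R : realType} {d : nat}.
Local Notation V := 'rV[R]_d.
Implicit Types (c x y z u v w h : V) (F : V -> R) (lam A : R).

(** Here P = p, X = |lam v + y' - c|, r = |y' - c|, lv = lam |v|, and w is the value in the window.
    Eliminating lv leaves a coefficient of r that decreases in w, so w = 1/2 is the worst case; it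
    gives X (4P(P+1) - 1) <= (2P^2 + P) r. *)
Lemma ms_error_arith (P w X r lv : R) : 1 <= P -> 1 / 2 <= w -> 0 <= r ->
  X <= (4 * P * (P + 1))^-1 * lv + (1 - w * (P + 1) / P) * r + w / (2 * P) * r ->
  lv <= X + r -> X <= 4 / 7 * r.
Proof.
move=> P1 hw r0 hX hlv; have P0 : 0 < P by lra.
have D0 : 0 < 4 * P * (P + 1) by rewrite !mulr_gt0//; lra.
have h1 : X * (4 * P * (P + 1)) <=
    lv + (4 * P * (P + 1) - 2 * w * (2 * P + 1) * (P + 1)) * r.
  have := ler_wpM2r (ltW D0) hX.
  have -> : ((4 * P * (P + 1))^-1 * lv + (1 - w * (P + 1) / P) * r + w / (2 * P) * r) * (4 * P * (P + 1))
    = lv + (4 * P * (P + 1) - 2 * w * (2 * P + 1) * (P + 1)) * r.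
    by field; rewrite !gt_eqF//; lra.
  by [].
have h2 : (2 * P + 1) * (P + 1) * r <= 2 * w * (2 * P + 1) * (P + 1) * r.
  apply: ler_wpM2r => //; rewrite -!mulrA mulrA; apply: ler_peMl; last by lra.
  by rewrite mulr_ge0//; lra.
have h3 : X * (4 * P * (P + 1) - 1) <= (2 * P ^+ 2 + P) * r by nra.
have D1 : 0 < 4 * P * (P + 1) - 1 by nra.
rewrite -(ler_pM2r D1); apply: (le_trans h3).
have h4 : 2 * P ^+ 2 + P <= 4 / 7 * (4 * P * (P + 1) - 1) by nra.
by have := ler_wpM2r r0 h4; nra.
Qed.

(* The potential A (F y - F xs) + |x - xs|^2 / 2 decreases because a^2 = lam A' turns
   the terms in v into A' / (2 lam) (|lam v + y' - c|^2 - |y' - c|^2), and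
   33/98 = (1 - (4/7)^2) / 2. *)
Lemma ms_step F xs x y y' v lam A : 0 < lam -> 0 <= A ->
  let a := catd_a lam A in let c := catd_mid lam A x y in
  (forall u, F y' + edot v (u - y') <= F u) ->
  enorm (lam *: v + (y' - c)) <= 4 / 7 * enorm (y' - c) ->
  (A + a) * (F y' - F xs) + enorm (x - a *: v - xs) ^+ 2 / 2
    + 33 / 98 * ((A + a) / lam * enorm (y' - c) ^+ 2)
  <= A * (F y - F xs) + enorm (x - xs) ^+ 2 / 2.
Proof.
move=> l0 A0 a c cv he; have a0 := catd_a_gt0 l0 A0; have as2 := catd_a_sqr l0 A0.
have ec := catd_mid_eq x y l0 A0; rewrite -/a -/c in a0 as2 ec *.
set A' := A + a in as2 ec *; have A'0 : 0 < A' by rewrite ltr_wpDl.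
set e := y' - c in he *; set vx := edot v (x - xs); set ve := edot v e.
have h1 : A * (F y' + edot v (y - y')) <= A * F y by rewrite ler_wpM2l.
have h2 : a * (F y' + edot v (xs - y')) <= a * F xs by rewrite ler_wpM2l ?cv// ltW.
have E1 : A * edot v (y - y') + a * edot v (xs - y') = - (A' * ve) - a * vx.
  rewrite -!edotZr -edotNr -edotNr -!edotDr; congr (edot v _).
  rewrite /e [A' *: _]scalerBr ec /A'; apply/rowP => i; rewrite !mxE; ring.
have E2 : enorm (x - a *: v - xs) ^+ 2 = enorm (x - xs) ^+ 2 - 2 * a * vx + a ^+ 2 * enorm v ^+ 2.
  rewrite (_ : x - a *: v - xs = (x - xs) - a *: v); last by rewrite addrAC.
  rewrite !enorm_sqr !edotE /vx !edotE (edotC v x) (edotC v xs) (edotC xs x); ring.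
have E3 : enorm (lam *: v + e) ^+ 2 = lam ^+ 2 * enorm v ^+ 2 + 2 * lam * ve + enorm e ^+ 2.
  by rewrite /ve; clear; rewrite !enorm_sqr; move: e => u; rewrite !edotE (edotC u v); ring.
have h3 : enorm (lam *: v + e) ^+ 2 <= 16 / 49 * enorm e ^+ 2.
  have -> : 16 / 49 * enorm e ^+ 2 = (4 / 7 * enorm e) ^+ 2 by rewrite exprMn; field.
  by apply: lerXn2r he; rewrite nnegrE ?mulr_ge0 ?enorm_ge0.
rewrite E2 as2; move: h3; rewrite E3 {E3 E2 he}; move: h1 h2 E1.
set q := enorm v ^+ 2; set n := enorm e ^+ 2; set D := enorm (x - xs) ^+ 2.
move: (edot v (y - y')) (edot v (xs - y')) vx ve q n D (F y) (F y') (F xs) => b1 b2 vx ve q n D f f' fs h1 h2 E1 h3.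
have {}h3 : A' / (2 * lam) * (lam ^+ 2 * q + 2 * lam * ve + n) <= A' / (2 * lam) * (16 / 49 * n).
  by rewrite ler_wpM2l// divr_ge0 ?mulr_ge0// ltW.
have E4 : A' / (2 * lam) * (lam ^+ 2 * q + 2 * lam * ve + n) = lam * A' * q / 2 + A' * ve + A' / lam * n / 2.
  by field; rewrite gt_eqF.
have E5 : A' / (2 * lam) * (16 / 49 * n) = 8 / 49 * (A' / lam * n) by field; rewrite gt_eqF.
rewrite E4 E5 in h3.
have E6 : A' * f' = A * f' + a * f' by rewrite /A' mulrDl.
have E7 : A' * fs = A * fs + a * fs by rewrite /A' mulrDl.
move: h1 h2 E1 h3 E6 E7; rewrite !mulrDr !mulrN.
move: (A' / lam * n) => k; move: (A' * f') (A' * fs) (A * f') (a * f') (A * fs) (a * fs) (A * f) (A * b1) (a * b2) (A' * ve) => t1 t2 t3 t4 t5 t6 t7 t8 t9 t10.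
rewrite -[2 * a * vx]mulrA.
move: (a * vx) (lam * A' * q) => t11 t12 *; lra.
Qed.

(* The state after k steps of relative error 4/7 from a start at distance R0 of xs.
   The list holds, for each step, the increment of A^(1/(p+1)) and
   A' |y' - c|^2 / lam. *)
Definition ms_inv (p : nat) (kap : R) F xs (R0 : R) (k : nat) A x y :=
  [/\ 0 <= A, enorm (y - xs) <= 9 / 4 * R0 & exists s : seq (R * R),
    [/\ size s = k,
        forall t, t \in s -> [/\ 0 <= t.1, 0 <= t.2 &
          kap ^+ 2 / p.+1%:R ^+ (2 * p + 2) <= t.1 ^+ (2 * p + 2) * t.2 ^+ p.-1],
        (\sum_(t <- s) t.1) ^+ p.+1 = A
      & A * (F y - F xs) + enorm (x - xs) ^+ 2 / 2 + 33 / 98 * \sum_(t <- s) t.2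
          <= R0 ^+ 2 / 2]].

Context (p : nat) (kap : R) (F : V -> R) (xs : V) (R0 : R).
Hypotheses (p0 : (0 < p)%N) (kap0 : 0 < kap) (mxs : is_argmin F xs) (R00 : 0 <= R0).

Lemma ms_inv0 x : enorm (x - xs) <= R0 -> ms_inv p kap F xs R0 0 0 x x.
Proof.
move=> hx; split=> //; first by apply: (le_trans hx); have := R00; lra.
exists [::]; split=> //; first by rewrite big_nil expr0n.
rewrite big_nil mul0r mulr0 add0r addr0 ler_pM2r ?invr_gt0//.
by rewrite lerXn2r ?nnegrE ?enorm_ge0.
Qed.

Lemma ms_inv_x k A x y : ms_inv p kap F xs R0 k A x y -> enorm (x - xs) <= R0.
Proof.
move=> [A0 _ [s [_ hs _ h]]].
have S0 : 0 <= \sum_(t <- s) t.2 by rewrite big_seq sumr_ge0// => t /hs [].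
have F0 : 0 <= A * (F y - F xs) by rewrite mulr_ge0// subr_ge0.
rewrite -(@ler_pXn2r _ 2)// ?nnegrE ?enorm_ge0//.
by move: h S0 F0; move: (A * _) (\sum_(t <- s) t.2) (_ ^+ 2) (R0 ^+ 2) => a b c e; lra.
Qed.

Lemma ms_inv_step k A x y y' v lam : ms_inv p kap F xs R0 k A x y -> 0 < lam ->
  let a := catd_a lam A in let c := catd_mid lam A x y in
  (forall u, F y' + edot v (u - y') <= F u) ->
  enorm (lam *: v + (y' - c)) <= 4 / 7 * enorm (y' - c) ->
  kap <= lam * enorm (y' - c) ^+ p.-1 ->
  ms_inv p kap F xs R0 k.+1 (A + a) (x - a *: v) y'.
Proof.
move=> hinv l0 a c cv he hk; have hx := ms_inv_x hinv.
have [A0 hy [s [ss hs sA hp]]] := hinv.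
have a0 := catd_a_gt0 l0 A0; have as2 := catd_a_sqr l0 A0; rewrite -/a in a0 as2.
have A'0 : 0 < A + a by rewrite ltr_wpDl.
have U0 : 0 <= \sum_(t <- s) t.1 by rewrite big_seq sumr_ge0// => t /hs [].
have S0 : 0 <= \sum_(t <- s) t.2 by rewrite big_seq sumr_ge0// => t /hs [].
have [U' U'0 hU'] := root_exists (ltn0Sn p) (ltW A'0).
have UU : \sum_(t <- s) t.1 <= U'.
  by rewrite -(@ler_pXn2r _ p.+1)// ?nnegrE// sA hU' lerDl ltW.
have := catd_growth p0 l0 A0 (enorm_ge0 (y' - c)) kap0 hk U0 UU sA hU'.
have := ms_step xs l0 A0 cv he; rewrite -/a -/c.
set b := (A + a) / lam * _; move=> hstep hgrow.
have b0 : 0 <= b by rewrite /b mulr_ge0 ?sqr_ge0// divr_ge0// ltW.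
have F0 : 0 <= (A + a) * (F y' - F xs) by rewrite mulr_ge0 ?subr_ge0// ltW.
have x0 := exprn_ge0 2 (enorm_ge0 (x - a *: v - xs)).
have htot : (A + a) * (F y' - F xs) + enorm (x - a *: v - xs) ^+ 2 / 2
    + 33 / 98 * (b + \sum_(t <- s) t.2) <= R0 ^+ 2 / 2.
  move: hp hstep; move: (_ * (F y' - _)) (A * _) (enorm (x - xs) ^+ 2) (enorm (x - _ - _) ^+ 2) (\sum_(t <- s) t.2) (R0 ^+ 2) => *; lra.
(* The potential gives b <= (98/33)(R0^2/2) = (49/33) R0^2, and 49/33 <= 25/16. *)
have bR : b <= (5 / 4 * R0) ^+ 2.
  have R2 := exprn_ge0 2 R00.
  by rewrite exprMn; move: htot F0 x0 S0 R2; move: (_ * (F y' - _)) (enorm _ ^+ 2) (\sum_(t <- s) t.2) (R0 ^+ 2) => *; lra.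
have hr : (A + a) * enorm (y' - c) <= a * (5 / 4 * R0).
  have n1 : 0 <= (A + a) * enorm (y' - c) by apply: mulr_ge0; [exact: ltW|exact: enorm_ge0].
  have n2 : 0 <= a * (5 / 4 * R0) by apply: mulr_ge0; [exact: ltW|rewrite mulr_ge0].
  rewrite -(@ler_pXn2r _ 2)//.
  rewrite [leRHS]exprMn; apply: le_trans (ler_wpM2l (sqr_ge0 a) bR).
  rewrite as2 /b le_eqVlt; apply/orP; left; apply/eqP; field.
  by rewrite gt_eqF.
split; [exact: ltW| |exists ((U' - \sum_(t <- s) t.1, b) :: s); split].
- rewrite -(ler_pM2l A'0).
  (* The weight [A] carries the old bound 9/4 R0 and the weight [a] carries R0 + 5/4 R0; since 1 +
     5/4 = 9/4 the bound reproduces itself. *)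
  have E : (A + a) *: (y' - xs) = A *: (y - xs) + a *: (x - xs) + (A + a) *: (y' - c).
    have ec := catd_mid_eq x y l0 A0; rewrite -/a -/c in ec.
    rewrite [(A + a) *: (y' - c)]scalerBr ec.
    by apply/rowP => i; rewrite !mxE; ring.
  rewrite -[X in X * enorm _ <= _](gtr0_norm A'0) -enormZ E.
  apply: (le_trans (enormD _ _)); rewrite [enorm (_ *: (y' - c))]enormZ (gtr0_norm A'0).
  have h1 : enorm (A *: (y - xs) + a *: (x - xs)) <= A * (9 / 4 * R0) + a * R0.
    apply: (le_trans (enormD _ _)); rewrite !enormZ (ger0_norm A0) (gtr0_norm a0).
    by apply: lerD; apply: ler_wpM2l => //; exact: ltW.
  by apply: (le_trans (lerD h1 hr)); rewrite le_eqVlt; apply/orP; left; apply/eqP; field.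
- by rewrite /= ss.
- move=> t; rewrite inE => /orP[/eqP ->|/hs//].
  by split; rewrite ?subr_ge0.
- by rewrite big_cons subrK.
- by rewrite big_cons.
Qed.

(** Hoelder with exponents 2p+2 and p-1. The first sum is A^(1/(p+1)), whence the power A^2; the
    second is bounded through the potential. *)
Lemma ms_inv_rate k A x y : ms_inv p kap F xs R0 k A x y -> 0 < R0 ->
  A * (F y - F xs) <= R0 ^+ 2 / 2 /\
  k%:R ^+ (3 * p + 1) * kap ^+ 2 <=
    p.+1%:R ^+ (2 * p + 2) * A ^+ 2 * (49 / 33 * R0 ^+ 2) ^+ p.-1.
Proof.
move=> [A0 hy [s [ss hs sA hp]]] R0p.
have U0 : 0 <= \sum_(t <- s) t.1 by rewrite big_seq sumr_ge0// => t /hs [].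
have S0 : 0 <= \sum_(t <- s) t.2 by rewrite big_seq sumr_ge0// => t /hs [].
have F0 : 0 <= A * (F y - F xs) by rewrite mulr_ge0// subr_ge0.
have x0 := exprn_ge0 2 (enorm_ge0 (x - xs)).
have R2 : 0 < R0 ^+ 2 by rewrite exprn_gt0.
split.
  by move: hp S0 F0 x0; move: (A * _) (_ ^+ 2) (\sum_(t <- s) t.2) (R0 ^+ 2) => *; lra.
have S1 : \sum_(t <- s) t.2 <= 49 / 33 * R0 ^+ 2.
  by move: hp S0 F0 x0; move: (A * _) (_ ^+ 2) (\sum_(t <- s) t.2) (R0 ^+ 2) => *; lra.
have P0 : 0 < p.+1%:R ^+ (2 * p + 2) :> R by rewrite exprn_gt0.
have K0 : 0 < kap ^+ 2 / p.+1%:R ^+ (2 * p + 2) by rewrite divr_gt0// exprn_gt0.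
have S2 : 0 <= (49 / 33 * R0 ^+ 2) ^+ p.-1 by rewrite exprn_ge0// mulr_ge0// ltW.
case: k => [|k] in ss *.
  rewrite expr0n addn1 /= mul0r; apply: mulr_ge0 => //.
  by rewrite mulr_ge0 ?sqr_ge0// ltW.
have U1 : 0 < \sum_(t <- s) t.1.
  rewrite lt_def U0 andbT; apply/eqP => E.
  case: s ss hs E {sA hp U0 S0 S1} => // t s ss hs E; have [t1 t2 t3] := hs t (mem_head _ _).
  have T0 : 0 <= \sum_(j <- s) j.1.
    by rewrite big_seq sumr_ge0// => j js; have [|] := hs j; first by rewrite inE js orbT.
  have E1 : t.1 = 0 by move: E; rewrite big_cons => E; lra.
  by move: (lt_le_trans K0 t3); rewrite E1 expr0n addn2 /= mul0r ltxx.
have S3 : 0 < 49 / 33 * R0 ^+ 2 by rewrite mulr_gt0.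
have m0 : (0 < 2 * p + 2)%N by rewrite addn2.
have := hoelder_growth m0 (ltW K0) hs U1 S3 (lexx _) S1.
rewrite ss (_ : (2 * p + 2 + p.-1 = 3 * p + 1)%N); last exact: growth_exponent.
rewrite mulrA ler_pdivrMr// => h; apply: (le_trans h).
have -> : (\sum_(t <- s) t.1) ^+ (2 * p + 2) = A ^+ 2.
  by rewrite -sA -exprM; congr (_ ^+ _); rewrite [RHS]mulSn [RHS]addnC [in RHS]mulnC.
by rewrite mulrC mulrA.
Qed.

End MonteiroSvaiter.

(** * CATD and restarts *)

Section CatdRun.
Context {R : realType} {d : nat}.
Local Notation V := 'rV[R]_d.
Implicit Types (c x y z u v w h : V) (lam A : R).

Lemma gradD (f g : V -> R) z : differentiable f z -> differentiable g z ->
  grad (fun v => f v + g v) z = grad f z + grad g z.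
Proof.
move=> df dg; apply/rowP => i; rewrite !mxE.
by rewrite -[LHS]/('D_(delta_mx 0 i) (f + g) z) deriveD//; exact: diff_derivable.
Qed.

Lemma enorm_le_of_edot w (b : R) : 0 <= b -> (forall h, edot w h <= b * enorm h) -> enorm w <= b.
Proof.
move=> b0 hw; have := hw w; rewrite -enorm_sqr expr2.
have [/eqP -> //|n0] := boolP (enorm w == 0).
by rewrite ler_pM2r// lt_def n0 enorm_ge0.
Qed.

Context (p : nat) (L H : R) (phi gam : V -> R).
Hypotheses (p0 : (0 < p)%N) (L0 : 0 <= L) (LH : 2 * L <= H) (H0 : 0 < H).
Hypotheses (hphi : lip_deriv p L phi) (cphi : grad_convex phi).
Hypotheses (dgam : forall x, differentiable gam x) (cgam : grad_convex gam).

Let F v := phi v + gam v.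
Let model c := tensor_model p H phi gam c.
Let dphi x : differentiable phi x := ndifferentiable1 p0 hphi.1 x.

(** What the left end 1/2 of the window says about lam |y'-c|^(p-1). *)
Definition growth_const (q : nat) (K : R) : R := (q.-1)`!%:R / (2 * K).

Lemma growth_const_gt0 : 0 < growth_const p H.
Proof. by rewrite divr_gt0 ?mulr_gt0 ?ltr0n ?fact_gt0. Qed.

Lemma window_growth lam c z : 0 < lam -> catd_window p H lam c z ->
  growth_const p H <= lam * enorm (z - c) ^+ p.-1.
Proof.
move=> l0 /andP[h _]; have f0 : 0 < (p.-1)`!%:R :> R by rewrite ltr0n fact_gt0.
rewrite /growth_const ler_pdivrMr ?mulr_gt0//.
move: h; rewrite !mulrA ler_pdivlMr// => h.
have -> : lam * enorm (z - c) ^+ p.-1 * 2 * H = 2 * (lam * H * enorm (z - c) ^+ p.-1) by ring.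
by rewrite -ler_pdivrMl// mulrC mulrC.
Qed.

Lemma sum_convex z u : F z + edot (grad phi z + grad gam z) (u - z) <= F u.
Proof.
rewrite edotDl !edot_grad// /F addrACA; apply: lerD; [exact: cphi|exact: cgam].
Qed.

(** The vector lam v + (z - c) is split into lam times the gradient of the model, lam times the
    Taylor error of grad [phi], and (1 - lam k)(z - c), where [k] is the coefficient of the
    regularizer. The right end of the window gives lam k <= 1. *)
Lemma ms_error lam c z : 0 < lam -> catd_window p H lam c z ->
  enorm (grad (model c) z) <= (4 * p * p.+1)%:R^-1 * enorm (grad phi z + grad gam z) ->
  enorm (lam *: (grad phi z + grad gam z) + (z - c)) <= 4 / 7 * enorm (z - c).
Proof.
move=> l0 /andP[w1 w2] hacc.
set v := grad phi z + grad gam z in hacc *; set e := grad (model c) z in hacc.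
set r := enorm (z - c) in w1 w2 *.
have r0 : 0 <= r by exact: enorm_ge0.
have f0 : 0 < p`!%:R :> R by rewrite ltr0n fact_gt0.
have f1 : 0 < (p.-1)`!%:R :> R by rewrite ltr0n fact_gt0.
have P0 : 0 < p%:R :> R by rewrite ltr0n.
pose k : R := H / p`!%:R * (p.+1%:R * r ^+ p.-1).
pose w := v - e + k *: (z - c).
have hw h : edot w h <= L * r ^+ p / p`!%:R * enorm h.
  have [dm D] := tensor_model_diff H p0 hphi dgam c z.
  have -> : edot w h = 'D_h phi z - 'D_h (taylor p phi c) z.
    rewrite /w /v /e !edotE !edot_grad// D -/r /k !edotE; ring.
  have hp1 : (p.-1 + size [:: h] = p)%N by rewrite addn1 prednK.
  have := taylor_remainder_Dn c z hphi hp1.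
  rewrite /= big_seq1 prednK// -/r => h1; apply: (le_trans (ler_norm _)).
  by apply: (le_trans h1); rewrite le_eqVlt; apply/orP; left; apply/eqP; ring.
have nw : enorm w <= L * r ^+ p / p`!%:R.
  apply: enorm_le_of_edot => //; rewrite mulr_ge0 ?invr_ge0//.
  by rewrite mulr_ge0// exprn_ge0.
pose wn := lam * (H * r ^+ p.-1 / (p.-1)`!%:R).
have fE : p`!%:R = p%:R * (p.-1)`!%:R :> R by rewrite -natrM -{1 2}(prednK p0) factS.
have lk : lam * k = wn * (p%:R + 1) / p%:R.
  by rewrite /k /wn fE -natr1; field; rewrite !gt_eqF.
have lw : lam * enorm w <= wn / (2 * p%:R) * r.
  apply: (@le_trans _ _ (lam * (L * r ^+ p / p`!%:R))); first by rewrite ler_pM2l.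
  have -> : wn / (2 * p%:R) * r = lam * (H / 2 * r ^+ p / p`!%:R).
    rewrite /wn fE (_ : r ^+ p = r * r ^+ p.-1); last by rewrite -exprS prednK.
    field.
    by rewrite !gt_eqF.
  rewrite ler_pM2l// ler_pM2r ?invr_gt0//; apply: ler_wpM2r; first exact: exprn_ge0.
  by rewrite ler_pdivlMr// mulrC.
have wP : wn * (p%:R + 1) / p%:R <= 1.
  by rewrite ler_pdivrMr// mul1r -ler_pdivlMr ?natr1// natr1.
have E : lam *: v + (z - c) = lam *: e + lam *: w + (1 - lam * k) *: (z - c).
  by rewrite /w; apply/rowP => i; rewrite !mxE; ring.
apply: (@ms_error_arith _ p%:R wn _ r (lam * enorm v)) => //.
- by rewrite ler1n.
- by rewrite div1r.
- rewrite {1}E; apply: (le_trans (enormD _ _)); rewrite addrAC; apply: lerD; last first.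
    by rewrite enormZ lk ger0_norm ?subr_ge0.
  apply: (le_trans (enormD _ _)); apply: lerD; last by rewrite enormZ gtr0_norm.
  rewrite enormZ gtr0_norm// mulrCA ler_pM2l//; apply: (le_trans hacc).
  by rewrite !natrM natr1.
- rewrite -[X in X * _](gtr0_norm l0) -enormZ.
  rewrite -[lam *: v](addrK (z - c)); apply: (le_trans (enormD _ _)).
  by rewrite addrA subrK enormN.
Qed.

Context (xs : V).
Hypothesis (mxs : is_argmin F xs).

Lemma catd_run_inv T z n A x y m (R0 : R) : catd_run p H T phi gam z n A x y m ->
  enorm (z - xs) <= R0 ->
  ms_inv p (growth_const p H) F xs R0 n A x y /\ (m <= n * T.+1)%N.
Proof.
move=> run hz; have R00 : 0 <= R0 by apply: le_trans hz; exact: enorm_ge0.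
elim: run => [|{}n {}A {}x {}y {}m lam y' t _ [IH1 IH2] l0 my win tT].
  by split=> //; exact: ms_inv0.
split; last by move/andP: tT => [_ tT]; rewrite mulSn; lia.
apply: (ms_inv_step p0 growth_const_gt0 mxs R00 IH1 l0).
- exact: sum_convex.
- apply: ms_error => //; rewrite (_ : grad _ _ = 0) ?enorm0 ?mulr_ge0 ?enorm_ge0//.
  apply/rowP => i; rewrite !mxE; apply: derive_argmin => //.
  exact: (tensor_model_diff H p0 hphi dgam _ _).1.
- exact: window_growth.
Qed.

Lemma catd_output_exists T z N : (0 < T)%N -> exists z' m, catd_output p H T phi gam z N z' m.
Proof.
move=> T0; suff : (exists A x y m, catd_run p H T phi gam z N A x y m) \/
   exists n A y z' m, [/\ (n < N)%N, catd_run p H T phi gam z n A z' y m & is_argmin F z'].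
  move=> [[A [x [y [m h]]]]|[n [A [y [z' [m h]]]]]].
    by exists y, m; left; exists A, x.
  by exists z', m; right; exists n, A, y.
elim: N => [|n IH]; first by left; exists 0, z, z, 0%N; exact: catd_start.
case: IH => [[A [x [y [m h]]]]|[n' [A [y [z' [m [nn h1 h2]]]]]]]; last first.
  by right; exists n', A, y, z', m; split=> //; exact: ltnW.
have [mx|nx] := pselect (is_argmin F x); first by right; exists n, A, y, x, m.
have [[A0 _ _] _] := catd_run_inv h (lexx _).
have w0 : 0 < p%:R / p.+1%:R :> R by rewrite divr_gt0 ?ltr0n.
have [lam [y' [l0 my hl]]] :=
  catd_lambda_exists p0 L0 LH H0 hphi cphi dgam cgam mxs y A0 nx w0.
left; do 4 eexists; apply: (catd_iter h l0 my (t := 1%N)); last by rewrite T0.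
rewrite /catd_window hl lexx andbT ler_pdivlMr ?ltr0n// ler_pdivrMl ?ltr0n//.
by rewrite -natrM ler_nat; lia.
Qed.

Lemma catd_output_cost T z N z' m : catd_output p H T phi gam z N z' m -> (m <= N * T.+1)%N.
Proof.
move=> [[A [x h]]|[n [A [y [nN h _]]]]]; have [_ h1] := catd_run_inv h (lexx _) => //.
by apply: (leq_trans h1); rewrite leq_mul2r ltnW.
Qed.

End CatdRun.

(** * The number of steps of one restart *)

Section RestartSteps.
Context {R : realType}.

Definition restart_ratio (p : nat) (H sigma : R) : R :=
  p.+1%:R * catd_const p * H * 2 ^+ p.+1 / sigma.

Lemma catd_const_gt0 (p : nat) : 0 < catd_const p :> R.
Proof.
by rewrite /catd_const divr_gt0 ?mulr_gt0 ?exprn_gt0 ?powR_gt0 ?ltr0n ?fact_gt0.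
Qed.

Lemma catd_const_sqr (p : nat) :
  (catd_const p : R) ^+ 2 = 2 ^+ (2 * p.-1) * p.+1%:R ^+ (3 * p + 1) / (p.-1)`!%:R ^+ 2.
Proof.
rewrite /catd_const !exprMn exprVn -exprM mulnC; congr (_ * _ / _).
rewrite -powR_mulrn ?powR_ge0// -powRrM divfK ?pnatr_eq0// powR_mulrn//.
Qed.

Lemma restart_ratio_gt0 p H sigma : 0 < H -> 0 < sigma -> 0 < restart_ratio p H sigma.
Proof.
move=> H0 s0; rewrite /restart_ratio divr_gt0// mulr_gt0 ?exprn_gt0// mulr_gt0//.
by rewrite mulr_gt0 ?catd_const_gt0.
Qed.

(** With s = p+1 the power of [r] has exponent 0 and equals 1, even for [r = 0]: all restarts have
    the same length. *)
Lemma restart_stepsE p (H sigma r : R) : restart_steps p p.+1 H sigma r =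
  maxn `|Num.ceil (restart_ratio p H sigma `^ (2 / (3 * p + 1)%:R))|%N 1.
Proof. by rewrite /restart_steps subrr powRr0 mulr1. Qed.

Lemma ceil_powR_le (Y : R) : 0 <= Y -> Y <= (maxn `|Num.ceil Y|%N 1)%:R <= Y + 1.
Proof.
move=> Y0; have c0 : 0 <= Num.ceil Y by rewrite ceil_ge0 (lt_le_trans _ Y0).
have E : (`|Num.ceil Y|%N)%:R = (Num.ceil Y)%:~R :> R by rewrite natr_absz ger0_norm.
apply/andP; split.
  apply: (@le_trans _ _ (`|Num.ceil Y|%N)%:R); last by rewrite ler_nat leq_maxl.
  by rewrite E; exact: Num.Theory.ceil_ge.
rewrite /maxn; case: ifP => _; first by rewrite lerDr.
by rewrite E ltW// -ltrBlDr; have := Num.Theory.gt_pred_ceil Y; rewrite intrB.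
Qed.

Lemma restart_steps_sqr p H sigma r : 0 < H -> 0 < sigma ->
  restart_ratio p H sigma ^+ 2 <= (restart_steps p p.+1 H sigma r)%:R ^+ (3 * p + 1).
Proof.
move=> H0 s0; rewrite restart_stepsE; have X0 := restart_ratio_gt0 p H0 s0.
set X := restart_ratio p H sigma in X0 *; set Y := X `^ _.
have Y0 : 0 <= Y by exact: powR_ge0.
have -> : X ^+ 2 = Y ^+ (3 * p + 1).
  by rewrite -(powR_mulrn _ Y0) -powRrM divfK ?pnatr_eq0 ?addn1// powR_mulrn// ltW.
by apply: lerXn2r; rewrite ?nnegrE//; have /andP[] := ceil_powR_le Y0.
Qed.

Lemma restart_steps_le p H sigma r : 
  (restart_steps p p.+1 H sigma r)%:R <= restart_ratio p H sigma `^ (2 / (3 * p + 1)%:R) + 1.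
Proof. by rewrite restart_stepsE; have /andP[] := ceil_powR_le (powR_ge0 (restart_ratio p H sigma) (2 / (3 * p + 1)%:R)). Qed.

(** After cancellation the right side keeps the surplus 4^(p-1) (p+1)^(p-1), which absorbs
    (49/33)^(p-1). *)
Lemma halving_const (p : nat) : (0 < p)%N ->
  4 * p.+1%:R ^+ (2 * p + 4) * (49 / 33) ^+ p.-1 * 2 ^+ (2 * p) <=
  p.+1%:R ^+ 2 * (2 ^+ (2 * p.-1) * p.+1%:R ^+ (3 * p + 1)) * 2 ^+ (2 * p.+1) :> R.
Proof.
case: p => // q _ /=.
have h : (49 / 33) ^+ q <= 4 ^+ q * q.+2%:R ^+ q :> R.
  rewrite -exprMn; apply: lerXn2r; rewrite ?nnegrE//.
  have : 1 <= q.+2%:R :> R by rewrite ler1n.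
  lra.
have -> : (3 * q.+1 + 1 = (2 * q.+1 + 2) + q)%N by lia.
have -> : (2 * q.+1 + 4 = (2 * q.+1 + 2) + 2)%N by lia.
have -> : (2 * q.+2 = 2 + 2 * q.+1)%N by lia.
rewrite !exprD expr0 mulr1.
set a := q.+2%:R ^+ (2 * q.+1); set b := 2 ^+ (2 * q.+1).
have c0 : 0 <= 4 * a * b * q.+2%:R ^+ 2 * q.+2%:R ^+ 2 by rewrite !mulr_ge0 ?exprn_ge0.
have := ler_wpM2l c0 h.
have -> : 4 ^+ q = 2 ^+ q * 2 ^+ q :> R by rewrite -exprMn; congr (_ ^+ _); ring.
have -> : 2 ^+ 2 = 4 :> R by ring.
set t := (49 / 33) ^+ q; set u := 2 ^+ q; set w := q.+2%:R ^+ q; set g := q.+2%:R ^+ 2.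
clearbody t u w g a b => h1.
have -> : 4 * (a * g * g) * t * b = 4 * a * b * g * g * t by ring.
apply: (le_trans h1); rewrite le_eqVlt; apply/orP; left; apply/eqP; ring.
Qed.

(* The comparison of the two sides of the halving estimate for D = sigma / (p+1)
   (R0 / 2)^(p+1): Q = p+1, C = catd_const p, t = 2^(p+1), f = (p-1)!, r = R0^(p+1). *)
Lemma halving_identity (Q C H t s f ab r : R) : Q != 0 -> H != 0 -> t != 0 -> s != 0 -> f != 0 ->
  C ^+ 2 = ab / f ^+ 2 ->
  (Q * C * H * t / s) ^+ 2 * (f / (2 * H)) ^+ 2 * (s / Q * (r / t)) ^+ 2 =
  Q ^+ 2 * ab * t ^+ 2 * (r ^+ 2 / (Q ^+ 2 * t ^+ 2 * 4)).
Proof.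
move=> Q0 H0 t0 s0 f0 hC.
have -> : (Q * C * H * t / s) ^+ 2 * (f / (2 * H)) ^+ 2 * (s / Q * (r / t)) ^+ 2 =
  C ^+ 2 * (f ^+ 2 * r ^+ 2 / 4) by field; rewrite Q0 H0 t0.
by rewrite hC; field; rewrite Q0 t0.
Qed.

End RestartSteps.

Section Halving.
Context {R : realType} {d : nat}.
Local Notation V := 'rV[R]_d.
Implicit Types (z : V).
Context (p : nat) (L H sigma : R) (phi : V -> R) (xs : V).
Hypotheses (p0 : (0 < p)%N) (L0 : 0 <= L) (LH : 2 * L <= H) (H0 : 0 < H).
Hypotheses (s0 : 0 < sigma) (hphi : lip_deriv p L phi).
Hypotheses (uphi : uniformly_convex p.+1 sigma phi) (mxs : is_argmin phi xs).

Let dphi x : differentiable phi x := ndifferentiable1 p0 hphi.1 x.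
Let cphi : grad_convex phi := uc_grad_convex (ltW s0) dphi uphi.
Let d0 x : differentiable (fun _ : V => 0 : R) x.
Proof. exact: differentiable_cst. Qed.
Let c0 : @grad_convex R d (fun=> 0).
Proof. by move=> x y; rewrite derive_cst addr0. Qed.
Let mxs0 : is_argmin (fun v => phi v + 0) xs.
Proof. by move=> y; rewrite !addr0. Qed.

Lemma restart_exists T z N : (0 < T)%N -> exists z' m, catd_output p H T phi (fun=> 0) z N z' m.
Proof. exact: (catd_output_exists p0 L0 LH H0 hphi cphi d0 c0 mxs0). Qed.

Lemma restart_cost T z N z' m : catd_output p H T phi (fun=> 0) z N z' m -> (m <= N * T.+1)%N.
Proof. exact: (catd_output_cost p0 L0 LH H0 hphi cphi d0 c0 mxs0). Qed.

(** If [z'] were farther than R0/2, uniform convexity would make its gap exceed [D]; as the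
    potential bounds A times the gap by R0^2/2, this contradicts the growth of A over the prescribed
    number of steps. Squares are compared to avoid half-integer powers. *)
Lemma restart_halving T z r R0 z' m :
  catd_output p H T phi (fun=> 0) z (restart_steps p p.+1 H sigma r) z' m ->
  enorm (z - xs) <= R0 -> enorm (z' - xs) <= R0 / 2.
Proof.
move=> hout hz; have R00 : 0 <= R0 by apply: le_trans hz; exact: enorm_ge0.
(* A run stopped early returns an exact minimizer, which is [xs] by uniqueness. *)
case: hout => [[A [x run]]|[n [A [y [_ _ mz']]]]]; last first.
  have mz : is_argmin phi z' by move=> u; have := mz' u; rewrite !addr0.
  by rewrite (uc_argmin_unique (ltn0Sn p) s0 dphi uphi mxs mz) subrr enorm0 divr_ge0.
have [inv _] := catd_run_inv p0 L0 LH H0 hphi cphi d0 c0 mxs0 run hz.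
(* The rate presupposes R0 > 0; for R0 = 0 the bound 9/4 R0 of the invariant suffices. *)
have [E|R0n] := eqVneq R0 0.
  by have [_ h _] := inv; move: h; rewrite E mulr0 mul0r.
have R0p : 0 < R0 by rewrite lt_def R0n.
have [h1 h2] := ms_inv_rate p0 (growth_const_gt0 p H0) mxs0 inv R0p.
have hN := restart_steps_sqr p r H0 s0.
set N := restart_steps _ _ _ _ _ in h2 hN.
rewrite leNgt; apply/negP => far.
have uc := uc_argmin z' dphi uphi mxs.
pose D := sigma / p.+1%:R * (R0 / 2) ^+ p.+1.
have sp : 0 < sigma / p.+1%:R by rewrite divr_gt0.
have D0 : 0 < D by rewrite mulr_gt0// exprn_gt0// divr_gt0.
have hD : D < phi z' - phi xs.
  rewrite ltrBrDl; apply: lt_le_trans uc; rewrite ltrD2l ltr_pM2l//.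
  by rewrite ltrXn2r ?nnegrE ?divr_ge0 ?enorm_ge0// ltW.
rewrite !addr0 in h1.
have X0 := restart_ratio_gt0 p H0 s0.
have k0 := growth_const_gt0 p H0.
have [A0 _ _] := inv.
have h3 := lt_le_trans (mulr_gt0 (exprn_gt0 2 X0) (exprn_gt0 2 k0)) (le_trans (ler_wpM2r (sqr_ge0 _) hN) h2).
have Ap : 0 < A.
  rewrite lt_def A0 andbT; apply/eqP => E; move: h3.
  by rewrite E [0 ^+ 2]expr0n /= mulr0 mul0r ltxx.
have h4 : A * D < R0 ^+ 2 / 2 by apply: lt_le_trans h1; rewrite ltr_pM2l.
have h5 : restart_ratio p H sigma ^+ 2 * growth_const p H ^+ 2 * D ^+ 2 <
    p.+1%:R ^+ (2 * p + 2) * (R0 ^+ 2 / 2) ^+ 2 * (49 / 33 * R0 ^+ 2) ^+ p.-1.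
  have hS : 0 < p.+1%:R ^+ (2 * p + 2) * (49 / 33 * R0 ^+ 2) ^+ p.-1.
    by rewrite mulr_gt0 ?exprn_gt0// mulr_gt0// exprn_gt0.
  have h6 : (A * D) ^+ 2 < (R0 ^+ 2 / 2) ^+ 2.
    by rewrite ltrXn2r ?nnegrE ?divr_ge0 ?exprn_ge0// mulr_ge0// ltW.
  have := ler_wpM2r (sqr_ge0 D) (le_trans (ler_wpM2r (sqr_ge0 _) hN) h2) => h7.
  apply: (le_lt_trans h7).
  have -> : p.+1%:R ^+ (2 * p + 2) * A ^+ 2 * (49 / 33 * R0 ^+ 2) ^+ p.-1 * D ^+ 2 =
    p.+1%:R ^+ (2 * p + 2) * (49 / 33 * R0 ^+ 2) ^+ p.-1 * (A * D) ^+ 2 by rewrite exprMn; ring.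
  by rewrite [ltRHS]mulrAC ltr_pM2l.
move: h5; apply/negP; rewrite -leNgt.
have hc := @halving_const R p p0.
have f1 : 0 < (p.-1)`!%:R :> R by rewrite ltr0n fact_gt0.
have P0 : 0 < p.+1%:R :> R by rewrite ltr0n.
have -> : restart_ratio p H sigma ^+ 2 * growth_const p H ^+ 2 * D ^+ 2 =
  p.+1%:R ^+ 2 * (2 ^+ (2 * p.-1) * p.+1%:R ^+ (3 * p + 1)) * 2 ^+ (2 * p.+1) *
  (R0 ^+ (2 * p.+1) / (p.+1%:R ^+ 2 * 2 ^+ (2 * p.+1) * 4)).
  have e2 (y : R) : y ^+ (2 * p.+1) = (y ^+ p.+1) ^+ 2 by rewrite mulnC exprM.
  rewrite !e2 /restart_ratio /growth_const /D (expr_div_n R0).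
  by apply: halving_identity; rewrite ?catd_const_sqr// gt_eqF// exprn_gt0.
have -> : p.+1%:R ^+ (2 * p + 2) * (R0 ^+ 2 / 2) ^+ 2 * (49 / 33 * R0 ^+ 2) ^+ p.-1 =
  4 * p.+1%:R ^+ (2 * p + 4) * (49 / 33) ^+ p.-1 * 2 ^+ (2 * p) *
  (R0 ^+ (2 * p.+1) / (p.+1%:R ^+ 2 * 2 ^+ (2 * p.+1) * 4)).
  have -> : R0 ^+ (2 * p.+1) = (R0 ^+ 2) ^+ 2 * (R0 ^+ 2) ^+ p.-1.
    by rewrite -exprD -exprM; congr (_ ^+ _); case: p p0 => // q _ /=; lia.
  have -> : p.+1%:R ^+ (2 * p + 4) = p.+1%:R ^+ (2 * p + 2) * p.+1%:R ^+ 2 :> R.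
    by rewrite -exprD -addnA.
  have -> : 2 ^+ (2 * p.+1) = 4 * 2 ^+ (2 * p) :> R.
    by rewrite mulnS (exprD _ 2); congr (_ * _); ring.
  rewrite (exprMn _ (49 / 33)); field.
  by rewrite !gt_eqF// exprn_gt0.
apply: ler_wpM2r => //.
by rewrite divr_ge0 ?exprn_ge0// !mulr_ge0 ?exprn_ge0.
Qed.

End Halving.

(** * Accuracy of the inner iterates *)

Section DerivativeBounds.
Context {R : realType} {d : nat}.
Local Notation V := 'rV[R]_d.
Implicit Types (c x y z u v w h : V) (phi : V -> R) (vs : seq V).

(** Descent from order [p], where the Lipschitz condition applies, to lower orders by the mean value
    theorem. Each order lost costs a factor 1 + r. *)
Lemma Dn_bound_ball p L B r phi x0 : lip_deriv p L phi -> 0 <= L -> 0 <= B -> 0 <= r ->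
  deriv_bound p B phi x0 -> forall j vs x, (2 <= size vs)%N -> (j + size vs = p)%N ->
  enorm (x - x0) <= r ->
  `|Dn phi vs x| <= (B + L) * (1 + r) ^+ j.+1 * \prod_(v <- vs) enorm v.
Proof.
move=> hphi L0 B0 r0 hB; elim=> [|j IH] vs x s2 sj xr.
  have P0 := prod_enorm_ge0 vs.
  have h1 := hB vs; rewrite s2 -sj leqnn in h1.
  have h2 := hphi.2 vs x x0 sj.
  have h3 : L * enorm (x - x0) * \prod_(v <- vs) enorm v <= L * r * \prod_(v <- vs) enorm v.
    by rewrite ler_wpM2r// ler_wpM2l.
  rewrite -[Dn phi vs x](subrK (Dn phi vs x0)); apply: (le_trans (ler_normD _ _)).
  apply: (le_trans (lerD (le_trans h2 h3) (h1 isT))).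
  rewrite -mulrDl ler_wpM2r// expr1; nra.
have P0 := prod_enorm_ge0 vs.
have h1 := hB vs; rewrite s2 -sj leq_addl in h1.
have df y : differentiable (Dn phi vs) y by apply: hphi.1; rewrite -sj addSn ltnS leq_addl.
have [t /andP[t0 t1] ht] := line_mvt x0 (x - x0) df.
have tr : enorm (x0 + t *: (x - x0) - x0) <= r.
  rewrite addrAC subrr add0r enormZ gtr0_norm//; apply: le_trans xr.
  by rewrite ler_piMl ?enorm_ge0// ltW.
have := IH ((x - x0) :: vs) _ (leqW s2) _ tr; rewrite addnS => /(_ sj) /=.
rewrite -ht (addrC x0) subrK big_cons => h2.
set X := (B + L) * (1 + r) ^+ j.+1 in h2.
have X0 : 0 <= X by rewrite mulr_ge0 ?addr_ge0// exprn_ge0// addr_ge0.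
have BX : B <= X.
  have : 1 <= (1 + r) ^+ j.+1 by rewrite exprn_ege1// lerDl.
  move=> h; apply: (@le_trans _ _ (B + L)); first by rewrite lerDl.
  by rewrite /X ler_peMr ?addr_ge0.
have h3 : X * (enorm (x - x0) * \prod_(v <- vs) enorm v) <= X * (r * \prod_(v <- vs) enorm v).
  by rewrite ler_wpM2l// ler_wpM2r.
rewrite -[Dn phi vs x](subrK (Dn phi vs x0)); apply: (le_trans (ler_normD _ _)).
apply: (le_trans (lerD (le_trans h2 h3) (h1 isT))).
rewrite exprSr mulrA -/X mulrA -mulrDl ler_wpM2r//.
by rewrite mulrDr mulr1 addrC lerD2r.
Qed.

Lemma deriv_bound_ball p L B r phi x0 x : lip_deriv p L phi -> 0 <= L -> 0 <= B -> 0 <= r ->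
  deriv_bound p B phi x0 -> enorm (x - x0) <= r ->
  deriv_bound p ((B + L) * (1 + r) ^+ p) phi x.
Proof.
move=> hphi L0 B0 r0 hB xr vs /andP[s2 sp].
have := Dn_bound_ball hphi L0 B0 r0 hB s2 (subnK sp) xr => /le_trans; apply.
rewrite ler_wpM2r ?prod_enorm_ge0// ler_wpM2l ?addr_ge0//.
by rewrite ler_weXn2l ?lerDl//; lia.
Qed.

Lemma grad_lipschitz_ball p L B r phi c x y : (0 < p)%N ->
  lip_deriv p L phi -> 0 <= L -> 0 <= B -> 0 <= r -> deriv_bound p B phi c ->
  enorm (x - c) <= r -> enorm (y - c) <= r ->
  enorm (grad phi x - grad phi y) <= (B + L) * (1 + r) ^+ p * enorm (x - y).
Proof.
move=> p0 hphi L0 B0 r0 hB xr yr.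
have df u : differentiable phi u by exact: (ndifferentiable1 p0 hphi.1).
have X1 : 1 <= (1 + r) ^+ p by rewrite exprn_ege1// lerDl.
have X0 : 0 <= (B + L) * (1 + r) ^+ p by rewrite mulr_ge0 ?addr_ge0// exprn_ge0// addr_ge0.
apply: enorm_le_of_edot => [|h]; first by rewrite mulr_ge0 ?enorm_ge0.
rewrite edotDl edotNl !edot_grad//; apply: (le_trans (ler_norm _)).
(* For p = 1 [deriv_bound] says nothing, but the gradient is Lipschitz by hypothesis. *)
have [p1|p1] := ltnP 1 p; last first.
  have pE : p = 1%N by apply/eqP; rewrite eqn_leq p1 p0.
  have := hphi.2 [:: h] x y; rewrite pE big_seq1 => /(_ erefl) /= hl.
  apply: (le_trans hl); rewrite ler_wpM2r ?enorm_ge0// ler_wpM2r ?enorm_ge0//.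
  rewrite -pE; apply: (@le_trans _ _ (B + L)); first by rewrite lerDr.
  by rewrite ler_peMr ?addr_ge0.
have d2 u : differentiable ('D_h phi) u by apply: (hphi.1 [:: h]).
have [t /andP[t0 t1] ht] := line_mvt y (x - y) d2.
rewrite (addrC y) subrK in ht; rewrite ht.
have tr : enorm (y + t *: (x - y) - c) <= r.
  have -> : y + t *: (x - y) - c = t *: (x - c) + (1 - t) *: (y - c).
    by apply/rowP => i; rewrite !mxE; ring.
  have t1' : 0 < 1 - t by rewrite subr_gt0.
  apply: (le_trans (enormD _ _)); rewrite !enormZ !gtr0_norm//; nra.
have := deriv_bound_ball hphi L0 B0 r0 hB tr (vs := [:: x - y; h]) p1.
by rewrite /= big_cons big_seq1 mulrA.
Qed.

End DerivativeBounds.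

Section Accuracy.
Context {R : realType} {d : nat}.
Local Notation V := 'rV[R]_d.
Implicit Types (c x y z : V).

(* [n1] and [n2] stand for the norms at z of the gradients of the model and of F,
   [t] for the distance from z to the minimizer of F, [X] for 2^J. *)
Lemma accuracy_arith (K M R0 eps n1 n2 t X : R) : 0 < K -> 0 <= M -> 0 < R0 -> 0 < X -> 0 < eps ->
  n1 <= M * (9 * R0 / X) -> eps <= n2 * t -> 0 <= n2 -> t <= 16 * R0 ->
  144 * K * M * R0 ^+ 2 / eps <= X -> n1 <= K^-1 * n2.
Proof.
move=> K0 M0 R00 X0 e0 h1 h2 n0 h3 h4.
have h5 : eps <= n2 * (16 * R0) by apply: (le_trans h2); rewrite ler_wpM2l.
apply: (le_trans h1); rewrite ler_pdivlMl//.
rewrite -(ler_pM2r (mulr_gt0 X0 (mulr_gt0 (ltr0n R 16 : 0 < 16 = true) R00))).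
have -> : K * (M * (9 * R0 / X)) * (X * (16 * R0)) = 144 * K * M * R0 ^+ 2 by field; rewrite gt_eqF.
rewrite ler_pdivrMr// in h4; apply: (le_trans h4).
by rewrite mulrCA ler_pM2l.
Qed.

Context (p : nat) (Lf Lg Hin B R0 eps : R) (f g : V -> R) (x0 xs : V).
Hypotheses (p0 : (0 < p)%N) (Lf0 : 0 < Lf) (Lfg : Lf < Lg) (B0 : 0 <= B) (eps0 : 0 < eps).
Hypotheses (hf : lip_deriv p Lf f) (cf : grad_convex f).
Hypotheses (hg : lip_deriv p Lg g) (cg : grad_convex g).
Hypotheses (Bf : deriv_bound p B f x0) (Bg : deriv_bound p B g x0).
Hypotheses (mxs : is_argmin (fun v => f v + g v) xs).
Hypotheses (R0p : 0 < R0) (hx0 : enorm (x0 - xs) <= R0).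

Let F v := f v + g v.
Let sub c := subproblem p (2 * Lf) f g c.
Let df x : differentiable f x := ndifferentiable1 p0 hf.1 x.
Let dg x : differentiable g x := ndifferentiable1 p0 hg.1 x.
Let Lf0' : 0 <= Lf := ltW Lf0.
Let Lg0 : 0 < Lg := lt_trans Lf0 Lfg.
Let H0 : 0 < 2 * Lf.
Proof. by rewrite mulr_gt0. Qed.

Definition sub_lip (q : nat) (lf lg : R) : R := 2 * lf / q`!%:R * (2 * q + 1)%:R ^+ q.+1 + lg.

Lemma lip_deriv_sub c : lip_deriv p (sub_lip p Lf Lg) (sub c).
Proof. exact: (lip_deriv_tensor_model H0 hf c hg). Qed.

(** A Lipschitz constant for the gradient of the subproblem on the ball of radius 18 r about its
    center. The center is within 4 r of x0, and [f] and [g] each contribute one share to the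
    derivatives there. *)
Definition grad_lip (q : nat) (lg b hin r : R) : R :=
  (2 * ((b + lg) * (1 + 4 * r) ^+ q) + hin) * (1 + 18 * r) ^+ q.

Lemma sub_dist c zmin : enorm (c - xs) <= 9 / 4 * R0 -> is_argmin (sub c) zmin ->
  enorm (c - zmin) <= 9 * R0.
Proof.
move=> hc mz; have h := model_argmin_dist p0 Lf0' (lexx _) H0 hf cf dg cg mxs mz.
apply: (le_trans (enorm_tri xs _ _)); rewrite (enormB xs); lra.
Qed.

(** By convexity a point that is not an eps-solution has |grad F| at least eps/(16 R0), while the
    gradient of the model, zero at [zmin], is at most a multiple of 9 R0/2^J. The product 9 times 16
    is the 144. *)
Lemma accurate_of_close c zmin z (J : nat) : enorm (c - xs) <= 9 / 4 * R0 ->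
  is_argmin (sub c) zmin -> enorm (z - zmin) <= enorm (c - zmin) / 2 ^+ J ->
  sub_lip p Lf Lg <= Hin -> eps < F z - F xs ->
  144 * (4 * p * p.+1)%:R * grad_lip p Lg B Hin R0 * R0 ^+ 2 / eps <= 2 ^+ J ->
  accurate p (2 * Lf) f g c z.
Proof.
move=> hc mz hz hH hF hJ.
have hcz := sub_dist hc mz.
have X0 : 0 < 2 ^+ J :> R by rewrite exprn_gt0.
have X1 : 1 <= 2 ^+ J :> R by rewrite exprn_ege1// ler1n.
have sl0 : 0 <= sub_lip p Lf Lg.
  by rewrite /sub_lip addr_ge0 ?(ltW Lg0)// mulr_ge0 ?exprn_ge0// divr_ge0// ltW.
have Hin0 := le_trans sl0 hH.
have R0' : 0 <= R0 by exact: ltW.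
have hz1 : enorm (z - zmin) <= 9 * R0 / 2 ^+ J.
  by apply: (le_trans hz); rewrite ler_pM2r ?invr_gt0.
have hz2 : enorm (z - zmin) <= 9 * R0.
  by apply: (le_trans hz1); rewrite ler_pdivrMr// ler_peMr// mulr_ge0.
have hmin := model_argmin_dist p0 Lf0' (lexx _) H0 hf cf dg cg mxs mz.
have zs : enorm (z - xs) <= 16 * R0.
  by apply: (le_trans (enorm_tri zmin _ _)); lra.
have zc : enorm (z - c) <= 18 * R0.
  by apply: (le_trans (enorm_tri zmin _ _)); rewrite (enormB zmin); lra.
have mc : enorm (zmin - c) <= 18 * R0 by rewrite enormB; lra.
have cx : enorm (c - x0) <= 4 * R0.
  by apply: (le_trans (enorm_tri xs _ _)); rewrite (enormB xs); have := hx0; lra.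
pose B' := 2 * ((B + Lg) * (1 + 4 * R0) ^+ p).
have r4 : 0 <= 4 * R0 by rewrite mulr_ge0.
have B'0 : 0 <= B'.
  by rewrite /B' mulr_ge0// mulr_ge0 ?exprn_ge0 ?addr_ge0// ltW.
have Bsub : deriv_bound p B' (sub c) c.
  move=> vs hvs; have /andP[_ sp] := hvs.
  rewrite /sub (Dn_tensor_model_center _ hf _ hg.1 sp).
  have b1 := deriv_bound_ball hf Lf0' B0 r4 Bf cx hvs.
  have b2 := deriv_bound_ball hg (ltW Lg0) B0 r4 Bg cx hvs.
  apply: (le_trans (ler_normD _ _)); apply: (le_trans (lerD b1 b2)).
  have B'E : B' = (B + Lg) * (1 + 4 * R0) ^+ p + (B + Lg) * (1 + 4 * R0) ^+ p.
    by rewrite /B' mulr_natl mulr2n.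
  rewrite -mulrDl B'E; apply: ler_wpM2r; [exact: prod_enorm_ge0|rewrite lerD2r].
  by rewrite ler_wpM2r ?lerD2l ?(ltW Lfg)// exprn_ge0// addr_ge0.
have hl := lip_deriv_le (lip_deriv_sub c) hH.
have r18 : 0 <= 18 * R0 by rewrite mulr_ge0.
have := grad_lipschitz_ball p0 hl Hin0 B'0 r18 Bsub zc mc.
have -> : grad (sub c) zmin = 0.
  apply/rowP => i; rewrite !mxE; apply: derive_argmin => //.
  exact: (tensor_model_diff (2 * Lf) p0 hf dg c zmin).1.
rewrite subr0 -/(grad_lip p Lg B Hin R0) => hgr.
have M0 : 0 <= grad_lip p Lg B Hin R0.
  by rewrite /grad_lip mulr_ge0 ?addr_ge0// exprn_ge0// addr_ge0.
rewrite /accurate; apply: (accuracy_arith (M := grad_lip p Lg B Hin R0) (R0 := R0) (eps := eps)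
  (t := enorm (z - xs)) (X := 2 ^+ J)) => //.
- by rewrite ltr0n !muln_gt0 p0.
- by apply: (le_trans hgr); rewrite ler_wpM2l.
- have := sum_convex p0 hf cf dg cg z xs; rewrite -/F => hcv.
  have h2 := normr_edot_le (grad f z + grad g z) (xs - z).
  rewrite gradD// (enormB z); apply: le_trans h2; rewrite -normrN; apply: le_trans (ler_norm _).
  apply: ltW; apply: (lt_le_trans hF).
  by move: hcv; rewrite /F; move: (edot _ _) => s hcv; rewrite lerBlDr -lerBlDl opprK.
- exact: enorm_ge0.
Qed.

End Accuracy.

Lemma bernoulli_le (R : realFieldType) (e : R) (n : nat) : 0 <= e -> e <= 1 ->
  1 - e * n%:R <= (1 - e) ^+ n.
Proof.
move=> e0 e1; elim: n => [|n IH]; first by rewrite mulr0 subr0 expr0.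
have h : 0 <= 1 - e by rewrite subr_ge0.
have := ler_wpM2l h IH; rewrite -exprS; apply: le_trans.
rewrite -natr1; have n0 : 0 <= n%:R :> R by []; nra.
Qed.

(* The value w0 = p / (p+1) / (1 + 2^-j)^(p-1) leaves room on both sides of the
   window for all the points at relative distance 2^-j from the exact minimizer. *)
Lemma window_robust (R : realType) (d p j : nat) (H lam : R) (c z z' : 'rV[R]_d) :
  (0 < p)%N -> 0 < H -> 0 < lam -> (4 * p <= 2 ^ j)%N ->
  lam * (H * enorm (z - c) ^+ p.-1 / (p.-1)`!%:R) = p%:R / p.+1%:R / (1 + 2 ^- j) ^+ p.-1 ->
  enorm (z' - z) <= enorm (c - z) / 2 ^+ j -> catd_window p H lam c z'.
Proof.
move=> p0 H0 l0 pj hw hz; set e : R := 2 ^- j in hw.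
have e0 : 0 < e by rewrite invr_gt0 exprn_gt0.
have P0 : 0 < p%:R :> R by rewrite ltr0n.
have ep : e * (4 * p%:R) <= 1.
  rewrite /e ler_pdivrMl ?exprn_gt0// mulr1.
  have : (4 * p)%:R <= (2 ^ j)%:R :> R by rewrite ler_nat.
  by rewrite natrM natrX.
have e1 : e <= 1 / 4 by rewrite ler_pdivlMr//; have : 1 <= p%:R :> R; [rewrite ler1n|nra].
have r0 := enorm_ge0 (z - c); set r := enorm (z - c) in hw r0.
rewrite (enormB c) -/r -/e in hz.
have up : enorm (z' - c) <= (1 + e) * r.
  apply: (le_trans (enorm_tri z _ _)); rewrite -/r mulrDl mul1r addrC lerD2l.
  by apply: (le_trans hz); rewrite mulrC.
have lo : (1 - e) * r <= enorm (z' - c).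
  have := enorm_tri z' z c; rewrite -/r (enormB z) => h.
  by have := le_trans h (lerD hz (lexx _)); lra.
have lo0 : 0 <= (1 - e) * r by rewrite mulr_ge0//; lra.
have up0 : 0 <= (1 + e) * r by rewrite mulr_ge0//; lra.
have f0 : 0 < (p.-1)`!%:R :> R by rewrite ltr0n fact_gt0.
have k0 : 0 < lam * H / (p.-1)`!%:R by rewrite divr_gt0// mulr_gt0.
have u0 : 0 < (1 + e) ^+ p.-1 by rewrite exprn_gt0//; lra.
have E t : lam * (H * t / (p.-1)`!%:R) = lam * H / (p.-1)`!%:R * t.
  by rewrite !mulrA mulrAC.
rewrite E in hw; rewrite /catd_window !E; apply/andP; split.
  apply: (@le_trans _ _ (lam * H / (p.-1)`!%:R * ((1 - e) * r) ^+ p.-1)); last first.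
    by rewrite ler_pM2l//; apply: lerXn2r; rewrite ?nnegrE ?enorm_ge0.
  rewrite exprMn mulrCA hw mulrA mulrAC mulrC.
  have h1 : (1 - 2 * e) ^+ p.-1 <= (1 - e) ^+ p.-1 / (1 + e) ^+ p.-1.
    rewrite -expr_div_n; apply: lerXn2r; rewrite ?nnegrE ?divr_ge0//; try lra.
    have d0 : 0 < 1 + e by lra.
    by rewrite ler_pdivlMr//; nra.
  have h2 : 1 - 2 * e * (p.-1)%:R <= (1 - 2 * e) ^+ p.-1 by apply: bernoulli_le; lra.
  have h3 : (p%:R + 1) / (2 * p%:R) <= 1 - 2 * e * (p.-1)%:R.
    have -> : (p.-1)%:R = p%:R - 1 :> R by rewrite -[in RHS](prednK p0) -natr1 addrK.
    have P1 : 0 <= p%:R - 1 :> R by rewrite subr_ge0 ler1n.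
    have := ler_wpM2r P1 ep; rewrite ler_pdivrMr ?mulr_gt0//; move: (p%:R) => P; lra.
  have h4 := le_trans h3 (le_trans h2 h1).
  have q0 : 0 <= p%:R / p.+1%:R :> R by rewrite divr_ge0.
  have := ler_wpM2r q0 h4; rewrite -[p.+1%:R]natr1.
  have -> : (p%:R + 1) / (2 * p%:R) * (p%:R / (p%:R + 1)) = 2^-1 :> R.
    by field; rewrite !gt_eqF//; lra.
  move=> h5; apply: (le_trans h5); rewrite le_eqVlt; apply/orP; left; apply/eqP; ring.
apply: (@le_trans _ _ (lam * H / (p.-1)`!%:R * ((1 + e) * r) ^+ p.-1)).
  by rewrite ler_pM2l//; apply: lerXn2r; rewrite ?nnegrE ?enorm_ge0.
by rewrite exprMn mulrCA hw mulrC divfK// gt_eqF.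
Qed.

(** * The combination framework *)

Section FrameworkInvariant.
Context {R : realType} {d : nat}.
Local Notation V := 'rV[R]_d.
Implicit Types (c x y z : V).

Lemma uc_le (s : nat) (sigma sigma' : R) (phi : V -> R) : sigma <= sigma' ->
  uniformly_convex s sigma' phi -> uniformly_convex s sigma phi.
Proof.
move=> h uc x y; apply: le_trans (uc x y); rewrite lerD2l.
by rewrite ler_wpM2r ?exprn_ge0 ?enorm_ge0// ler_wpM2r.
Qed.

Lemma budget_restart (K a n u w J : nat) : (n <= K + a + 1 + u)%N -> (u <= J)%N ->
  (n.+1 <= K + (J.+2 + a) + 1 + w)%N.
Proof. lia. Qed.

Lemma budget_iter (K a n u W J : nat) : (n <= K + a + 1 + u)%N -> (u <= J)%N ->
  (a + J.+2 <= W)%N -> (n <= K + W)%N.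
Proof. lia. Qed.

Context (p : nat) (Lf Lg sigma Hin B R0 eps : R) (f g : V -> R) (x0 xs : V).
Context (T J Q M : nat).
Hypotheses (p0 : (0 < p)%N) (Lf0 : 0 < Lf) (Lfg : Lf < Lg) (B0 : 0 <= B) (eps0 : 0 < eps).
Hypotheses (hf : lip_deriv p Lf f) (cf : grad_convex f).
Hypotheses (hg : lip_deriv p Lg g) (cg : grad_convex g).
Hypotheses (Bf : deriv_bound p B f x0) (Bg : deriv_bound p B g x0).
Hypotheses (mxs : is_argmin (fun v => f v + g v) xs).
Hypotheses (R0p : 0 < R0) (hx0 : enorm (x0 - xs) <= R0).
Hypotheses (s0 : 0 < sigma) (hs : sigma <= model_sigma p (2 * Lf)).
Hypotheses (Hin0 : 0 < Hin) (hH : 2 * sub_lip p Lf Lg <= Hin).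

Let F v := f v + g v.
Let sub c := subproblem p (2 * Lf) f g c.
Let kap := growth_const p (2 * Lf).

Hypothesis hJ : 144 * (4 * p * p.+1)%:R * grad_lip p Lg B Hin R0 * R0 ^+ 2 / eps <= 2 ^+ J.
Hypothesis hQ : forall k A x y, ms_inv p kap F xs R0 k A x y -> eps < F y - F xs -> (k <= Q)%N.
Hypothesis hM : (0 < M)%N /\ forall r, (restart_steps p p.+1 Hin sigma r * T.+1 <= M)%N.

Let df x : differentiable f x := ndifferentiable1 p0 hf.1 x.
Let dg x : differentiable g x := ndifferentiable1 p0 hg.1 x.
Let Lf0' : 0 <= Lf := ltW Lf0.
Let Lg0 : 0 < Lg := lt_trans Lf0 Lfg.
Let H0 : 0 < 2 * Lf.
Proof. by rewrite mulr_gt0. Qed.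
Let kap0 : 0 < kap := growth_const_gt0 p H0.
Let R00 : 0 <= R0 := ltW R0p.
Let sl0 : 0 <= sub_lip p Lf Lg.
Proof. by rewrite /sub_lip addr_ge0 ?(ltW Lg0)// mulr_ge0 ?exprn_ge0// divr_ge0// ltW. Qed.
Let hH1 : sub_lip p Lf Lg <= Hin.
Proof. by apply: le_trans hH; rewrite ler_peMl// ler1n. Qed.

Lemma sub_uc c : uniformly_convex p.+1 sigma (sub c).
Proof. exact: uc_le hs (tensor_model_uc p0 Lf0' (lexx _) H0 hf cf dg cg c). Qed.

Lemma sub_lip_deriv c : lip_deriv p (sub_lip p Lf Lg) (sub c).
Proof. exact: lip_deriv_sub. Qed.

Lemma sub_argmin_exists c : exists z, is_argmin (sub c) z.
Proof. exact: model_argmin_exists p0 Lf0' (lexx _) H0 hf cf dg cg c. Qed.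

(* A candidate costs at most J + 2 computations for f, since every point z_j with
   j >= J is accurate, and an iteration examines at most T candidates. *)
Definition fw_inv (k : nat) (s : fw_state R d) : Prop :=
  match s with
  | Outer A x y t nf ng =>
    [/\ ms_inv p kap F xs R0 k A x y, (k <= Q.+1)%N, (t <= T)%N,
        (nf <= k * (T * J.+2) + t * J.+2)%N & (ng <= M * nf)%N]
  | Inner A x y lam j z t nf ng =>
    [/\ ms_inv p kap F xs R0 k A x y, (k <= Q.+1)%N, (0 < t <= T)%N /\ 0 < lam,
        (nf <= k * (T * J.+2) + t.-1 * J.+2 + 1 + minn j J)%N /\ (ng <= M * nf)%N
      & exists2 zmin, is_argmin (sub (catd_mid lam A x y)) zmin &
          enorm (z - zmin) <= enorm (catd_mid lam A x y - zmin) / 2 ^+ j]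
  end.

Let reached := eps_reached F xs eps.
Let step := fw_step p f g (2 * Lf) sigma Hin T.

Lemma not_reachedP s v : ~ reached s -> v \in fw_points s -> eps < F v - F xs.
Proof. by move=> h hv; rewrite ltNge; apply/negP => le; apply: h; exists v. Qed.

Lemma mid_close k A x y lam : ms_inv p kap F xs R0 k A x y -> 0 < lam ->
  enorm (catd_mid lam A x y - xs) <= 9 / 4 * R0.
Proof.
move=> hi l0; have [A0 hy _] := hi; apply: catd_mid_dist => //.
by apply: (le_trans (ms_inv_x mxs R00 hi)); have := R00; lra.
Qed.

Lemma fw_inv_accurate k A x y lam j z t nf ng :
  fw_inv k (Inner A x y lam j z t nf ng) -> ~ reached (Inner A x y lam j z t nf ng) ->
  (J <= j)%N -> accurate p (2 * Lf) f g (catd_mid lam A x y) z.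
Proof.
move=> [hi _ [_ l0] _ [zmin mz hz]] nr Jj.
apply: (accurate_of_close p0 Lf0 Lfg B0 eps0 hf cf hg cg Bf Bg mxs R0p hx0
  (mid_close hi l0) mz (J := J) _ hH1 _ hJ).
  apply: (le_trans hz); rewrite ler_wpM2l ?enorm_ge0// lef_pV2 ?posrE ?exprn_gt0//.
  by rewrite ler_weXn2l// ler1n.
by apply: (not_reachedP nr); rewrite !inE eqxx !orbT.
Qed.

Lemma fw_inv_try k A x y t nf ng lam : fw_inv k (Outer A x y t nf ng) -> 0 < lam -> (t < T)%N ->
  fw_inv k (Inner A x y lam 0 (catd_mid lam A x y) t.+1 nf.+1 ng.+1).
Proof.
move=> [hi kQ tT hn hg'] l0 tT'; split=> //.
- split; first by rewrite min0n addn0 addn1.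
  by case: hM => M0 _; rewrite mulnS -add1n leq_add.
- have [zmin mz] := sub_argmin_exists (catd_mid lam A x y).
  by exists zmin => //; rewrite expr0 divr1.
Qed.

Lemma fw_inv_restart k A x y lam j z t nf ng zmin z' m :
  let c := catd_mid lam A x y in
  let acc := accurate p (2 * Lf) f g c z in
  fw_inv k (Inner A x y lam j z t nf ng) -> ~ reached (Inner A x y lam j z t nf ng) ->
  (t + acc <= T)%N -> is_argmin (sub c) zmin ->
  catd_output p Hin T (sub c) (fun=> 0) z
      (restart_steps p p.+1 Hin sigma (enorm (c - zmin) / 2 ^+ j)) z' m ->
  fw_inv k (Inner A x y lam j.+1 z' (t + acc) nf.+1 (ng + m)).
Proof.
move=> c acc hinv nr tT mz hout.
have hacc := fw_inv_accurate hinv nr; rewrite -/c -/acc in hacc.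
have [hi kQ [/andP[t0 _] l0] [hn hg'] [zm mzm hz]] := hinv.
have dsub u : differentiable (sub c) u := ndifferentiable1 p0 (sub_lip_deriv c).1 u.
(* The minimizer that fixes the restart length is the one tracked by the invariant. *)
have E : zm = zmin := uc_argmin_unique (ltn0Sn p) s0 dsub (sub_uc c) mz mzm.
rewrite E -/c in hz; split=> //.
- by split=> //; rewrite ltn_addr.
- split.
    (* An accurate point opens a new candidate with a fresh allowance J+2. Otherwise j < J, and the
       minimum grows by one. *)
    move: hacc; case: acc tT => tT hacc /=.
      case: t t0 hn {tT hacc hinv nr} => // t _ /= hn; rewrite (addn1 t).
      by rewrite mulSn; apply: (budget_restart _ hn); exact: geq_minr.
    rewrite addn0; case: (leqP J j) => jJ; first by have := hacc jJ.
    rewrite (minn_idPl jJ); move: hn; rewrite (minn_idPl (ltnW jJ)).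
    by rewrite (addnS _ j) ltnS.
  rewrite mulnS addnC leq_add//; have [_ hM'] := hM.
  have := restart_cost p0 sl0 hH Hin0 s0 (sub_lip_deriv c) (sub_uc c) mz hout.
  by move=> /leq_trans; apply.
- exists zmin => //; rewrite -/c exprSr invfM mulrA.
  exact: (restart_halving p0 sl0 hH Hin0 s0 (sub_lip_deriv c) (sub_uc c) mz hout hz).
Qed.

(** The bound k <= Q comes from the old iterate [y], which is not yet an eps-solution; the new count
    may thus be Q+1. *)
Lemma fw_inv_accept k A x y lam j z t nf ng :
  let c := catd_mid lam A x y in
  fw_inv k (Inner A x y lam j z t nf ng) -> ~ reached (Inner A x y lam j z t nf ng) ->
  accurate p (2 * Lf) f g c z -> catd_window p (2 * Lf) lam c z ->
  (k <= Q)%N /\ fw_inv k.+1 (Outer (A + catd_a lam A)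
             (x - catd_a lam A *: (grad f z + grad g z)) z 0 nf ng).
Proof.
move=> c hinv nr acc win.
have [hi kQ [/andP[t0 tT] l0] [hn hg'] [zm mzm hz]] := hinv.
have kQ' : (k <= Q)%N.
  apply: (hQ hi); apply: (not_reachedP nr); by rewrite !inE eqxx !orbT.
split=> //; split=> //.
- apply: (ms_inv_step p0 kap0 mxs R00 hi l0).
  + exact: (sum_convex p0 hf cf dg cg).
  + apply: (ms_error p0 Lf0' (lexx _) hf dg l0 win).
    by move: acc; rewrite /accurate gradD.
  + exact: (window_growth H0 l0 win).
- rewrite mul0n addn0 mulSn addnC; apply: (budget_iter hn (geq_minr _ _)).
  case: t t0 tT {hinv nr hn} => // t _ tT /=.
  by rewrite addnC -mulSn leq_mul2r tT orbT.
Qed.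

Lemma fw_inv_reject k A x y lam j z t nf ng :
  fw_inv k (Inner A x y lam j z t nf ng) -> fw_inv k (Outer A x y t nf ng).
Proof.
move=> [hi kQ [/andP[t0 tT] l0] [hn hg'] _]; split=> //.
apply: (budget_iter hn (geq_minr _ _)); case: t t0 {tT hn} => // t _ /=.
by rewrite addnC -mulSn.
Qed.

Lemma fw_inv_step k s s' : fw_inv k s -> ~ reached s -> step s s' -> exists k', fw_inv k' s'.
Proof.
move=> hi nr st; case: st hi nr => {s s'}.
- by move=> A x y t nf ng lam l0 tT _ _ hi _; exists k; exact: fw_inv_try.
- move=> A x y lam j z t nf ng zmin z' m c acc _ tT mz hout hi nr; exists k.
  exact: (fw_inv_restart hi nr tT mz hout).
- move=> A x y lam j z t nf ng c acc win hi nr; exists k.+1.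
  by have [] := fw_inv_accept hi nr acc win.
- by move=> A x y lam j z t nf ng c _ _ hi _; exists k; exact: fw_inv_reject hi.
Qed.

Let exec := fw_exec reached p f g (2 * Lf) sigma Hin T.

Lemma fw_inv_exec s : exec (fw_init x0) s -> exists k, fw_inv k s.
Proof.
elim=> [|s1 s2 _ [k IH] nr st]; last exact: fw_inv_step IH nr st.
by exists 0%N; split=> //; exact: ms_inv0.
Qed.

Lemma fw_inv_counts k s : fw_inv k s ->
  (fw_nf s <= Q.+2 * (T * J.+2))%N /\ (fw_ng s <= M * (Q.+2 * (T * J.+2)))%N.
Proof.
suff h : fw_inv k s -> (fw_nf s <= Q.+2 * (T * J.+2))%N /\ (fw_ng s <= M * fw_nf s)%N.
  move=> /h [h1 h2]; split=> //; apply: (leq_trans h2); by rewrite leq_mul2l h1 orbT.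
have key n : (k <= Q.+1)%N -> (n <= k * (T * J.+2) + T * J.+2)%N -> (n <= Q.+2 * (T * J.+2))%N.
  move=> kQ /leq_trans; apply; rewrite addnC -mulSn leq_mul2r ltnS kQ orbT//.
case: s => [A x y t nf ng|A x y lam j z t nf ng].
  move=> [_ kQ tT hn hg'] /=; split=> //; apply: key => //; apply: (leq_trans hn).
  by rewrite leq_add2l leq_mul2r tT orbT.
move=> [_ kQ [/andP[t0 tT] _] [hn hg'] _] /=; split=> //; apply: key => //.
apply: (budget_iter hn (geq_minr _ _)); case: t t0 tT {hn} => // t _ tT /=.
by rewrite addnC -mulSn leq_mul2r tT orbT.
Qed.

Lemma fw_exec_trans s s1 s2 : exec s s1 -> exec s1 s2 -> exec s s2.
Proof.
move=> h1; elim=> // a b h2 IH nr st; exact: fw_execS IH nr st.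
Qed.

Lemma fw_exec1 s s1 : ~ reached s -> step s s1 -> exec s s1.
Proof. by move=> nr st; apply: fw_execS nr st; exact: fw_exec0. Qed.

Context (j0 : nat).
Hypotheses (hj0 : (4 * p <= 2 ^ j0)%N) (hT : (j0.+2 <= T)%N).

Let T0 : (0 < T)%N.
Proof. exact: leq_trans hT. Qed.

(** Induction on the restarts left until both J and [j0] are reached: from J on points are accurate,
    from [j0] on they satisfy the window. Only accurate points with j < [j0] are charged as
    candidates, so t stays at most [j0]+1. *)
Lemma inner_progress k A x y lam j z t nf ng n :
  fw_inv k (Inner A x y lam j z t nf ng) -> (t <= (minn j j0).+1)%N ->
  (forall z' zmin, is_argmin (sub (catd_mid lam A x y)) zmin ->
     enorm (z' - zmin) <= enorm (catd_mid lam A x y - zmin) / 2 ^+ j0 ->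
     catd_window p (2 * Lf) lam (catd_mid lam A x y) z') ->
  (maxn J j0 - j <= n)%N ->
  (exists2 s, exec (Inner A x y lam j z t nf ng) s & reached s) \/
  (exists A' x' y' nf' ng', [/\ (k <= Q)%N, fw_inv k.+1 (Outer A' x' y' 0 nf' ng') &
     exec (Inner A x y lam j z t nf ng) (Outer A' x' y' 0 nf' ng')]).
Proof.
set c := catd_mid lam A x y => hinv ht hwin; elim: n j z t nf ng hinv ht => [|n IH] j z t nf ng hinv ht hn.
  have [hr|nr] := pselect (reached (Inner A x y lam j z t nf ng)).
    by left; exists (Inner A x y lam j z t nf ng) => //; exact: fw_exec0.
  have /andP[Jj jj] : (J <= j)%N && (j0 <= j)%N by rewrite -geq_max -subn_eq0 -leqn0.
  have acc := fw_inv_accurate hinv nr Jj.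
  have win : catd_window p (2 * Lf) lam c z.
    have [_ _ _ _ [zm mz hz]] := hinv; apply: (hwin _ _ mz); apply: (le_trans hz).
    rewrite ler_wpM2l ?enorm_ge0// lef_pV2 ?posrE ?exprn_gt0//.
    by rewrite ler_weXn2l// ler1n.
  have [kQ hi'] := fw_inv_accept hinv nr acc win.
  right; do 5 eexists; split; [exact: kQ|exact: hi'|].
  by apply: fw_exec1 nr _; exact: fw_accept.
have [hr|nr] := pselect (reached (Inner A x y lam j z t nf ng)).
  by left; exists (Inner A x y lam j z t nf ng) => //; exact: fw_exec0.
case: (boolP (accurate p (2 * Lf) f g c z && catd_window p (2 * Lf) lam c z)) => [/andP[acc win]|nacc].
  have [kQ hi'] := fw_inv_accept hinv nr acc win.
  right; do 5 eexists; split; [exact: kQ|exact: hi'|].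
  by apply: fw_exec1 nr _; exact: fw_accept.
have tacc : (t + accurate p (2 * Lf) f g c z <= (minn j.+1 j0).+1)%N /\ (j < maxn J j0)%N.
  case: (boolP (accurate p (2 * Lf) f g c z)) nacc => /= [acc nwin|nacc _].
    have jj : (j < j0)%N.
      rewrite ltnNge; apply/negP => jj; move/negP: nwin; apply.
      have [_ _ _ _ [zm mz hz]] := hinv; apply: (hwin _ _ mz); apply: (le_trans hz).
      rewrite ler_wpM2l ?enorm_ge0// lef_pV2 ?posrE ?exprn_gt0//.
      by rewrite ler_weXn2l// ler1n.
    by move: ht; rewrite (minn_idPl (ltnW jj)) (minn_idPl jj) addn1 ltnS leq_max jj orbT.
  rewrite addn0; split; last first.
    rewrite leq_max; apply/orP; left; rewrite ltnNge; apply/negP => Jj.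
    by move/negP: nacc; apply; exact: fw_inv_accurate hinv nr Jj.
  by apply: (leq_trans ht); rewrite ltnS leq_min !geq_min leqnSn leqnn orbT.
have [ht' jlt] := tacc.
have tT : (t + accurate p (2 * Lf) f g c z <= T)%N.
  by apply: (leq_trans ht'); apply: leq_trans hT; rewrite ltnS (leq_trans (geq_minr _ _)).
have [zm mz] := sub_argmin_exists c.
have [z' [m hout]] := restart_exists p0 sl0 hH Hin0 s0 (sub_lip_deriv c) (sub_uc c) mz z
   (restart_steps p p.+1 Hin sigma (enorm (c - zm) / 2 ^+ j)) T0.
have hinv' := fw_inv_restart hinv nr tT mz hout.
have st : step (Inner A x y lam j z t nf ng)
    (Inner A x y lam j.+1 z' (t + accurate p (2 * Lf) f g c z) nf.+1 (ng + m)).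
  by apply: fw_restart nacc tT mz hout.
have hn' : (maxn J j0 - j.+1 <= n)%N by rewrite subnS -subn1 leq_subLR add1n.
case: (IH _ _ _ _ _ hinv' ht' hn') => [[s e1 r1]|[A' [x' [y' [nf' [ng' [kQ i1 e1]]]]]]].
  by left; exists s => //; apply: fw_exec_trans e1; exact: fw_exec1.
right; exists A', x', y', nf', ng'; split=> //.
by apply: fw_exec_trans e1; exact: fw_exec1.
Qed.

Hypothesis hHin : forall c, lip_deriv p Hin (sub c).

Lemma outer_iteration k A x y nf ng : fw_inv k (Outer A x y 0 nf ng) ->
  (exists2 s, exec (Outer A x y 0 nf ng) s & reached s) \/
  (exists A' x' y' nf' ng', [/\ (k <= Q)%N, fw_inv k.+1 (Outer A' x' y' 0 nf' ng') &
     exec (Outer A x y 0 nf ng) (Outer A' x' y' 0 nf' ng')]).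
Proof.
move=> hinv; have [hr|nr] := pselect (reached (Outer A x y 0 nf ng)).
  by left; exists (Outer A x y 0 nf ng) => //; exact: fw_exec0.
have nx : ~ is_argmin F x.
  move=> mx; have := not_reachedP nr (mem_head _ _ : x \in fw_points (Outer A x y 0 nf ng)).
  rewrite ltNge => /negP; apply; have := mx xs; rewrite -subr_le0 => h.
  by apply: (le_trans h); exact: ltW.
have [[A0 _ _] _ _ _ _] := hinv.
(* The target of [window_robust], so that inexact solutions also end up in the window. *)
have w0 : 0 < p%:R / p.+1%:R / (1 + 2 ^- j0) ^+ p.-1 :> R.
  by rewrite divr_gt0 ?divr_gt0 ?ltr0n// exprn_gt0// addr_gt0 ?invr_gt0 ?exprn_gt0.
have [lam [zm [l0 mz hl]]] :=
  catd_lambda_exists p0 Lf0' (lexx _) H0 hf cf dg cg mxs y A0 nx w0.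
have hinv' := fw_inv_try hinv l0 T0.
have st : step (Outer A x y 0 nf ng)
    (Inner A x y lam 0 (catd_mid lam A x y) 1 nf.+1 ng.+1).
  by apply: fw_try => //; exact: sub_uc.
have hwin z' zm' : is_argmin (sub (catd_mid lam A x y)) zm' ->
    enorm (z' - zm') <= enorm (catd_mid lam A x y - zm') / 2 ^+ j0 ->
    catd_window p (2 * Lf) lam (catd_mid lam A x y) z'.
  move=> mz'; have dsub u : differentiable (sub (catd_mid lam A x y)) u.
    exact: ndifferentiable1 p0 (sub_lip_deriv _).1 u.
  rewrite (uc_argmin_unique (ltn0Sn p) s0 dsub (sub_uc _) mz mz').
  exact: (window_robust p0 H0 l0 hj0 hl).
case: (inner_progress hinv' (ltn0Sn _) hwin (leqnn _)) => [[s e1 r1]|[A' [x' [y' [nf' [ng' [kQ i1 e1]]]]]]].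
  by left; exists s => //; apply: fw_exec_trans e1; exact: fw_exec1.
right; exists A', x', y', nf', ng'; split=> //.
by apply: fw_exec_trans e1; exact: fw_exec1.
Qed.

Lemma outer_progress k A x y nf ng :
  fw_inv k (Outer A x y 0 nf ng) -> exists2 s, exec (Outer A x y 0 nf ng) s & reached s.
Proof.
move: (leqnn (Q.+1 - k)); move: {2}(Q.+1 - k)%N => n.
elim: n k A x y nf ng => [|n IH] k A x y nf ng hn hinv;
  case: (outer_iteration hinv) => [//|[A' [x' [y' [nf' [ng' [kQ i1 e1]]]]]]].
  by move: hn; rewrite leqn0 subn_eq0 ltnNge kQ.
have [|s e2 r2] := IH _ _ _ _ _ _ _ i1; first by rewrite subSS; move: hn; rewrite subSn.
by exists s => //; exact: fw_exec_trans e1 e2.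
Qed.

End FrameworkInvariant.

(** * Constants *)

Section Constants.
Context {R : realType}.
Implicit Types (x Y : R).

Lemma le_pow2 x : exists m : nat, x <= 2 ^+ m.
Proof.
exists (Num.trunc x).+1; apply: (le_trans (ltW (truncnS_gt x))).
by rewrite -natrX ler_nat ltnW// ltn_expl.
Qed.

Lemma pow2_ln (C : R) (k : nat) : exists2 D : R, 0 <= D & forall Y, expR 1 <= Y ->
  exists J : nat, C * Y ^+ k <= 2 ^+ J /\ J%:R <= D * ln Y.
Proof.
have [m hm] := le_pow2 C; have [m1 hm1] := le_pow2 (expR 1).
exists (m%:R + m1%:R * k%:R * 2) => [|Y hY]; first by rewrite addr_ge0 ?mulr_ge0.
have Y0 : 0 < Y by apply: lt_le_trans hY; exact: expR_gt0.
have L1 : 1 <= ln Y by rewrite -[X in X <= _]expRK ler_ln ?posrE ?expR_gt0.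
pose n := (Num.trunc (ln Y)).+1.
have nL : ln Y <= n%:R by exact: ltW (truncnS_gt _).
have n2 : n%:R <= 2 * ln Y.
  have h : (Num.trunc (ln Y))%:R <= ln Y by rewrite truncn_le; lra.
  by rewrite /n -natr1; lra.
exists (m + m1 * n * k)%N; split.
  have hY2 : Y <= 2 ^+ (m1 * n).
    rewrite -[Y]lnK ?posrE// exprM; apply: (@le_trans _ _ (expR 1 ^+ n)).
      by rewrite -expRM_natr mul1r ler_expR.
    by apply: lerXn2r; rewrite ?nnegrE ?expR_ge0.
  rewrite exprD; apply: (@le_trans _ _ (2 ^+ m * Y ^+ k)).
    by rewrite ler_wpM2r// exprn_ge0// ltW.
  rewrite ler_wpM2l// exprM; apply: lerXn2r; rewrite ?nnegrE//; exact: ltW.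
have h1 := ler_wpM2l (mulr_ge0 (ler0n R m1) (ler0n R k)) n2.
have h2 := ler_peMr (ler0n R m) L1.
rewrite natrD !natrM mulrDl.
by move: h1 h2; move: (m%:R) (m1%:R) (n%:R) (k%:R) (ln Y) => a b c e l h1 h2; lra.
Qed.

Lemma le_of_pow (n : nat) (x y : R) : (0 < n)%N -> 0 <= x -> 0 <= y ->
  x ^+ n <= y ^+ 2 -> x <= y `^ (2 / n%:R).
Proof.
move=> n0 x0 y0 h; have nR : n%:R != 0 :> R by rewrite pnatr_eq0 -lt0n.
have -> : x = (x ^+ n) `^ n%:R^-1.
  by rewrite -powR_mulrn// -powRrM mulfV// powRr1.
rewrite powRrM powR_mulrn//; apply: ge0_ler_powR => //.
- by rewrite nnegrE exprn_ge0.
- by rewrite nnegrE exprn_ge0.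
Qed.

Definition outer_const (p : nat) : R := 4 * p.+1%:R ^+ (2 * p + 2) * 2 ^+ p.

(** While the gap exceeds [eps], A is at most R0^2/(2 eps). Inserted into the growth estimate this
    gives R0^4 R0^(2(p-1)) = (R0^(p+1))^2, the square of the quantity under the rate. *)
Lemma outer_arith (p n : nat) (Lf R0 eps k A : R) : (0 < p)%N -> 0 < Lf -> 0 < R0 -> 0 < eps ->
  0 <= k -> 0 <= A -> A * eps <= R0 ^+ 2 / 2 ->
  k ^+ n * growth_const p (2 * Lf) ^+ 2 <=
    p.+1%:R ^+ (2 * p + 2) * A ^+ 2 * (49 / 33 * R0 ^+ 2) ^+ p.-1 ->
  k ^+ n <= (outer_const p * (Lf * R0 ^+ p.+1 / eps)) ^+ 2.
Proof.
move=> p0 Lf0 R00 e0 k0 A0 hA; rewrite /growth_const.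
set f : R := (p.-1)`!%:R.
have f1 : 1 <= f by rewrite ler1n fact_gt0.
have f0 : 0 < f by apply: lt_le_trans f1.
set Q : R := p.+1%:R ^+ (2 * p + 2).
have Q1 : 1 <= Q by rewrite exprn_ege1// ler1n.
set K := k ^+ n; have K0 : 0 <= K by exact: exprn_ge0.
set S := (49 / 33 * R0 ^+ 2) ^+ p.-1 => h.
have R2 : 0 < R0 ^+ 2 by rewrite exprn_gt0.
have hS : S <= 2 ^+ p * (R0 ^+ 2) ^+ p.-1.
  rewrite /S exprMn; apply: ler_wpM2r; first by rewrite exprn_ge0// ltW.
  apply: (@le_trans _ _ (2 ^+ p.-1)); first by apply: lerXn2r; rewrite ?nnegrE//; lra.
  by rewrite ler_weXn2l ?ler1n// leq_pred.
have S0 : 0 <= S by rewrite exprn_ge0// mulr_ge0// ltW.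
have h1 : K * (f / (2 * (2 * Lf))) ^+ 2 = K * f ^+ 2 / (16 * Lf ^+ 2).
  by field; rewrite gt_eqF.
rewrite h1 ler_pdivrMr ?mulr_gt0 ?exprn_gt0// in h.
have h2 : K <= K * f ^+ 2 by rewrite ler_peMr// exprn_ege1.
have hA2 : (A * eps) ^+ 2 <= (R0 ^+ 2 / 2) ^+ 2.
  by apply: lerXn2r => //; rewrite nnegrE ?mulr_ge0 ?divr_ge0 ?exprn_ge0// ltW.
have E : (outer_const p * (Lf * R0 ^+ p.+1 / eps)) ^+ 2 =
    (16 * Q ^+ 2 * (2 ^+ p) ^+ 2 * Lf ^+ 2 * ((R0 ^+ 2) ^+ 2 * (R0 ^+ 2) ^+ p.-1)) / eps ^+ 2.
  have -> : (R0 ^+ 2) ^+ 2 * (R0 ^+ 2) ^+ p.-1 = (R0 ^+ p.+1) ^+ 2.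
    by rewrite -exprD -exprM add2n prednK// mulnC exprM.
  by rewrite /outer_const -/Q; field; rewrite gt_eqF.
rewrite E ler_pdivlMr ?exprn_gt0//.
have h3 : K * eps ^+ 2 <= Q * (A * eps) ^+ 2 * S * (16 * Lf ^+ 2).
  have := ler_wpM2r (sqr_ge0 eps) (le_trans h2 h); rewrite exprMn => /le_trans; apply.
  by rewrite le_eqVlt; apply/orP; left; apply/eqP; ring.
apply: (le_trans h3).
set P := 2 ^+ p in hS *; set V := (R0 ^+ 2) ^+ p.-1 in hS *.
have P1 : 1 <= P by rewrite exprn_ege1// ler1n.
have V0 : 0 <= V by rewrite exprn_ge0// ltW.
have h4 : (A * eps) ^+ 2 * S <= (R0 ^+ 2) ^+ 2 * (P * V).
  apply: ler_pM => //; rewrite ?sqr_ge0//.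
  apply: (le_trans hA2); rewrite expr_div_n ler_pdivrMr ?exprn_gt0//.
  by rewrite ler_peMr ?sqr_ge0// exprn_ege1// ler1n.
have Q0 : 0 <= Q by lra. have P0 : 0 <= P by lra.
have h5 : Q * P <= Q ^+ 2 * P ^+ 2.
  by rewrite -exprMn ler_eXnr// mulr_ege1.
have L0 : 0 <= Lf ^+ 2 by rewrite sqr_ge0.
have W0 : 0 <= (R0 ^+ 2) ^+ 2 * V * (16 * Lf ^+ 2).
  by apply: mulr_ge0; apply: mulr_ge0 => //; exact: sqr_ge0.
have h6 := ler_wpM2r W0 h5.
have h7 : Q * ((A * eps) ^+ 2 * S) * (16 * Lf ^+ 2) <= Q * ((R0 ^+ 2) ^+ 2 * (P * V)) * (16 * Lf ^+ 2).
  by apply: ler_wpM2r; [rewrite mulr_ge0|apply: ler_wpM2l].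
rewrite -[Q * _ * S]mulrA; apply: (le_trans h7).
apply: le_trans (eq_ind _ (fun t => t <= _) h6 _ _) _; first by ring.
by rewrite le_eqVlt; apply/orP; left; apply/eqP; ring.
Qed.

Lemma rate_ge1 (p : nat) (L R0 eps : R) : 0 < eps -> eps <= L * R0 ^+ p.+1 -> 1 <= rate p L R0 eps.
Proof.
move=> e0 h; have h1 : 1 `^ (2 / (3 * p + 1)%:R) = 1 :> R by rewrite powR1.
rewrite /rate -[X in X <= _]h1.
apply: ge0_ler_powR; rewrite ?nnegrE ?divr_ge0//.
  by apply: le_trans h; exact: ltW.
  exact: ltW.
by rewrite ler_pdivlMr// mul1r.
Qed.

Lemma grad_lip_poly (p : nat) (ell Lg B r Y : R) : 0 <= ell -> 1 <= Y -> 0 <= Lg <= Y ->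
  0 <= B <= Y -> 0 <= r <= Y ->
  grad_lip p Lg B (ell * Lg) r <= ((4 * 5 ^+ p + ell) * 19 ^+ p) * Y ^+ (2 * p + 1).
Proof.
move=> l0 Y1 /andP[g0 gY] /andP[b0 bY] /andP[r0 rY].
have Y0 : 0 <= Y by lra.
have Yp : 1 <= Y ^+ p by rewrite exprn_ege1.
have h1 : (1 + 4 * r) ^+ p <= 5 ^+ p * Y ^+ p.
  by rewrite -exprMn; apply: lerXn2r; rewrite ?nnegrE; lra.
have h2 : (1 + 18 * r) ^+ p <= 19 ^+ p * Y ^+ p.
  by rewrite -exprMn; apply: lerXn2r; rewrite ?nnegrE; lra.
have x1 : 0 <= (1 + 4 * r) ^+ p by rewrite exprn_ge0//; lra.
have x2 : 0 <= (1 + 18 * r) ^+ p by rewrite exprn_ge0//; lra.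
have h3 : (B + Lg) * (1 + 4 * r) ^+ p <= 2 * Y * (5 ^+ p * Y ^+ p).
  by apply: ler_pM => //; lra.
have h4 : ell * Lg <= ell * (Y * Y ^+ p).
  by apply: ler_wpM2l => //; apply: (le_trans gY); rewrite ler_peMr.
have h5 : 2 * ((B + Lg) * (1 + 4 * r) ^+ p) + ell * Lg <= (4 * 5 ^+ p + ell) * (Y * Y ^+ p).
  by move: h3 h4; move: (5 ^+ p) (Y ^+ p) (_ * (1 + _) ^+ p) (ell * Lg) => a b c e h3 h4; lra.
rewrite /grad_lip; apply: (@le_trans _ _ ((4 * 5 ^+ p + ell) * (Y * Y ^+ p) * (19 ^+ p * Y ^+ p))).
  by apply: ler_pM => //; rewrite addr_ge0 ?mulr_ge0// addr_ge0.
rewrite mul2n -addnn !exprD expr1.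
by rewrite le_eqVlt; apply/orP; left; apply/eqP; ring.
Qed.

End Constants.

(** * Assembling the counts *)

Section FinalCounts.
Context {R : realType}.

Lemma sub_lip_le (p : nat) (Lf Lg : R) : 0 <= Lf -> Lf <= Lg ->
  sub_lip p Lf Lg <= sub_lip p 1 1 * Lg.
Proof.
move=> L0 LL; rewrite /sub_lip.
have k0 : 0 <= 2 / p`!%:R * (2 * p + 1)%:R ^+ p.+1 :> R by rewrite mulr_ge0 ?divr_ge0.
have -> : 2 * Lf / p`!%:R * (2 * p + 1)%:R ^+ p.+1 = 2 / p`!%:R * (2 * p + 1)%:R ^+ p.+1 * Lf by ring.
rewrite mulr1; move: (2 / _ * _) k0 => k k0.
by rewrite [leRHS]mulrDl mul1r lerD2r ler_wpM2l.
Qed.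

Lemma nf_arith (Q T J : nat) (a r t D Lam : R) (b : nat) : 0 <= a -> 0 <= t -> 0 <= D ->
  1 <= r -> 1 <= Lam -> Q%:R <= a * r -> T%:R <= t * Lam ^+ b -> J%:R <= D * Lam ->
  (Q.+2 * (T * J.+2))%:R <= (a + 2) * t * (D + 2) * r * Lam ^+ b.+1.
Proof.
move=> a0 t0 D0 r1 L1 hQ hT hJ.
have h1 : Q.+2%:R <= (a + 2) * r by rewrite -addn2 natrD mulrDl; lra.
have h2 : J.+2%:R <= (D + 2) * Lam by rewrite -addn2 natrD mulrDl; lra.
rewrite !natrM; apply: (@le_trans _ _ (((a + 2) * r) * ((t * Lam ^+ b) * ((D + 2) * Lam)))).
  by apply: ler_pM => //; apply: ler_pM.
by rewrite exprSr le_eqVlt; apply/orP; left; apply/eqP; ring.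
Qed.

(** Intended for x = (Lg/Lf)^(2/(3p+1)) and y the rate for [f], so that y x is the rate for [g]; N
    is the length of a restart and n the bound for [fw_nf]. *)
Lemma ng_arith (N T n : nat) (x y c3 t K Lam : R) (b : nat) : 0 <= c3 -> 0 <= t -> 0 <= K ->
  1 <= x -> 0 <= y -> 1 <= Lam -> N%:R <= c3 * x + 1 -> T%:R <= t * Lam ^+ b ->
  n%:R <= K * y * Lam ^+ b.+1 ->
  ((N * T.+1) * n)%:R <= K * ((c3 + 1) * (t + 1)) * (y * x) * Lam ^+ (2 * b + 1).
Proof.
move=> c0 t0 K0 x1 y0 L1 hN hT hn.
have Lb : 1 <= Lam ^+ b by rewrite exprn_ege1.
have h1 : N%:R <= (c3 + 1) * x by rewrite mulrDl; lra.
have h2 : T.+1%:R <= (t + 1) * Lam ^+ b by rewrite -natr1 mulrDl; lra.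
rewrite !natrM; apply: (@le_trans _ _ (((c3 + 1) * x) * ((t + 1) * Lam ^+ b) * (K * y * Lam ^+ b.+1))).
  by apply: ler_pM => //; apply: ler_pM.
have -> : (2 * b + 1 = b + b.+1)%N by rewrite mul2n -addnn addn1 addnS.
by rewrite exprD le_eqVlt; apply/orP; left; apply/eqP; ring.
Qed.

Lemma accuracy_poly (K G r eps Y : R) (n : nat) (M : R) : 0 <= K -> 0 <= M -> M <= G * Y ^+ n ->
  1 <= Y -> 0 <= r <= Y -> 0 < eps -> eps^-1 <= Y ->
  144 * K * M * r ^+ 2 / eps <= 144 * K * G * Y ^+ (n + 3).
Proof.
move=> K0 M0 hM Y1 /andP[r0 rY] e0 eY.
have Y0 : 0 <= Y by lra.
have r2 : r ^+ 2 <= Y ^+ 2 by apply: lerXn2r.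
apply: (@le_trans _ _ (144 * K * (G * Y ^+ n) * Y ^+ 2 * Y)).
  apply: ler_pM => //; first by rewrite !mulr_ge0 ?sqr_ge0.
    by rewrite invr_ge0 ltW.
  apply: ler_pM => //; rewrite ?sqr_ge0 ?mulr_ge0//.
  by apply: ler_wpM2l => //; rewrite mulr_ge0.
by rewrite exprD le_eqVlt; apply/orP; left; apply/eqP; ring.
Qed.

Lemma ln_ge1 (Y : R) : expR 1 <= Y -> 1 <= ln Y.
Proof.
move=> h; rewrite -[X in X <= _]expRK ler_ln// posrE ?expR_gt0//.
by apply: lt_le_trans h; exact: expR_gt0.
Qed.

End FinalCounts.

(** Cost bounds on all executions say nothing about a framework that gets stuck; the second
    conclusion excludes this. It starts where no candidate has been tried, since poor choices of
    lambda can exhaust the budget T within an iteration. *)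
Theorem theorem4 (R : realType) (p : nat) (hp : (1 <= p)%N) :
  exists mu0 ell0 : R, [/\ 0 < mu0, 0 < ell0 &
  forall (mu ell : R) (b : nat), 0 < mu <= mu0 -> ell0 <= ell ->
  exists (C : R) (c T0 : nat),
  forall (d : nat) (f g : 'rV[R]_d -> R) (Lf Lg : R) (x0 xs : 'rV[R]_d)
         (eps B : R) (T : nat),
  convex_fun f -> convex_fun g ->
  lip_deriv p Lf f -> lip_deriv p Lg g ->
  0 < Lf -> Lf < Lg ->
  is_argmin (fun v => f v + g v) xs ->
  let R0 := enorm (x0 - xs) in
  0 < eps <= Lf * R0 ^+ p.+1 ->
  0 <= B -> deriv_bound p B f x0 -> deriv_bound p B g x0 ->
  let Lam := log_factor eps R0 Lf Lg B in
  (T0 <= T)%N -> T%:R <= T0%:R * Lam ^+ b ->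
  let reached := eps_reached (fun v => f v + g v) xs eps in
  let exec := fw_exec reached p f g (2 * Lf) (mu * Lf) (ell * Lg) T in
  (forall s, exec (fw_init x0) s ->
     (fw_nf s)%:R <= C * rate p Lf R0 eps * Lam ^+ c /\
     (fw_ng s)%:R <= C * rate p Lg R0 eps * Lam ^+ c) /\
  (forall A x y nf ng, exec (fw_init x0) (Outer A x y 0 nf ng) ->
     exists2 s, exec (Outer A x y 0 nf ng) s & reached s)].
Proof.
(* By homogeneity [mu0 * Lf] is the convexity constant for H = 2 Lf. The factor 2 in [ell0] is the
   requirement H >= 2 L of the inner CATD. *)
pose mu0 : R := model_sigma p 2; pose ell0 : R := 2 * sub_lip p 1 1.
have mu00 : 0 < mu0 by exact: model_sigma_gt0.
have sl0 : 0 < sub_lip p 1 1 :> R.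
  by rewrite /sub_lip ltr_wpDl// mulr_ge0 ?divr_ge0// exprn_ge0.
exists mu0, ell0; split=> //; first by rewrite mulr_gt0.
move=> mu ell b /andP[mup mule] ellle.
have ellp : 0 < ell by apply: lt_le_trans ellle; rewrite mulr_gt0.
pose e : R := 2 / (3 * p + 1)%:R.
have e0 : 0 <= e by rewrite divr_ge0.
pose c2 : R := p.+1%:R * catd_const p * 2 ^+ p.+1 * (ell / mu).
have c20 : 0 <= c2.
  by rewrite /c2 mulr_ge0 ?divr_ge0 ?ltW// !mulr_gt0 ?catd_const_gt0 ?exprn_gt0// ltr0n.
pose c1 : R := outer_const p `^ e.
pose G : R := (4 * 5 ^+ p + ell) * 19 ^+ p.
(* This is [j0]+2 for [j0] = 4p, which satisfies 4p <= 2^(4p). *)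
pose t : R := (4 * p + 2)%:R.
have [D D0 hD] := pow2_ln (144 * (4 * p * p.+1)%:R * G) (2 * p + 1 + 3).
pose K : R := (c1 + 2) * t * (D + 2).
have c10 : 0 <= c1 by exact: powR_ge0.
have t0 : 0 <= t by [].
have K0 : 0 <= K by rewrite /K !mulr_ge0 ?addr_ge0.
have c30 : 0 <= c2 `^ e by exact: powR_ge0.
exists (K * ((c2 `^ e + 1) * (t + 1))), (2 * b + 1)%N, (4 * p + 2)%N.
move=> d f g Lf Lg x0 xs eps B T cf cg hf hg Lf0 Lfg mxs R0 /andP[eps0 epsR] B0 Bf Bg Lam hT1 hT2 reached exec.
have R00 : 0 <= R0 by exact: enorm_ge0.
have R0p : 0 < R0.
  rewrite lt_def R00 andbT; apply/eqP => E.
  by move: (lt_le_trans eps0 epsR); rewrite E expr0n mulr0 ltxx.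
have Lg0 : 0 < Lg by apply: lt_trans Lfg.
pose Y := expR 1 + eps^-1 + R0 + Lf^-1 + Lg + B.
have i1 : 0 <= eps^-1 by rewrite invr_ge0 ltW.
have i2 : 0 <= Lf^-1 by rewrite invr_ge0 ltW.
have x1 : 1 <= expR 1 :> R by rewrite -[X in X <= _]expR0 ler_expR.
have Y1 : 1 <= Y by rewrite /Y; lra.
have eY : eps^-1 <= Y by rewrite /Y; lra.
have rY : 0 <= R0 <= Y by rewrite R00 /= /Y; lra.
have gY : 0 <= Lg <= Y by rewrite (ltW Lg0) /= /Y; lra.
have bY : 0 <= B <= Y by rewrite B0 /= /Y; lra.
have xY : expR 1 <= Y by rewrite /Y; lra.
have Lam1 : 1 <= Lam by exact: ln_ge1.
have [J [hJ1 hJ2]] := hD Y xY.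
have Hin0 : 0 < ell * Lg by rewrite mulr_gt0.
have s0 : 0 < mu * Lf by rewrite mulr_gt0.
have hH : 2 * sub_lip p Lf Lg <= ell * Lg.
  have h := sub_lip_le p (ltW Lf0) (ltW Lfg).
  apply: (@le_trans _ _ (ell0 * Lg)); last by rewrite ler_pM2r.
  by rewrite /ell0 -mulrA ler_pM2l.
have hs : mu * Lf <= model_sigma p (2 * Lf).
  have -> : model_sigma p (2 * Lf) = mu0 * Lf by rewrite /mu0 /model_sigma; ring.
  by rewrite ler_pM2r.
have M0 : 0 <= grad_lip p Lg B (ell * Lg) R0.
  rewrite /grad_lip mulr_ge0 ?exprn_ge0 ?addr_ge0 ?mulr_ge0 ?exprn_ge0 ?addr_ge0 ?mulr_ge0 ?(ltW Lg0) ?(ltW ellp)//.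
have hJ : 144 * (4 * p * p.+1)%:R * grad_lip p Lg B (ell * Lg) R0 * R0 ^+ 2 / eps <= 2 ^+ J.
  apply: le_trans hJ1.
  have := grad_lip_poly p (ltW ellp) Y1 gY bY rY => hM.
  exact: accuracy_poly.
(* With the rate at least 1, additive constants can be absorbed into it. *)
have r1 := rate_ge1 eps0 epsR.
pose Q := Num.trunc (c1 * rate p Lf R0 eps).
have a0 : 0 <= c1 * rate p Lf R0 eps by rewrite mulr_ge0// ?powR_ge0.
have hQ0 : Q%:R <= c1 * rate p Lf R0 eps by rewrite truncn_le.
have hQ k A x y : ms_inv p (growth_const p (2 * Lf)) (fun v => f v + g v) xs R0 k A x y ->
    eps < (fun v => f v + g v) y - (fun v => f v + g v) xs -> (k <= Q)%N.
  move=> hi hF; rewrite truncn_ge_nat//.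
  have [A0 _ _] := hi; have kp := growth_const_gt0 p (mulr_gt0 (ltr0n R 2 : 0 < 2 = true) Lf0).
  have [h1 h2] := ms_inv_rate hp kp mxs hi R0p.
  have h3 : A * eps <= R0 ^+ 2 / 2 by apply: le_trans h1; apply: ler_wpM2l => //; exact: ltW.
  have h4 := outer_arith hp Lf0 R0p eps0 (ler0n R k) A0 h3 h2.
  have oc : 0 <= outer_const p :> R by rewrite /outer_const !mulr_ge0 ?exprn_ge0.
  have rr : 0 <= Lf * R0 ^+ p.+1 / eps by rewrite divr_ge0 ?mulr_ge0 ?exprn_ge0// ltW.
  rewrite /c1 /rate -powRM//; apply: le_of_pow h4 => //; first by rewrite addn1.
  exact: mulr_ge0.
(* The radius 0 is a placeholder: the length is the same for all radii. *)
pose N := restart_steps p p.+1 (ell * Lg) (mu * Lf) 0.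
have hM : (0 < N * T.+1)%N /\ forall r, (restart_steps p p.+1 (ell * Lg) (mu * Lf) r * T.+1 <= N * T.+1)%N.
  rewrite /N; split=> [|r]; last by rewrite !restart_stepsE.
  by rewrite muln_gt0 restart_stepsE leq_max orbT.
have df x := ndifferentiable1 hp hf.1 x.
have dg x := ndifferentiable1 hp hg.1 x.
have gf := convex_grad_convex cf df.
have gg := convex_grad_convex cg dg.
have q1 : 1 <= (Lg / Lf) `^ e.
  have h1 : 1 `^ e = 1 :> R by rewrite powR1.
  rewrite -[X in X <= _]h1; apply: ge0_ler_powR; rewrite ?nnegrE ?divr_ge0// ?ltW//.
  by rewrite ltr_pdivlMr// mul1r.
have qr : rate p Lg R0 eps = rate p Lf R0 eps * (Lg / Lf) `^ e.
  rewrite /rate -/e -powRM ?divr_ge0 ?mulr_ge0 ?exprn_ge0 ?(ltW Lf0) ?(ltW Lg0) ?(ltW eps0)//.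
  by congr (_ `^ _); field; rewrite !gt_eqF.
have hN : N%:R <= c2 `^ e * (Lg / Lf) `^ e + 1.
  apply: (le_trans (restart_steps_le _ _ _ _)); rewrite lerD2r -powRM ?divr_ge0 ?(ltW Lf0) ?(ltW Lg0)//.
  rewrite le_eqVlt; apply/orP; left; apply/eqP; congr (_ `^ _).
  by rewrite /restart_ratio /c2; field; rewrite !gt_eqF.
have inv s : exec (fw_init x0) s ->
    exists k, fw_inv p Lf R0 f g xs T J Q (N * T.+1) k s.
  exact: (fw_inv_exec hp Lf0 Lfg B0 eps0 hf gf hg gg Bf Bg mxs R0p (lexx _) s0 hs Hin0 hH hJ hQ hM).
split=> [s /inv [k /fw_inv_counts [h1 h2]]|A x y nf ng /inv [k hk]]; last first.
  have hj0 : (4 * p <= 2 ^ (4 * p))%N by rewrite ltnW// ltn_expl.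
  have hjT : ((4 * p).+2 <= T)%N by rewrite -addn2.
  have hl c : lip_deriv p (ell * Lg) (subproblem p (2 * Lf) f g c).
    apply: (lip_deriv_le (lip_deriv_sub Lf0 hf hg c)); apply: le_trans hH.
    have sl : 0 <= sub_lip p Lf Lg.
      by rewrite /sub_lip addr_ge0 ?(ltW Lg0)// mulr_ge0 ?exprn_ge0// divr_ge0// mulr_ge0// ltW.
    lra.
  exact: (outer_progress hp Lf0 Lfg B0 eps0 hf gf hg gg Bf Bg mxs R0p (lexx _) s0 hs Hin0 hH hJ hQ hM hj0 hjT hl hk).
have hn := nf_arith c10 t0 D0 r1 Lam1 hQ0 hT2 hJ2.
have hn2 := ng_arith c30 t0 K0 q1 (le_trans ler01 r1) Lam1 hN hT2 hn.
rewrite -qr in hn2; split.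
  have h3 : (fw_nf s)%:R <= (Q.+2 * (T * J.+2))%:R :> R by rewrite ler_nat.
  apply: (le_trans h3); apply: (le_trans hn).
  have LL : Lam ^+ b.+1 <= Lam ^+ (2 * b + 1) by rewrite ler_weXn2l// addn1 ltnS mul2n -addnn leq_addl.
  have r0 : 0 <= rate p Lf R0 eps by exact: powR_ge0.
  rewrite -/K; apply: (@le_trans _ _ (K * rate p Lf R0 eps * Lam ^+ (2 * b + 1))).
    by apply: ler_wpM2l LL; exact: mulr_ge0.
  apply: ler_wpM2r; first by rewrite exprn_ge0// (le_trans ler01).
  by apply: ler_wpM2r => //; rewrite ler_peMr// mulr_ege1// lerDr.
have h3 : (fw_ng s)%:R <= (N * T.+1 * (Q.+2 * (T * J.+2)))%:R :> R by rewrite ler_nat.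
exact: le_trans h3 hn2.
Qed.
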